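(* Let $m,n\ge1$ and let $u$ be a unitary $mn\times mn$ complex matrix. The C*-envelope of the unitary relation algebra $\mathcal{A}_u$ is the generalised Cuntz algebra $\mathcal{O}_{X_u}$ (via the canonical map carrying $L_{e_i}$, $L_{f_j}$ to the corresponding universal generators of $\mathcal{O}_{X_u}$). In particular, for every permutation $\theta$ of $\{1,\dots,m\}\times\{1,\dots,n\}$, the C*-envelope of $\mathcal{A}_\theta$ is $C^*(\mathbb{F}_\theta^+)$. Also, each tail representation $\lambda_\tau$ extends to a faithful representation of $\mathcal{O}_{X_u}$.
   Context: Let $u=(u_{(i,j),(i',j')})$ be a unitary matrix in $M_{mn}(\mathbb{C})$ with rows and columns indexed by $\{1,\dots,m\}\times\{1,\dots,n\}$. Let $E=\mathbb{C}^m$, $F=\mathbb{C}^n$ with standard orthonormal bases $e_1,\dots,e_m$ and $f_1,\dots,f_n$. Identify $E\otimes F$ with $F\otimes E$ unitarily by $e_i\otimes f_j=\sum_{i',j'}u_{(i,j),(i',j')}f_{j'}\otimes e_{i'}$. Iterating, every tensor product of $k$ copies of $E$ and $l$ copies of $F$ in any order is unambiguously identified with $E^{\otimes k}\otimes F^{\otimes l}$; this gives an associative multiplication $\otimes$ on the family (product system) $X_u=\{E^{\otimes k}\otimes F^{\otimes l}\}_{k,l\ge0}$. Let $\mathcal{H}_u=\bigoplus_{k,l\ge0}E^{\otimes k}\otimes F^{\otimes l}$ (with $E^{\otimes0}=F^{\otimes0}=\mathbb{C}$), and let $L_{e_i}\xi=e_i\otimes\xi$, $L_{f_j}\xi=f_j\otimes\xi$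 be the left creation operators on $\mathcal{H}_u$. The unitary relation algebra $\mathcal{A}_u$ is the norm closed unital algebra generated by the $L_{e_i}$ and $L_{f_j}$. A representation of $\mathbb{F}_u^+$ is given by operators $A_1,\dots,A_m$, $B_1,\dots,B_n$ on a Hilbert space with $A_iB_j=\sum_{i',j'}u_{(i,j),(i',j')}B_{j'}A_{i'}$. A $*$-representation is one in which the $A_i$ are isometries with $\sum_iA_iA_i^*=I$ and the $B_j$ are isometries with $\sum_jB_jB_j^*=I$. $\mathcal{O}_{X_u}$ is the universal C*-algebra generated by a $*$-representation of $\mathbb{F}_u^+$. For a permutation $\theta$ of $\{1,\dots,m\}\times\{1,\dots,n\}$, $\mathbb{F}_\theta^+$ is the unital semigroup generated by $e_1,\dots,e_m,f_1,\dots,f_n$ subject only to $e_if_j=f_{j'}e_{i'}$ whenever $\theta(i,j)=(i',j')$; $\mathcal{A}_\theta$ is the norm closed unital algebra generated by its left regular representation $\lambda(w)\xi_x=\xi_{wx}$ on $\ell^2(\mathbb{F}_\theta^+)$; and $C^*(\mathbb{F}_\theta^+)$ is the universal C*-algebra generated by a representation of $\mathbb{F}_\theta^+$ by isometries with $\sum_i\pi(e_i)\pi(e_i)^*=I=\sum_j\pi(f_j)\pi(f_j)^*$. These coincide with $\mathcal{A}_u$ and $\mathcal{O}_{X_u}$ for the permutation matrix $u$ with $u_{(i,j),(i',j')}=1$ if $\theta(i,j)=(i',j')$ and $0$ otherwise. Tail representations: a tail is an infinite word $\tau=e_{i_0}f_{j_0}e_{i_1}f_{j_1}\cdots$. Let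 $\mathcal{H}_s=\mathcal{H}_u$ for $s\ge0$ and let $\rho_s:\mathcal{H}_s\to\mathcal{H}_{s+1}$ be the isometry $\rho_s(\xi)=\xi\otimes e_{i_s}\otimes f_{j_s}$. Let $\mathcal{H}_\tau=\varinjlim(\mathcal{H}_s,\rho_s)$ (Hilbert space limit). Left creation operators commute with the $\rho_s$ and so induce isometries $\lambda_\tau(e_i),\lambda_\tau(f_j)$ on $\mathcal{H}_\tau$; this is a $*$-representation $\lambda_\tau$ of $\mathbb{F}_u^+$. The C*-envelope of a unital operator algebra $\mathcal{A}$ is the unique C*-algebra $C^*_{\mathrm{env}}(\mathcal{A})$ generated by a completely isometric copy of $\mathcal{A}$ such that no proper quotient of it is completely isometric on $\mathcal{A}$. *)

(* Defs.v *)
From HB Require Import structures.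
From mathcomp Require Import all_boot all_order all_algebra perm.
From mathcomp Require Import sesquilinear spectral complex.
From mathcomp Require Import ring lra.
From mathcomp Require Import all_classical all_reals all_analysis.

Set Implicit Arguments.
Unset Strict Implicit.
Unset Printing Implicit Defensive.

Import Order.TTheory GRing.Theory Num.Theory.
Import numFieldNormedType.Exports.

Local Open Scope classical_set_scope.
Local Open Scope ring_scope.

(* A complex Hilbert space is a complete normed module over R[i] whose norm comes
   from an inner product, linear in the first variable *)
HB.mixin Record isHilbert (R : realType) H & CompleteNormedModule R[i] H := {
  hdot : {dot H for Num.Def.conjC};
  hdot_norm : forall x : H, hdot x x = `|x| ^+ 2 }.

#[short(type="hilbertType")]
HB.structure Definition Hilbert (R : realType) :=
  {H of isHilbert R H & CompleteNormedModule R[i] H}.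

Arguments hdot {R s}.

Section norm_of_dot.
Variables (C : numClosedFieldType) (U : lmodType C) (dot : {dot U for Num.Def.conjC}).

Definition dnorm (x : U) : C := sqrtC (dot x x).

Lemma dnormK x : dnorm x ^+ 2 = dot x x.
Proof. by rewrite sqrtCK. Qed.

Lemma dot_CauchySchwarz x y : `|dot x y| <= dnorm x * dnorm y.
Proof.
have [->|y0] := eqVneq y 0.
  by rewrite linear0r normr0 mulr_ge0 ?sqrt_dnorm_ge0.
have yy : 0 < dot y y by rewrite dnorm_gt0.
pose a := dot x y / dot y y.
have /= := dnorm_ge0 dot (x - a *: y).
rewrite dnormB dnormZ linearZr_LR /=.
set d := dot x y; set e := dot y y in yy a *.
have ee : e^* = e by apply: conj_Creal; exact: ger0_real (ltW yy).
have e0 : e != 0 by rewrite gt_eqF.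
have aE : a^* = d^* / e by rewrite /a rmorphM fmorphV /= ee.
rewrite aE rmorphM fmorph_div /= conjCK ee.
rewrite /a normf_div (ger0_norm (ltW yy)) exprMn exprVn normCK.
have -> : dot x x + d * d^* / e ^+ 2 * e - (d^* / e * d + d / e * d^*)
   = dot x x - `|d| ^+ 2 / e.
  by rewrite normCK; field.
rewrite subr_ge0 ler_pdivrMr// => h.
rewrite -(@ler_pXn2r _ 2)// ?nnegrE ?mulr_ge0 ?sqrt_dnorm_ge0//.
by rewrite exprMn !dnormK.
Qed.

Lemma dnorm_triangle x y : dnorm (x + y) <= dnorm x + dnorm y.
Proof.
have X0 z : 0 <= dnorm z := sqrt_dnorm_ge0 dot z.
rewrite -(@ler_pXn2r _ 2)// ?nnegrE ?addr_ge0//.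
rewrite dnormK dnormD sqrrD !dnormK [leRHS]addrAC lerD2l.
move: (dot x y) (dot_CauchySchwarz x y) => d h.
rewrite (@le_trans _ _ (`|d| *+ 2))//; last by rewrite lerMn2r /= h.
have : d + d^* \is Num.real by rewrite CrealE rmorphD /= conjCK addrC.
move=> /real_ler_norm /le_trans; apply.
by rewrite (le_trans (ler_normD _ _))// norm_conjC mulr2n.
Qed.

Lemma dnormZ_sqrt (a : C) x : dnorm (a *: x) = `|a| * dnorm x.
Proof.
apply/eqP; rewrite -(@eqrXn2 _ 2)// ?mulr_ge0 ?sqrt_dnorm_ge0//.
by rewrite exprMn !dnormK dnormZ.
Qed.

Lemma dnorm0_eq0 x : dnorm x = 0 -> x = 0.
Proof. by move=> /eqP; rewrite sqrt_dnorm_eq0 => /eqP. Qed.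

End norm_of_dot.

Section unordered_sums.
Variables (R : realType) (S : choiceType).
Implicit Types (h p q : S -> R) (f g : S -> R[i]).

Definition rsummable h := (\esum_(s in [set: S]) (`|h s|)%:E < +oo)%E.

(* Unordered sums of summable real and complex families *)
Definition rsum h : R :=
  fine (\esum_(s in [set: S]) (Num.max (h s) 0)%:E) -
  fine (\esum_(s in [set: S]) (Num.max (- h s) 0)%:E).

Definition csum f : R[i] :=
  Complex (rsum (fun s => complex.Re (f s))) (rsum (fun s => complex.Im (f s))).

Lemma rsummable_le p q : (forall s, `|p s| <= `|q s|) ->
  rsummable q -> rsummable p.
Proof. by move=> pq; apply: le_lt_trans; apply: le_esum => s _; rewrite lee_fin. Qed.

Lemma rsummableD p q : rsummable p -> rsummable q ->
  rsummable (fun s => p s + q s).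
Proof.
move=> hp hq; apply: le_lt_trans (lte_add_pinfty hp hq).
rewrite -esumD; [|by move=> *; rewrite lee_fin..].
by apply: le_esum => s _; rewrite -EFinD lee_fin ler_normD.
Qed.

Lemma esumZ (c : R) p : 0 <= c -> (forall s, 0 <= p s) ->
  (\esum_(s in [set: S]) (c * p s)%:E =
   c%:E * \esum_(s in [set: S]) (p s)%:E)%E.
Proof.
move=> c0 p0.
have le_ (a : R) q : 0 <= a -> (forall s, 0 <= q s) ->
    (\esum_(s in [set: S]) (a * q s)%:E <=
     a%:E * \esum_(s in [set: S]) (q s)%:E)%E.
  move=> a0 q0; apply: ge_ereal_sup => _ [X [finX _] <-].
  under eq_fsbigr do rewrite EFinM.
  rewrite -ge0_mule_fsumr; last by move=> *; rewrite lee_fin.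
  apply: lee_wpmul2l; rewrite ?lee_fin//.
  by apply: ereal_sup_ubound; exists X.
apply/eqP; rewrite eq_le le_//=.
have [->|cn0] := eqVneq c 0.
  by rewrite mul0e; apply: esum_ge0 => s _; rewrite mul0r.
have ci : 0 <= c^-1 by rewrite invr_ge0.
have := @le_ c^-1 (fun s => c * p s) ci (fun s => mulr_ge0 c0 (p0 s)).
under eq_esum do rewrite mulKf//.
move=> /(lee_wpmul2l (x:=c%:E)); rewrite lee_fin => /(_ c0).
by rewrite muleA -EFinM divff// mul1e.
Qed.


Let E p : \bar R := (\esum_(s in [set: S]) (p s)%:E)%E.

Lemma esum_fin p : (forall s, 0 <= p s) -> rsummable p -> E p \is a fin_num.
Proof.
move=> p0; rewrite /rsummable => h; rewrite ge0_fin_numE.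
  by apply: le_lt_trans h; apply: le_esum => s _; rewrite lee_fin ler_norm.
by apply: esum_ge0 => s _; rewrite lee_fin.
Qed.

Lemma rsum_diff h p q : (forall s, 0 <= p s) -> (forall s, 0 <= q s) ->
  rsummable p -> rsummable q -> (forall s, h s = p s - q s) ->
  rsum h = fine (E p) - fine (E q).
Proof.
move=> p0 q0 sp sq hpq.
have m0 (x : R) : 0 <= Num.max x 0 by rewrite le_max lexx orbT.
have sh : rsummable (fun s => p s + q s) by exact: rsummableD.
have s1 : rsummable (fun s => Num.max (h s) 0).
  apply: rsummable_le sh => s; rewrite ger0_norm// ger0_norm ?addr_ge0//.
  by rewrite ge_max addr_ge0// hpq andbT lerD2l ge0_cp.
have s2 : rsummable (fun s => Num.max (- h s) 0).
  apply: rsummable_le sh => s; rewrite ger0_norm// ger0_norm ?addr_ge0//.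
  by rewrite ge_max addr_ge0// hpq andbT opprB addrC lerD2r ge0_cp.
have EQ : (E (fun s => Num.max (h s) 0)%R + E q = E (fun s => Num.max (- h s) 0)%R + E p)%E.
  rewrite /E -!esumD; try by move=> *; rewrite lee_fin.
  apply: eq_esum => s _; rewrite -!EFinD; congr EFin; rewrite hpq.
  by rewrite /Num.max; do 2!case: ifPn; rewrite -?leNgt; lra.
have f1 := esum_fin (fun s => m0 (h s)) s1.
have f2 := esum_fin (fun s => m0 (- h s)) s2.
have f3 := esum_fin p0 sp.
have f4 := esum_fin q0 sq.
move: (congr1 fine EQ); rewrite !fineD// /rsum -!/(E _) => {}EQ; lra.
Qed.

Lemma eq_rsum p q : (forall s, p s = q s) -> rsum p = rsum q.
Proof. by move=> /funext ->. Qed.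

Lemma rsumD p q : rsummable p -> rsummable q ->
  rsum (fun s => p s + q s) = rsum p + rsum q.
Proof.
have m0 (x : R) : 0 <= Num.max x 0 by rewrite le_max lexx orbT.
have sm h : rsummable h -> rsummable (fun s => Num.max (h s) 0).
  apply: rsummable_le => s; rewrite ger0_norm//.
  by rewrite ge_max normr_ge0 ler_norm.
have smN h : rsummable h -> rsummable (fun s => Num.max (- h s) 0).
  move=> hs; apply: sm; apply: rsummable_le hs => s; by rewrite normrN.
have maxB (x : R) : x = Num.max x 0 - Num.max (- x) 0.
  by rewrite /Num.max; do 2!case: ifPn; rewrite -?leNgt; lra.
move=> sp sq.
rewrite (@rsum_diff _ (fun s => Num.max (p s) 0 + Num.max (q s) 0)
   (fun s => Num.max (- p s) 0 + Num.max (- q s) 0)).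
- have F h : rsummable h ->
     E (fun s => Num.max (h s) 0) \is a fin_num /\
     E (fun s => Num.max (- h s) 0) \is a fin_num.
    by move=> sh; split; apply: esum_fin => //; [exact: sm|exact: smN].
  have [a b] := F _ sp; have [c d] := F _ sq.
  rewrite {1 2}/E; under eq_esum do rewrite EFinD.
  under [X in _ - fine X]eq_esum do rewrite EFinD.
  rewrite !esumD; try by move=> *; rewrite lee_fin.
  by rewrite !fineD// /rsum; lra.
- by move=> s; rewrite addr_ge0.
- by move=> s; rewrite addr_ge0.
- by apply: rsummableD; exact: sm.
- by apply: rsummableD; exact: smN.
- by move=> s; rewrite {1}(maxB (p s)) {1}(maxB (q s)); lra.
Qed.

Lemma rsumZ c p : rsummable p -> rsum (fun s => c * p s) = c * rsum p.
Proof.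
have m0 (x : R) : 0 <= Num.max x 0 by rewrite le_max lexx orbT.
move=> sp.
have maxZ (a x : R) : 0 <= a -> Num.max (a * x) 0 = a * Num.max x 0.
  by move=> a0; rewrite maxr_pMr// mulr0.
have [c0|c0] := leP 0 c.
  rewrite /rsum.
  under eq_esum do rewrite maxZ//.
  under [X in _ - fine X]eq_esum do rewrite -mulrN maxZ//.
  rewrite !esumZ// !fineM ?mulrBr//; apply: esum_fin => //.
  - by apply: rsummable_le sp => s; rewrite ger0_norm// ge_max normr_ge0 -normrN ler_norm.
  - by apply: rsummable_le sp => s; rewrite ger0_norm// ge_max normr_ge0 ler_norm.
have nc : 0 <= - c by rewrite oppr_ge0 ltW.
rewrite /rsum.
under eq_esum do rewrite -mulrNN maxZ//.
under [X in _ - fine X]eq_esum do rewrite -mulNr maxZ//.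
rewrite !esumZ// !fineM//=; first by lra.
apply: esum_fin => //.
  by apply: rsummable_le sp => s; rewrite ger0_norm// ge_max normr_ge0 ler_norm.
apply: esum_fin => //.
by apply: rsummable_le sp => s; rewrite ger0_norm// ge_max normr_ge0 -normrN ler_norm.
Qed.

Lemma rsum_ge0E p : (forall s, 0 <= p s) -> rsum p = fine (E p).
Proof.
move=> p0; rewrite /rsum.
rewrite [X in _ - fine X]esum1 ?subr0; last first.
  by move=> s _; congr EFin; rewrite max_r// oppr_le0.
by congr fine; apply: eq_esum => s _; rewrite max_l.
Qed.

End unordered_sums.

Section l2.
Variables (R : realType) (S : choiceType).
Local Notation normc := ComplexField.Normc.normc.
Implicit Types f g : S -> R[i].

Definition square_summable f :=
  (\esum_(s in [set: S]) (normc (f s) ^+ 2)%:E < +oo)%E.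

Definition l2_pred : {pred S -> R[i]} := fun f => `[< square_summable f >].

Lemma normc_sq (z : R[i]) :
  normc z ^+ 2 = complex.Re z ^+ 2 + complex.Im z ^+ 2.
Proof. by case: z => a b /=; rewrite sqr_sqrtr// addr_ge0// sqr_ge0. Qed.

Lemma normc_lin (a x y : R[i]) :
  normc (a * x + y) ^+ 2 <= 2 * normc a ^+ 2 * normc x ^+ 2 + 2 * normc y ^+ 2.
Proof.
case: a x y => [a b] [x y] [z w]; rewrite -subr_ge0.
have -> : Complex a b * Complex x y + Complex z w =
  Complex (a * x - b * y + z) (a * y + b * x + w) by [].
rewrite !normc_sq /=.
have -> : 2 * (a ^+ 2 + b ^+ 2) * (x ^+ 2 + y ^+ 2) + 2 * (z ^+ 2 + w ^+ 2) -
  ((a * x - b * y + z) ^+ 2 + (a * y + b * x + w) ^+ 2) =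
  (a * x - b * y - z) ^+ 2 + (a * y + b * x - w) ^+ 2 by ring.
by rewrite addr_ge0 ?sqr_ge0.
Qed.

Lemma square_summableP f :
  square_summable f <-> rsummable (fun s => normc (f s) ^+ 2).
Proof.
rewrite /square_summable /rsummable.
by under [X in _ <-> (X < _)%E]eq_esum do rewrite ger0_norm ?sqr_ge0//.
Qed.

Lemma l2_predP f : reflect (square_summable f) (f \in l2_pred).
Proof. exact: asboolP. Qed.

Lemma l2_submod_closed : submod_closed l2_pred.
Proof.
rewrite /l2_pred; split; rewrite ?unfold_in.
  apply/asboolP; rewrite /square_summable esum1 ?ltry// => s _.
  by rewrite ComplexField.Normc.normc0 expr0n.
move=> a f g /asboolP/square_summableP sf /asboolP/square_summableP sg.
apply/asboolP/square_summableP.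
pose c := normc a ^+ 2.
have sf' : rsummable (fun s => 2 * c * normc (f s) ^+ 2).
  have c0 : 0 <= 2 * c by rewrite mulr_ge0 ?sqr_ge0.
  rewrite /rsummable; under eq_esum do rewrite normrM (ger0_norm c0).
  rewrite esumZ// lte_mul_pinfty ?lee_fin//.
have sg' : rsummable (fun s => 2 * normc (g s) ^+ 2).
  by under eq_fun do rewrite mulr_natl mulr2n; exact: rsummableD.
apply: rsummable_le (rsummableD sf' sg') => s.
rewrite ger0_norm ?sqr_ge0// ger0_norm; last first.
  by apply: addr_ge0; repeat (exact: sqr_ge0 || exact: ler0n || apply: mulr_ge0).
exact: normc_lin.
Qed.

HB.instance Definition _ :=
  GRing.isSubmodClosed.Build R[i] (S -> R[i]) l2_pred
    (GRing.submod_closed_semi l2_submod_closed).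

Record l2 := L2 { l2fun :> S -> R[i]; _ : l2fun \in l2_pred }.

HB.instance Definition _ := [isSub for l2fun].
HB.instance Definition _ := [Choice of l2 by <:].
HB.instance Definition _ := [SubChoice_isSubLmodule of l2 by <:].

Definition l2dot (f g : l2) : R[i] := csum (fun s => f s * Num.conj (g s)).

Lemma l2_ext (f g : l2) : (forall s, f s = g s) -> f = g.
Proof. by move=> fg; apply: val_inj; apply/funext. Qed.

Lemma l2_mem (f : l2) : l2fun f \in l2_pred.
Proof. by case: f. Qed.

Lemma l2_sum (f : l2) : rsummable (fun s => normc (f s) ^+ 2).
Proof. exact: (iffLR (square_summableP _) (elimT (l2_predP _) (l2_mem f))). Qed.

Lemma normc_ge_Re_Im (z : R[i]) :
  `|complex.Re z| <= normc z /\ `|complex.Im z| <= normc z.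
Proof.
case: z => a b /=; split; rewrite -sqrtr_sqr ler_wsqrtr//.
  by rewrite lerDl sqr_ge0.
by rewrite lerDr sqr_ge0.
Qed.

Lemma normcZ (a z : R[i]) : normc (a * z) = normc a * normc z.
Proof. exact: ComplexField.Normc.normcM. Qed.

Lemma normc_conj (z : R[i]) : normc (Num.conj z) = normc z.
Proof. by case: z => a b /=; rewrite sqrrN. Qed.

Lemma normc_ge0 (z : R[i]) : 0 <= normc z.
Proof. by case: z => a b; exact: sqrtr_ge0. Qed.

Definition csummable f := rsummable (fun s => normc (f s)).

Lemma csummable_Re f : csummable f -> rsummable (fun s => complex.Re (f s)).
Proof.
apply: rsummable_le => s; rewrite [leRHS]ger0_norm ?normc_ge0//.
by have [] := normc_ge_Re_Im (f s).
Qed.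

Lemma csummable_Im f : csummable f -> rsummable (fun s => complex.Im (f s)).
Proof.
apply: rsummable_le => s; rewrite [leRHS]ger0_norm ?normc_ge0//.
by have [] := normc_ge_Re_Im (f s).
Qed.

Lemma csummable_prod (f g : l2) : csummable (fun s => f s * Num.conj (g s)).
Proof.
apply: rsummable_le (rsummableD (l2_sum f) (l2_sum g)) => s.
rewrite normcZ normc_conj ger0_norm ?mulr_ge0 ?normc_ge0//.
rewrite ger0_norm ?addr_ge0 ?sqr_ge0//.
by have := sqr_ge0 (normc (f s) - normc (g s)); have := normc_ge0 (f s);
  have := normc_ge0 (g s); nra.
Qed.

Lemma csumD f g : csummable f -> csummable g ->
  csum (fun s => f s + g s) = csum f + csum g.
Proof.
move=> sf sg.
rewrite [RHS]/Algebra.add/= /csum.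
rewrite -(rsumD (csummable_Re sf) (csummable_Re sg)).
rewrite -(rsumD (csummable_Im sf) (csummable_Im sg)).
by congr Complex; apply: eq_rsum => s; case: (f s) (g s) => [? ?] [? ?].
Qed.

Lemma csumZ a f : csummable f -> csum (fun s => a * f s) = a * csum f.
Proof.
move=> sf; rewrite /csum.
have sRe := csummable_Re sf; have sIm := csummable_Im sf.
have sZ (c : R) (h : S -> R) : rsummable h -> rsummable (fun s => c * h s).
  move=> sh; rewrite /rsummable; under eq_esum do rewrite normrM.
  by rewrite esumZ// lte_mul_pinfty ?lee_fin.
case: a => a b.
have -> : Complex a b * Complex (rsum (fun s => complex.Re (f s)))
    (rsum (fun s => complex.Im (f s))) =
  Complex (a * rsum (fun s => complex.Re (f s)) - b * rsum (fun s => complex.Im (f s)))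
    (a * rsum (fun s => complex.Im (f s)) + b * rsum (fun s => complex.Re (f s))) by [].
rewrite -mulNr -!(rsumZ _ sRe) -!(rsumZ _ sIm).
rewrite -(rsumD (sZ a _ sRe) (sZ (- b) _ sIm)) -(rsumD (sZ a _ sIm) (sZ b _ sRe)).
by congr Complex; apply: eq_rsum => s; case: (f s) => [x y] /=; rewrite ?mulNr.
Qed.

Lemma csum_conj f : csum (fun s => Num.conj (f s)) = Num.conj (csum f).
Proof.
rewrite /csum; congr Complex; first by apply: eq_rsum => s; case: (f s).
rewrite /rsum opprB; congr (fine _ - fine _);
  by apply: eq_esum => s _; case: (f s) => a b /=; rewrite ?opprK.
Qed.

Lemma l2dotC (f g : l2) : l2dot f g = Num.conj (l2dot g f).
Proof.
rewrite /l2dot -csum_conj; congr csum; apply/funext => s.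
by rewrite rmorphM /= conjCK mulrC.
Qed.

Lemma l2dotP a (f g h : l2) : l2dot (a *: f + g) h = a * l2dot f h + l2dot g h.
Proof.
rewrite /l2dot -csumZ; last exact: csummable_prod.
rewrite -csumD; last 2 first.
- have := csummable_prod (a *: f) h; congr csummable; apply/funext => s.
  by rewrite mulrA.
- exact: csummable_prod.
congr csum; apply/funext => s.
by rewrite mulrA -mulrDl.
Qed.

Lemma l2dotB (f g h : l2) : l2dot (f - g) h = l2dot f h - l2dot g h.
Proof. by rewrite -scaleN1r addrC l2dotP mulN1r addrC. Qed.

Lemma l2dotZ a (f h : l2) : l2dot (a *: f) h = a * l2dot f h.
Proof.
have l0 : l2dot 0 h = 0 by rewrite -(subrr f) l2dotB subrr.
by rewrite -[a *: f]addr0 l2dotP l0 addr0.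
Qed.

Lemma l2dot_addl (h : l2) : zmod_morphism (l2dot^~ h).
Proof. by move=> f g; rewrite l2dotB. Qed.

Lemma l2dot_addr (f : l2) : zmod_morphism (l2dot f).
Proof. by move=> g h; rewrite l2dotC l2dotB rmorphB /= -!l2dotC. Qed.

Lemma l2dot_scalel (h : l2) : GRing.scalable_for *%R (l2dot^~ h).
Proof. by move=> a f; rewrite l2dotZ. Qed.

Lemma l2dot_scaler (f : l2) :
  GRing.scalable_for (Num.Def.conjC \; *%R) (l2dot f).
Proof. by move=> a g; rewrite l2dotC l2dotZ rmorphM /= -l2dotC. Qed.

HB.instance Definition _ := isBilinear.Build R[i] l2 l2 R[i]
  ( *%R ) (Num.Def.conjC \; *%R) l2dot
  l2dot_addl l2dot_addr l2dot_scalel l2dot_scaler.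

Lemma l2dot_herm (f g : l2) : l2dot f g = (-1) ^+ false * Num.conj (l2dot g f).
Proof. by rewrite expr0 mul1r l2dotC. Qed.

HB.instance Definition _ := isHermitianSesquilinear.Build R[i] l2 false
  Num.Def.conjC l2dot l2dot_herm.

Lemma l2dotxx (f : l2) :
  l2dot f f = Complex (rsum (fun s => normc (f s) ^+ 2)) 0.
Proof.
rewrite /l2dot /csum; congr Complex.
  by apply: eq_rsum => s; rewrite normc_sq; case: (f s) => a b /=; ring.
rewrite (@eq_rsum _ _ _ (fun s => 0 * normc (f s) ^+ 2)); last first.
  by move=> s; case: (f s) => a b /=; ring.
by rewrite (rsumZ _ (l2_sum f)) mul0r.
Qed.

Lemma l2_le_sum (f : l2) s : normc (f s) ^+ 2 <= rsum (fun s => normc (f s) ^+ 2).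
Proof.
rewrite rsum_ge0E; last by move=> ?; exact: sqr_ge0.
rewrite -lee_fin fineK; last first.
  by apply: esum_fin; [move=> ?; exact: sqr_ge0|exact: l2_sum].
apply: esum_ge; exists [set s]; first by split.
by rewrite fsbig_set1.
Qed.

Lemma l2dot_pos (f : l2) : f != 0 -> 0 < l2dot f f.
Proof.
move=> f0; rewrite l2dotxx ltcE /= eqxx /=.
have [s fs] : exists s, f s != 0.
  apply: contrapT => /forallNP f_0; move/eqP: f0; apply; apply: l2_ext => s.
  by apply/eqP; apply/negPn/negP; exact: f_0.
apply: lt_le_trans (l2_le_sum f s).
rewrite exprn_gt0// lt_neqAle normc_ge0 andbT eq_sym.
by apply: contra fs => /eqP/ComplexField.Normc.eq0_normc ->.
Qed.

HB.instance Definition _ := isDotProduct.Build R[i] l2 l2dot l2dot_pos.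

HB.instance Definition _ := @Lmodule_isNormed.Build R[i] l2
  (dnorm l2dot) (dnorm_triangle l2dot) (dnormZ_sqrt l2dot) (@dnorm0_eq0 _ _ l2dot).

Lemma l2_normE (f : l2) : `|f| ^+ 2 = l2dot f f.
Proof. exact: (dnormK l2dot). Qed.
End l2.

Section l2_complete.
Variables (R : realType) (S : choiceType).
Local Notation normc := ComplexField.Normc.normc.
Local Notation l2 := (l2 R S).
Implicit Types f g : l2.

Definition rnorm f : R := complex.Re `|f|.

Lemma rnormE f : `|f| = (rnorm f)%:C%C.
Proof. by rewrite RRe_real// ger0_real. Qed.

Lemma rnorm_ge0 f : 0 <= rnorm f.
Proof. by rewrite -ler0c -rnormE. Qed.

Lemma rnorm_sq f : rnorm f ^+ 2 = rsum (fun s => normc (f s) ^+ 2).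
Proof.
have := l2_normE f; rewrite l2dotxx rnormE -rmorphXn /=.
by move=> /(congr1 (@complex.Re _)).
Qed.

Lemma rnorm_coord f s : normc (f s) <= rnorm f.
Proof.
rewrite -(@ler_pXn2r _ 2)// ?nnegrE ?normc_ge0 ?rnorm_ge0//.
by rewrite rnorm_sq l2_le_sum.
Qed.

Lemma rnorm_leP f (e : R) : 0 <= e ->
  (forall X : set S, finite_set X -> \sum_(s \in X) normc (f s) ^+ 2 <= e ^+ 2) ->
  rnorm f <= e.
Proof.
move=> e0 H; rewrite -(@ler_pXn2r _ 2)// ?nnegrE ?rnorm_ge0//.
rewrite rnorm_sq rsum_ge0E; last by move=> ?; exact: sqr_ge0.
rewrite -lee_fin fineK; last first.
  by apply: esum_fin; [move=> ?; exact: sqr_ge0|exact: l2_sum].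
apply: ge_ereal_sup => _ [X [finX _] <-].
by rewrite fsumEFin// lee_fin H.
Qed.

Lemma square_summable_bounded (h : S -> R[i]) (e : R) :
  (forall X : set S, finite_set X -> \sum_(s \in X) normc (h s) ^+ 2 <= e) ->
  square_summable h.
Proof.
move=> H; rewrite /square_summable (@le_lt_trans _ _ e%:E) ?ltry//.
apply: ge_ereal_sup => _ [X [finX _] <-].
by rewrite fsumEFin// lee_fin H.
Qed.

Lemma sum_le_rnorm f (X : set S) : finite_set X ->
  \sum_(s \in X) normc (f s) ^+ 2 <= rnorm f ^+ 2.
Proof.
move=> finX; rewrite rnorm_sq rsum_ge0E; last by move=> ?; exact: sqr_ge0.
rewrite -lee_fin fineK; last first.
  by apply: esum_fin; [move=> ?; exact: sqr_ge0|exact: l2_sum].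
by apply: esum_ge; exists X => //; rewrite fsumEFin.
Qed.

Lemma l2_complete (F : set_system l2) : ProperFilter F -> cauchy F -> cvg F.
Proof.
move=> FF /cauchyP Fc.
have key (e : R) : 0 < e ->
    exists A : set l2, F A /\ forall f g, A f -> A g -> rnorm (f - g) <= e.
  move=> e0; have [] := Fc (e / 2)%:C%C; first by rewrite ltcR divr_gt0.
  move=> c Ac; exists (ball c (e / 2)%:C%C); split=> // f g.
  rewrite -!ball_normE /= => cf cg.
  rewrite -lecR -rnormE (le_trans (ler_distD c f g))//.
  rewrite [e]splitr rmorphD /= lerD// ltW//.
  by rewrite distrC.
have subE f g s : (f - g) s = f s - g s by [].
have ReB (x y : R[i]) : complex.Re (x - y) = complex.Re x - complex.Re y.
  by case: x y => [? ?] [? ?].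
have ImB (x y : R[i]) : complex.Im (x - y) = complex.Im x - complex.Im y.
  by case: x y => [? ?] [? ?].
have cvgRe s : cvg ((fun f => complex.Re (f s)) @ F).
  apply/cauchy_cvgP/cauchy_ballP => e e0.
  have [A [FA HA]] := key (e / 2) (divr_gt0 e0 (ltr0n _ 2)).
  exists ((fun f => complex.Re (f s)) @` A, (fun f => complex.Re (f s)) @` A).
    by split; apply: (@filterS _ F _ A) => [f Af|//]; exists f.
  move=> [_ _] /= [[f Af <-] [g Ag <-]].
  rewrite -ball_normE /= -ReB -subE.
  have [h _] := normc_ge_Re_Im ((f - g) s).
  rewrite (le_lt_trans h)// (le_lt_trans (rnorm_coord _ _))//.
  by rewrite (le_lt_trans (HA _ _ Af Ag))// ltr_pdivrMr// ltr_pMr// ltr1n.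
have cvgIm s : cvg ((fun f => complex.Im (f s)) @ F).
  apply/cauchy_cvgP/cauchy_ballP => e e0.
  have [A [FA HA]] := key (e / 2) (divr_gt0 e0 (ltr0n _ 2)).
  exists ((fun f => complex.Im (f s)) @` A, (fun f => complex.Im (f s)) @` A).
    by split; apply: (@filterS _ F _ A) => [f Af|//]; exists f.
  move=> [_ _] /= [[f Af <-] [g Ag <-]].
  rewrite -ball_normE /= -ImB -subE.
  have [_ h] := normc_ge_Re_Im ((f - g) s).
  rewrite (le_lt_trans h)// (le_lt_trans (rnorm_coord _ _))//.
  by rewrite (le_lt_trans (HA _ _ Af Ag))// ltr_pdivrMr// ltr_pMr// ltr1n.
pose a s : R := lim ((fun f => complex.Re (f s)) @ F).
pose b s : R := lim ((fun f => complex.Im (f s)) @ F).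
pose f0 s := Complex (a s) (b s).
have bound (A : set l2) (e : R) f : F A -> A f ->
   (forall f g, A f -> A g -> rnorm (f - g) <= e) ->
   forall X, finite_set X -> \sum_(s \in X) normc (f s - f0 s) ^+ 2 <= e ^+ 2.
  move=> FA Af HA X finX.
  have e0 : 0 <= e by rewrite (le_trans (rnorm_ge0 _) (HA _ _ Af Af)).
  have cv : (fun g => \sum_(s <- finmap.enum_fset (fset_set X))
        ((complex.Re (f s) - complex.Re (g s)) ^+ 2 +
         (complex.Im (f s) - complex.Im (g s)) ^+ 2)) @ F -->
      \sum_(s <- finmap.enum_fset (fset_set X)) ((complex.Re (f s) - a s) ^+ 2 +
         (complex.Im (f s) - b s) ^+ 2).
    apply: cvg_big => [|s _]; first exact: add_continuous.
    apply: cvgD; rewrite expr2; under eq_fun do rewrite expr2.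
      by apply: cvgM; (apply: cvgB; [exact: cvg_cst|exact: cvgRe]).
    by apply: cvgM; (apply: cvgB; [exact: cvg_cst|exact: cvgIm]).
  rewrite fsbig_finite//=.
  under eq_bigr do rewrite normc_sq ReB ImB.
  apply: (cvgr_to_le cv).
  apply: filterS FA => g Ag.
  have := le_trans (sum_le_rnorm (f - g) finX) (lerXn2r 2 _ _ (HA _ _ Af Ag)).
  rewrite !nnegrE rnorm_ge0 e0 => /(_ isT isT).
  rewrite [X in X <= _ -> _](_ : _ = \sum_(s <- finmap.enum_fset (fset_set X))
        ((complex.Re (f s) - complex.Re (g s)) ^+ 2 +
         (complex.Im (f s) - complex.Im (g s)) ^+ 2))//.
  rewrite fsbig_finite//=; apply: eq_bigr => s _.
  by rewrite normc_sq -ReB -ImB.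
have f0l2 : f0 \in @l2_pred R S.
  have [A [FA HA]] := key 1 ltr01.
  have [f Af] := filter_ex FA.
  have B := bound A 1 f FA Af HA.
  have d : (l2fun f - f0) \in @l2_pred R S.
    by apply/l2_predP; apply: (square_summable_bounded B).
  have -> : f0 = l2fun f - (l2fun f - f0) by rewrite opprB addrCA subrr addr0.
  by rewrite rpredB// l2_mem.
pose f1 : l2 := L2 f0l2.
apply/cvg_ex; exists f1; apply/cvgrPdist_le => e e0.
have eE : e = (complex.Re e)%:C%C by rewrite RRe_real// gtr0_real.
have e0' : 0 < complex.Re e by rewrite -ltcR -eE.
have [A [FA' HA]] := key _ e0'; have FA := FA'.
apply: (filterS _ FA') => f Af; rewrite distrC eE rnormE lecR.
by apply: rnorm_leP; [exact: ltW|move=> X finX; exact: (bound A _ f FA Af HA X finX)].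
Qed.

HB.instance Definition _ := Uniform_isComplete.Build l2 l2_complete.

Lemma l2dot_norm (f : l2) : @l2dot R S f f = `|f| ^+ 2.
Proof. by rewrite l2_normE. Qed.

HB.instance Definition _ := isHilbert.Build R l2 l2dot_norm.

End l2_complete.

Section operators.
Variable R : realType.
Implicit Types (H K : hilbertType R).

Definition bounded_op H K (T : H -> K) : Prop := linear T /\ continuous T.

Definition isometric H K (T : H -> K) : Prop := forall x, `|T x| = `|x|.

(* The value at y is the vector z given by the Riesz theorem, i.e. such that
   <T x, y> = <x, z> for all x *)
Definition adjoint H K (T : H -> K) : K -> H := fun y =>
  xget 0 [set z | forall x, hdot (T x) y = hdot x z].

Definition opnorm H K (T : H -> K) : R :=
  inf [set c | 0 <= c /\ forall x, `|T x| <= c%:C%C * `|x|].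

(* The norm of the operator matrix T acting on the Hilbert space H^k *)
Definition mx_opnorm H k (T : 'M[H -> H]_k) : R :=
  inf [set c | 0 <= c /\ forall x : 'I_k -> H,
    \sum_i `|\sum_j T i j (x j)| ^+ 2 <= c%:C%C ^+ 2 * \sum_j `|x j| ^+ 2].

Definition norm_closed H (A : set (H -> H)) : Prop :=
  forall T, bounded_op T ->
  (forall e : R, 0 < e -> exists2 T', A T' & opnorm (T - T') < e) -> A T.

Record operator_algebra H (A : set (H -> H)) : Prop := {
  operator_algebra_bounded : forall T, A T -> bounded_op T;
  operator_algebra_id : A idfun;
  operator_algebra_linear : forall (a : R[i]) T T',
    A T -> A T' -> A (a *: T + T');
  operator_algebra_comp : forall T T', A T -> A T' -> A (T \o T');
  operator_algebra_closed : norm_closed A }.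

(* Unital C*-algebras are concrete: norm closed self-adjoint subalgebras of
   B(H) containing the identity *)
Record cstar_algebra H (C : set (H -> H)) : Prop := {
  cstar_operator_algebra : operator_algebra C;
  cstar_adjoint : forall T, C T -> C (adjoint T) }.

Definition opalg_gen H (G : set (H -> H)) : set (H -> H) :=
  smallest (@operator_algebra H) G.

Definition cstar_gen H (G : set (H -> H)) : set (H -> H) :=
  smallest (@cstar_algebra H) G.

(* Maps between algebras of operators are total functions; only their values
   on the algebra A matter *)
Record unital_hom H K (A : set (H -> H)) (phi : (H -> H) -> (K -> K)) : Prop := {
  hom_bounded : forall T, A T -> bounded_op (phi T);
  hom_id : phi idfun = idfun;
  hom_linear : forall (a : R[i]) T T', A T -> A T' ->
    phi (a *: T + T') = a *: phi T + phi T';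
  hom_comp : forall T T', A T -> A T' -> phi (T \o T') = phi T \o phi T' }.

Record star_hom H K (C : set (H -> H)) (phi : (H -> H) -> (K -> K)) : Prop := {
  star_hom_unital : unital_hom C phi;
  star_hom_adjoint : forall T, C T -> phi (adjoint T) = adjoint (phi T) }.

Definition completely_isometric H K (A : set (H -> H))
    (phi : (H -> H) -> (K -> K)) : Prop :=
  forall k (T : 'M[H -> H]_k), (forall i j, A (T i j)) ->
  mx_opnorm (map_mx phi T) = mx_opnorm T.

Record closed_ideal H (C J : set (H -> H)) : Prop := {
  ideal_sub : J `<=` C;
  ideal0 : J 0;
  ideal_linear : forall (a : R[i]) T T', J T -> J T' -> J (a *: T + T');
  ideal_mull : forall T T', C T -> J T' -> J (T \o T');
  ideal_mulr : forall T T', J T -> C T' -> J (T \o T');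
  ideal_closed : norm_closed J }.

(* The norm of the image of T in M_k(C / J) = M_k(C) / M_k(J) *)
Definition mx_quotient_norm H (J : set (H -> H)) k (T : 'M[H -> H]_k) : R :=
  inf [set mx_opnorm (T + X) | X in [set X : 'M[H -> H]_k | forall i j, J (X i j)]].

(* (C, phi) is the C*-envelope of A: phi is a completely isometric unital
   homomorphism of A onto a generating subalgebra of C, and no quotient of C by
   a nonzero closed ideal J is completely isometric on phi(A) *)
Record is_cstar_envelope H K (A : set (H -> H)) (C : set (K -> K))
    (phi : (H -> H) -> (K -> K)) : Prop := {
  envelope_hom : unital_hom A phi;
  envelope_isometric : completely_isometric A phi;
  envelope_gen : C = cstar_gen (phi @` A);
  envelope_min : forall J, closed_ideal C J ->
    (forall k (T : 'M[H -> H]_k), (forall i j, A (T i j)) ->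
       mx_quotient_norm J (map_mx phi T) = mx_opnorm T) ->
    J = [set 0] }.

Definition to_l2 (S : choiceType) (f : S -> R[i]) : l2 R S := insubd 0 f.

Definition delta (S : choiceType) (s : S) : l2 R S :=
  to_l2 (fun t => (t == s)%:R).

(* The bounded operator with prescribed values on the standard basis of l2(S) *)
Definition of_basis (S : choiceType) H (c : S -> H) : l2 R S -> H :=
  xget 0 [set T | bounded_op T /\ forall s, T (delta s) = c s].

(* L, with embeddings iota, is the Hilbert space inductive limit of the
   isometries rho s : H_ s -> H_ s.+1 *)
Record hilbert_limit (H_ : nat -> hilbertType R) (rho : forall s, H_ s -> H_ s.+1)
    (L : hilbertType R) (iota : forall s, H_ s -> L) : Prop := {
  limit_bounded : forall s, bounded_op (iota s);
  limit_isometric : forall s, isometric (iota s);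
  limit_compatible : forall s, iota s.+1 \o rho s = iota s;
  limit_dense : closure (\bigcup_s range (iota s)) = setT }.

End operators.

Section unitary_relations.
Variables (R : realType) (m n : nat) (u : 'M[R[i]]_(m * n)).

(* e_w (x) f_v, for w and v words in {1..m} and {1..n}, is the standard basis
   of the direct sum of the spaces E^k (x) F^l *)
Definition fock_basis : choiceType := (seq 'I_m * seq 'I_n)%type.

Definition fock : hilbertType R := l2 R fock_basis.

(* inl i stands for e_i and inr j stands for f_j *)
Definition letter : Type := ('I_m + 'I_n)%type.

Definition word_of (x : fock_basis) : seq letter :=
  map inl x.1 ++ map inr x.2.

(* Below, g w v is the coefficient of e_w (x) f_v in a finitely supported
   vector *)
Definition tensE (i : 'I_m) (g : seq 'I_m -> seq 'I_n -> R[i])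
    (w : seq 'I_m) (v : seq 'I_n) : R[i] :=
  if w is a :: w' then (a == i)%:R * g w' v else 0.

(* Since u is unitary, the identification of E (x) F with F (x) E reads
     f_j (x) e_i = \sum_(a, b) (u_((a, b), (i, j)))^* e_a (x) f_b,
   hence f_j (x) e_i (x) xi = \sum_(a, b) (u_((a, b), (i, j)))^* e_a (x) f_b (x) xi *)
Fixpoint tensF (j : 'I_n) (g : seq 'I_m -> seq 'I_n -> R[i])
    (w : seq 'I_m) (v : seq 'I_n) {struct w} : R[i] :=
  match w with
  | [::] => if v is b :: v' then (b == j)%:R * g [::] v' else 0
  | a :: w' => \sum_(i < m) \sum_(b < n)
      Num.conj (u (mxvec_index a b) (mxvec_index i j)) *
      tensF b (fun w'' => g (i :: w'')) w' v
  end.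

Lemma tensFZ j c g w v :
  tensF j (fun w' v' => c * g w' v') w v = c * tensF j g w v.
Proof.
elim: w j g v => [|a w IHw] j g v /=.
  by case: v => [|b v]; rewrite ?mulr0// mulrCA.
rewrite mulr_sumr; apply: eq_bigr => i _; rewrite mulr_sumr.
by apply: eq_bigr => b _; rewrite (IHw b (fun w'' => g (i :: w''))) mulrCA.
Qed.

(* e_i (x) f_j = \sum_(i', j') u_((i, j), (i', j')) f_j' (x) e_i' *)
Lemma tensE_tensF (u_unitary : u \is unitarymx) i j g w v :
  tensE i (tensF j g) w v = \sum_(i' < m) \sum_(j' < n)
    u (mxvec_index i j) (mxvec_index i' j') * tensF j' (tensE i' g) w v.
Proof.
case: w => [|a w] /=.
  rewrite big1// => i' _; rewrite big1// => j' _.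
  by case: v => [|b v]; rewrite ?mulr0.
have H i' j' : \sum_(i0 < m) \sum_(b < n)
      Num.conj (u (mxvec_index a b) (mxvec_index i0 j')) *
      tensF b (fun w'' v'' => (i0 == i')%:R * g w'' v'') w v =
    \sum_(b < n) Num.conj (u (mxvec_index a b) (mxvec_index i' j')) *
      tensF b g w v.
  rewrite (bigD1 i')//= [X in _ + X]big1 ?addr0.
    by apply: eq_bigr => b _; rewrite tensFZ eqxx mul1r.
  move=> i0 i0i'; rewrite big1// => b _.
  by rewrite tensFZ (negPf i0i') mul0r mulr0.
under eq_bigr do under eq_bigr do rewrite H mulr_sumr.
under eq_bigr do rewrite exchange_big.
rewrite exchange_big/=.
have D b : \sum_(i' < m) \sum_(j' < n) u (mxvec_index i j) (mxvec_index i' j') *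
      Num.conj (u (mxvec_index a b) (mxvec_index i' j')) =
    (mxvec_index i j == mxvec_index a b)%:R.
  rewrite pair_bigA /=.
  have := congr1 (fun M : 'M[R[i]]_(m * n) => M (mxvec_index i j) (mxvec_index a b))
    (elimT unitarymxP u_unitary).
  rewrite !mxE => <-.
  rewrite (reindex _ (curry_mxvec_bij _ _)) /=.
  by apply: eq_bigr => -[x y] _; rewrite !mxE.
have I b : (mxvec_index i j == mxvec_index a b) = (i == a) && (j == b).
  by rewrite (inj_eq (@cast_ord_inj _ _ _)) (inj_eq enum_rank_inj).
transitivity (\sum_(b < n) (mxvec_index i j == mxvec_index a b)%:R * tensF b g w v).
  rewrite (bigD1 j)//= [X in _ + X]big1 ?addr0; last first.
    by move=> b bj; rewrite I (eq_sym j b) (negPf bj) andbF mul0r.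
  by rewrite I eqxx andbT eq_sym.
apply: eq_bigr => b _; rewrite -D mulr_suml; apply: eq_bigr => i' _.
by rewrite mulr_suml; apply: eq_bigr => j' _; rewrite mulrA.
Qed.

Definition vacuum (w : seq 'I_m) (v : seq 'I_n) : R[i] :=
  ((w == [::]) && (v == [::]))%:R.

Definition tens_letter (x : letter) :=
  match x with inl i => tensE i | inr j => tensF j end.

(* The elementary tensor z_1 (x) ... (x) z_k in an arbitrary order of the
   letters, as an element of E^k (x) F^l *)
Definition tensor (z : seq letter) : fock :=
  to_l2 (fun x : fock_basis => foldr tens_letter vacuum z x.1 x.2).

Definition creation (x : letter) : fock -> fock :=
  of_basis (fun y => tensor (x :: word_of y)).

Definition right_tensor (z : seq letter) : fock -> fock :=
  of_basis (fun y => tensor (word_of y ++ z)).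

Definition L_e (i : 'I_m) := creation (inl i).
Definition L_f (j : 'I_n) := creation (inr j).

Definition unitary_relation_algebra : set (fock -> fock) :=
  opalg_gen (range L_e `|` range L_f).

Record star_representation (H : hilbertType R)
    (A : 'I_m -> H -> H) (B : 'I_n -> H -> H) : Prop := {
  star_rep_boundedA : forall i, bounded_op (A i);
  star_rep_boundedB : forall j, bounded_op (B j);
  star_rep_relation : forall i j, A i \o B j =
    \sum_(i' < m) \sum_(j' < n)
      u (mxvec_index i j) (mxvec_index i' j') *: (B j' \o A i');
  star_rep_isometricA : forall i, isometric (A i);
  star_rep_isometricB : forall j, isometric (B j);
  star_rep_sumA : \sum_(i < m) (A i \o adjoint (A i)) = idfun;
  star_rep_sumB : \sum_(j < n) (B j \o adjoint (B j)) = idfun }.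

Record is_generalised_cuntz (K : hilbertType R) (O : set (K -> K))
    (A : 'I_m -> K -> K) (B : 'I_n -> K -> K) : Prop := {
  cuntz_rep : star_representation A B;
  cuntz_gen : O = cstar_gen (range A `|` range B);
  cuntz_universal : forall (H : hilbertType R)
      (A' : 'I_m -> H -> H) (B' : 'I_n -> H -> H),
    star_representation A' B' ->
    exists sigma : (K -> K) -> (H -> H),
      [/\ star_hom O sigma, forall i, sigma (A i) = A' i & forall j, sigma (B j) = B' j] }.

(* The tail e_(tau 0).1 f_(tau 0).2 e_(tau 1).1 f_(tau 1).2 ... *)
Definition tail_shift (tau : nat -> 'I_m * 'I_n) (s : nat) : fock -> fock :=
  right_tensor [:: inl (tau s).1; inr (tau s).2].

Definition is_tail_space (tau : nat -> 'I_m * 'I_n)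
    (L : hilbertType R) (iota : nat -> fock -> L) : Prop :=
  hilbert_limit (H_ := fun=> fock) (tail_shift tau) iota.

(* The operator induced on the limit by a left creation operator *)
Definition tail_rep (L : hilbertType R) (iota : nat -> fock -> L)
    (x : letter) : L -> L :=
  xget 0 [set T | bounded_op T /\
    forall s, T \o iota s = iota s \o creation x].

End unitary_relations.

Section permutation_semigroup.
Variables (m n : nat) (theta : {perm 'I_m * 'I_n}).

Inductive theta_cong : seq (letter m n) -> seq (letter m n) -> Prop :=
| theta_cong_rel x y i j : theta_cong (x ++ [:: inl i; inr j] ++ y)
    (x ++ [:: inr (theta (i, j)).2; inl (theta (i, j)).1] ++ y)
| theta_cong_refl x : theta_cong x x
| theta_cong_sym x y : theta_cong x y -> theta_cong y x
| theta_cong_trans x y z : theta_cong x y -> theta_cong y z -> theta_cong x z.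

Definition theta_rel : rel (seq (letter m n)) := fun x y => `[< theta_cong x y >].

Lemma theta_relP : equiv_class_of theta_rel.
Proof.
split=> [x|x y|y x z].
- by apply/asboolP; exact: theta_cong_refl.
- by apply/asboolP/asboolP; exact: theta_cong_sym.
- move=> /asboolP xy /asboolP yz; apply/asboolP; exact: theta_cong_trans yz.
Qed.

Canonical theta_equiv : equiv_rel (seq (letter m n)) := EquivRelPack theta_relP.

Definition Ftheta := {eq_quot theta_equiv}%qT.

HB.instance Definition _ := Choice.on Ftheta.

Definition Ftheta_class (x : seq (letter m n)) : Ftheta := (\pi_Ftheta x)%qT.

Definition Ftheta_mul (x y : Ftheta) : Ftheta :=
  Ftheta_class (repr x ++ repr y).

Lemma theta_cong_cat x x' y y' : theta_cong x x' -> theta_cong y y' ->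
  theta_cong (x ++ y) (x' ++ y').
Proof.
move=> xx' yy'; apply: (@theta_cong_trans _ (x' ++ y)).
  elim: xx' => [a b i j|a|a b _|a b c _ + _].
  - by rewrite -!catA; exact: theta_cong_rel.
  - exact: theta_cong_refl.
  - exact: theta_cong_sym.
  - exact: theta_cong_trans.
elim: yy' => [a b i j|a|a b _|a b c _ + _].
- by rewrite !(catA x') ; exact: theta_cong_rel.
- exact: theta_cong_refl.
- exact: theta_cong_sym.
- exact: theta_cong_trans.
Qed.

Lemma Ftheta_classP x y : theta_cong x y -> Ftheta_class x = Ftheta_class y.
Proof. by move=> xy; apply/eqmodP/asboolP. Qed.

Lemma Ftheta_classK x : theta_cong (repr (Ftheta_class x)) x.
Proof. by apply/asboolP; have /eqmodP := reprK (Ftheta_class x). Qed.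

Lemma Ftheta_reprK (x : Ftheta) : Ftheta_class (repr x) = x.
Proof. exact: reprK. Qed.

Lemma Ftheta_mulE x y :
  Ftheta_mul (Ftheta_class x) (Ftheta_class y) = Ftheta_class (x ++ y).
Proof. by apply: Ftheta_classP; apply: theta_cong_cat; exact: Ftheta_classK. Qed.

Lemma Ftheta_mulA : associative Ftheta_mul.
Proof.
move=> x y z; rewrite -(Ftheta_reprK x) -(Ftheta_reprK y) -(Ftheta_reprK z).
by rewrite !Ftheta_mulE catA.
Qed.

Lemma Ftheta_mul1 : left_id (Ftheta_class [::]) Ftheta_mul.
Proof. by move=> x; rewrite -(Ftheta_reprK x) Ftheta_mulE. Qed.

Lemma Ftheta_mulr1 : right_id (Ftheta_class [::]) Ftheta_mul.
Proof. by move=> x; rewrite -(Ftheta_reprK x) Ftheta_mulE cats0. Qed.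

HB.instance Definition _ :=
  isMonoid.Build Ftheta Ftheta_mulA Ftheta_mul1 Ftheta_mulr1.

Definition gen_e (i : 'I_m) : Ftheta := Ftheta_class [:: inl i].
Definition gen_f (j : 'I_n) : Ftheta := Ftheta_class [:: inr j].

Variable R : realType.

Definition regular_rep (w : Ftheta) : l2 R Ftheta -> l2 R Ftheta :=
  of_basis (fun x => delta R (w * x)%g).

Definition semigroup_algebra : set (l2 R Ftheta -> l2 R Ftheta) :=
  opalg_gen (range regular_rep).

Record theta_star_representation (H : hilbertType R)
    (sigma : Ftheta -> H -> H) : Prop := {
  theta_rep_bounded : forall w, bounded_op (sigma w);
  theta_rep1 : sigma 1%g = idfun;
  theta_repM : forall w z, sigma (w * z)%g = sigma w \o sigma z;
  theta_rep_isometric : forall w, isometric (sigma w);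
  theta_rep_sum_e : \sum_(i < m) (sigma (gen_e i) \o adjoint (sigma (gen_e i))) = idfun;
  theta_rep_sum_f : \sum_(j < n) (sigma (gen_f j) \o adjoint (sigma (gen_f j))) = idfun }.

Record is_semigroup_cstar (K : hilbertType R) (O : set (K -> K))
    (sigma : Ftheta -> K -> K) : Prop := {
  semigroup_cstar_rep : theta_star_representation sigma;
  semigroup_cstar_gen : O = cstar_gen (range sigma);
  semigroup_cstar_universal : forall (H : hilbertType R) (sigma' : Ftheta -> H -> H),
    theta_star_representation sigma' ->
    exists2 phi : (K -> K) -> (H -> H),
      star_hom O phi & forall w, phi (sigma w) = sigma' w }.

End permutation_semigroup.

Arguments Ftheta {m n} theta.
Arguments regular_rep {m n} theta {R}.
Arguments semigroup_algebra {m n} theta R.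

(* Main.v *)
Require Import Defs.
From mathcomp Require Import all_boot all_order all_algebra perm.
From mathcomp Require Import sesquilinear spectral complex.
From mathcomp Require Import ring lra.
From mathcomp Require Import all_classical all_reals all_analysis.
From HB Require Import structures.

(** The idea is to compare *-representations through polynomials without
    adjoints, for which the creation operators have the largest norms.

    First, on matrices of polynomials in the generators every *-representation f
    is dominated by the creation operators (star_dominated). A vector h is spread
    over the Fock space by its matrix coefficients <h, f_s g>, where s runs over
    the words of bidegree less than N. Since the f_s f_s^* of each bidegree add up
    to 1, this multiplies the squared norm of h by N^2. The creation operators act
    on the spread vector as f does on h, except near the boundary, whose share
    vanishes as N grows.

    Secondly, adjoints can be eliminated (reduce_poly_ev, reduced_bound). The
    relations allow a word that contains a letter of a given kind to be written as
    a combination of words that start with a letter of that kind, so that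
    f_x^* f_z is a combination of words as soon as z has letters of both kinds. Hence for a *-polynomial p and N
    at least its degree, p f_s is a polynomial q_s without adjoints for each word s
    of bidegree (N, N), and q_s is the same in all *-representations. The row of
    these f_s being unitary, the norm of p is that of the row of the q_s.

    Call a *-representation dominating if its norms on polynomials without
    adjoints are at least those of the creation operators. By the two facts it
    then dominates every *-representation on *-polynomials too
    (dominating_universal), so that the C*-algebra it generates maps to the one of
    any *-representation (extension_star_hom), injectively if the latter is
    dominating as well (extension_inj). A tail representation contains the creation
    operators on the first stage of the limit, so it is dominating
    (tail_dominates): it generates a model of the universal C*-algebra, which
    therefore exists. Conversely a universal representation is mapped to a tail
    representation by a *-homomorphism, which is completely contractive
    (star_hom_mxcontr); so it is dominating (hom_dominating). This gives the
    faithfulness of the tail representations, and with star_dominated the complete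
    isometry of the canonical map.

    For the minimality of the envelope (envelope_minimal), let J be a closed ideal
    whose quotient map is completely isometric on the nonselfadjoint algebra, and
    approximate T in J by a *-polynomial p. Modulo J, p is small, hence so is the
    row of the q_s; its entries lie in the nonselfadjoint algebra, so the row is
    small before taking the quotient, and therefore p and T are small. Thus T = 0.

    For a permutation the tensors of words are the standard basis vectors of the
    Fock space, which is thereby unitarily equivalent to the left regular
    representation of the semigroup (regular_rep_norm), and the *-representations
    are those of the relations for the permutation matrix (theta_rep_star,
    theta_rep_ofP). *)

Set Implicit Arguments.
Unset Strict Implicit.
Unset Printing Implicit Defensive.

Import Order.TTheory GRing.Theory Num.Theory.
Import numFieldNormedType.Exports.
Local Open Scope classical_set_scope.
Local Open Scope ring_scope.

(** * Hilbert spaces with real-valued norms *)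

Section RealNorm.
Variable R : realType.
Local Notation C := R[i].
Local Notation normc := ComplexField.Normc.normc.

Lemma normcE (z : C) : `|z| = (normc z)%:C%C.
Proof. by rewrite normc_def; case: z => a b. Qed.

Lemma normc_real (a : R) : normc a%:C%C = `|a|.
Proof. by rewrite /= expr0n /= addr0 sqrtr_sqr. Qed.

Lemma mul_conj (z : C) : z * Num.conj z = (normc z ^+ 2)%:C%C.
Proof. by rewrite -normCK normcE rmorphXn. Qed.

Variable H : hilbertType R.
Implicit Types x y z : H.

(** The norm of a complex normed module takes its values in the complex field,
    where the order is partial; its real part is easier to compute with. *)
Definition rn x : R := complex.Re `|x|.

Lemma rnE x : `|x| = (rn x)%:C%C.
Proof. by rewrite RRe_real// ger0_real. Qed.

Lemma rn_ge0 x : 0 <= rn x.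
Proof. by rewrite -ler0c -rnE. Qed.

Lemma rn0 : rn (0 : H) = 0.
Proof. by rewrite /rn normr0. Qed.

Lemma rn_eq0 x : rn x = 0 -> x = 0.
Proof. by move=> x0; apply/eqP; rewrite -normr_eq0 rnE x0. Qed.

Lemma rnD x y : rn (x + y) <= rn x + rn y.
Proof. by rewrite -lecR rmorphD /= -!rnE ler_normD. Qed.

Lemma rnN x : rn (- x) = rn x.
Proof. by rewrite /rn normrN. Qed.

Lemma rn_distC x y : rn (x - y) = rn (y - x).
Proof. by rewrite -rnN opprB. Qed.

Lemma rn_distD z x y : rn (x - y) <= rn (x - z) + rn (z - y).
Proof. by rewrite (le_trans _ (rnD _ _))// addrA subrK. Qed.

Lemma rnZ (a : C) x : rn (a *: x) = normc a * rn x.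
Proof.
have : ((rn (a *: x))%:C)%C = ((normc a * rn x)%:C)%C :> C.
  by rewrite rmorphM /= -!rnE -normcE normrZ.
by move=> [].
Qed.

Lemma rn_sum I (r : seq I) (F : I -> H) :
  rn (\sum_(i <- r) F i) <= \sum_(i <- r) rn (F i).
Proof.
elim: r => [|i r IH]; first by rewrite !big_nil rn0.
by rewrite !big_cons (le_trans (rnD _ _))// lerD2l.
Qed.

Lemma hdotC x y : hdot x y = Num.conj (hdot y x) :> C.
Proof. by have /= := hermC (@hdot R H) x y; rewrite expr0 mul1r. Qed.

Lemma hdotDl x y z : hdot (x + y) z = hdot x z + hdot y z.
Proof. by rewrite linearDl. Qed.

Lemma hdotZl a x z : hdot (a *: x) z = a * hdot x z.
Proof. by rewrite linearZl. Qed.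

Lemma hdotDr x y z : hdot z (x + y) = hdot z x + hdot z y.
Proof. by rewrite linearDr. Qed.

Lemma hdotZr a x z : hdot z (a *: x) = Num.conj a * hdot z x.
Proof. by rewrite hdotC hdotZl rmorphM /= -hdotC. Qed.

Lemma hdot0l x : hdot 0 x = 0 :> C. Proof. by rewrite linear0l. Qed.

Lemma hdot0r x : hdot x 0 = 0 :> C. Proof. by rewrite linear0r. Qed.

Lemma hdotNl x y : hdot (- x) y = - hdot x y :> C.
Proof. by rewrite -scaleN1r hdotZl mulN1r. Qed.

Lemma hdotNr x y : hdot x (- y) = - hdot x y :> C.
Proof. by rewrite hdotC hdotNl rmorphN /= -hdotC. Qed.

Lemma hdotBl x y z : hdot (x - y) z = hdot x z - hdot y z.
Proof. by rewrite hdotDl hdotNl. Qed.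

Lemma hdotBr x y z : hdot z (x - y) = hdot z x - hdot z y.
Proof. by rewrite hdotDr hdotNr. Qed.

Lemma hdot_suml I (r : seq I) (F : I -> H) y :
  hdot (\sum_(i <- r) F i) y = \sum_(i <- r) hdot (F i) y.
Proof.
elim: r => [|i r IH]; first by rewrite !big_nil hdot0l.
by rewrite !big_cons hdotDl IH.
Qed.

Lemma hdot_sumr I (r : seq I) (F : I -> H) y :
  hdot y (\sum_(i <- r) F i) = \sum_(i <- r) hdot y (F i).
Proof.
elim: r => [|i r IH]; first by rewrite !big_nil hdot0r.
by rewrite !big_cons hdotDr IH.
Qed.

Lemma hdot_rn x : hdot x x = (rn x ^+ 2)%:C%C.
Proof. by rewrite hdot_norm rnE rmorphXn. Qed.

Lemma rn_hdot x : rn x ^+ 2 = complex.Re (hdot x x).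
Proof. by rewrite hdot_rn. Qed.

Lemma hdot_CS x y : normc (hdot x y) <= rn x * rn y.
Proof.
have dn z : dnorm hdot z = (rn z)%:C%C.
  apply/eqP; rewrite -(@eqrXn2 _ 2)// ?sqrt_dnorm_ge0// ?ler0c ?rn_ge0//.
  by rewrite dnormK hdot_rn rmorphXn.
have := dot_CauchySchwarz hdot x y.
by rewrite !dn normcE -rmorphM lecR.
Qed.

Lemma hdot_Re_CS x y : complex.Re (hdot x y) <= rn x * rn y.
Proof.
apply: le_trans (hdot_CS x y); apply: le_trans (ler_norm _) _.
by have [] := normc_ge_Re_Im (hdot x y).
Qed.

Lemma rn_sqD x y :
  rn (x + y) ^+ 2 = rn x ^+ 2 + rn y ^+ 2 + 2 * complex.Re (hdot x y).
Proof.
rewrite !rn_hdot hdotDl !hdotDr (hdotC y x).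
by case: (hdot x x) (hdot y y) (hdot x y) => [a b] [c d] [e f] /=; lra.
Qed.

Lemma pythagoras x y : hdot x y = 0 -> rn (x + y) ^+ 2 = rn x ^+ 2 + rn y ^+ 2.
Proof. by move=> xy; rewrite rn_sqD xy mulr0 addr0. Qed.

Lemma parallelogram x y :
  rn (x + y) ^+ 2 + rn (x - y) ^+ 2 = 2 * rn x ^+ 2 + 2 * rn y ^+ 2.
Proof. by rewrite !rn_sqD hdotNr rnN; case: (hdot x y) => a b /=; lra. Qed.

Lemma hdot_ext x y : (forall z, hdot x z = hdot y z) -> x = y.
Proof.
move=> xy; apply/subr0_eq/rn_eq0/eqP; rewrite -sqrf_eq0 rn_hdot hdotBl xy.
by rewrite subrr.
Qed.

Lemma hdot_extr x y : (forall z, hdot z x = hdot z y) -> x = y.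
Proof. by move=> xy; apply: hdot_ext => z; rewrite hdotC xy -hdotC. Qed.

Lemma closure_rnP (A : set H) x :
  closure A x <-> forall e : R, 0 < e -> exists2 a, A a & rn (x - a) < e.
Proof.
split=> [clA e e0|h B /nbhs_ballP[e /= e0 xeB]].
  have [|a [Aa]] := clA (ball x e%:C%C).
    by apply: nbhsx_ballx; rewrite ltcR.
  by rewrite -ball_normE /= rnE ltcR => ?; exists a.
have eE : e = (complex.Re e)%:C%C by rewrite RRe_real// gtr0_real.
have e0' : 0 < complex.Re e by rewrite -ltcR -eE.
have [a Aa xa] := h _ e0'; exists a; split=> //; apply: xeB.
by rewrite -ball_normE /= rnE eE ltcR.
Qed.

(** The explicit rate e survives in the limit; stating completeness this way
    keeps filters out of the limits of operators below. *)
Lemma hilbert_complete (v : nat -> H) (e : nat -> R) :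
  (forall d, 0 < d -> exists N, forall p, (N <= p)%N -> e p < d) ->
  (forall p q, rn (v p - v q) <= e p + e q) ->
  exists l, forall p, rn (v p - l) <= e p.
Proof.
move=> e_small v_cauchy.
have cv : cvgn v.
  apply: cauchy_cvg; apply/cauchyP => d d0.
  have dE : d = (complex.Re d)%:C%C by rewrite RRe_real// gtr0_real.
  have d0' : 0 < complex.Re d by rewrite -ltcR -dE.
  have [N HN] := e_small _ (divr_gt0 d0' (ltr0n _ 2)).
  exists (v N); exists N => // p /= Np; rewrite /= -ball_normE /= rnE dE ltcR.
  by rewrite (le_lt_trans (v_cauchy _ _))// [ltRHS]splitr ltrD ?HN.
exists (limn v) => p; apply/ler_addgt0Pr => d d0.
have [N HN] := e_small _ (divr_gt0 d0 (ltr0n _ 2)).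
have d20 : 0 < (d / 2)%:C%C :> C by rewrite ltcR divr_gt0.
have [M _ HM] := (cvgrPdist_lt _ _).1 cv _ d20.
have HN' := HN (maxn N M) (leq_maxl _ _).
have := HM (maxn N M) (leq_maxr _ _); rewrite /= rnE ltcR => HM'.
apply: le_trans (rn_distD (v (maxn N M)) _ _) _.
have := v_cauchy p (maxn N M); rewrite rn_distC in HM'.
by move: HN' HM'; set s := e (maxn N M); set t := rn (_ - limn v); lra.
Qed.

Lemma invn_small (d : R) : 0 < d ->
  exists N, forall p, (N <= p)%N -> (p.+1%:R^-1 : R) < d.
Proof.
move=> d0; have di : 0 < d^-1 by rewrite invr_gt0.
exists (Num.truncn d^-1) => p Np; rewrite -[d]invrK ltf_pV2 ?posrE//.
by rewrite (lt_le_trans (truncnS_gt _))// ler_nat ltnS.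
Qed.

End RealNorm.

(** * Bounded operators *)

Section Bounded.
Variable R : realType.
Local Notation C := R[i].
Local Notation normc := ComplexField.Normc.normc.

Section Linear.
Variables (U V : lmodType C) (T : U -> V).
Hypothesis linT : linear T.

Lemma lin0 : T 0 = 0.
Proof. by have := linT (-1) 0 0; rewrite scaler0 addr0 scaleN1r addNr. Qed.

Lemma linD x y : T (x + y) = T x + T y.
Proof. by have := linT 1 x y; rewrite !scale1r. Qed.

Lemma linZ a x : T (a *: x) = a *: T x.
Proof. by have := linT a x 0; rewrite lin0 !addr0. Qed.

Lemma linN x : T (- x) = - T x.
Proof. by rewrite -scaleN1r linZ scaleN1r. Qed.

Lemma linB x y : T (x - y) = T x - T y.
Proof. by rewrite linD linN. Qed.

Lemma lin_sum I (r : seq I) (F : I -> U) :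
  T (\sum_(i <- r) F i) = \sum_(i <- r) T (F i).
Proof.
elim: r => [|i r IH]; first by rewrite !big_nil lin0.
by rewrite !big_cons linD IH.
Qed.

End Linear.

Lemma sumfE (S : Type) (V : lmodType C) I (r : seq I) (F : I -> S -> V) x :
  (\sum_(i <- r) F i) x = \sum_(i <- r) F i x.
Proof.
by elim: r => [|i r IH]; rewrite ?big_nil// !big_cons -IH.
Qed.

Implicit Types (H K L : hilbertType R).

Definition obound H K (T : H -> K) (c : R) := forall x, rn (T x) <= c * rn x.

Lemma bounded_opP H K (T : H -> K) :
  bounded_op T <-> linear T /\ exists2 c, 0 <= c & obound T c.
Proof.
split=> [[lT cT]|[lT [c c0 Tc]]]; split=> //.
  have /cvgrPdist_lt/(_ 1 ltr01) := cT 0.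
  rewrite nearE => /nbhs_ballP[d /= d0 Hd].
  rewrite /= (lin0 lT) in Hd.
  have dE : d = (complex.Re d)%:C%C by rewrite RRe_real// gtr0_real.
  have d0' : 0 < complex.Re d by rewrite -ltcR -dE.
  set e := complex.Re d in dE d0'.
  exists (2 / e); first by rewrite divr_ge0// ltW.
  move=> x; have [->|x0] := eqVneq x 0; first by rewrite (lin0 lT) !rn0 mulr0.
  have nx : 0 < rn x.
    by rewrite lt_neqAle rn_ge0 andbT eq_sym; apply: contra_neq x0; exact: rn_eq0.
  (* x is scaled to length e / 2, inside the ball given by continuity at 0 *)
  have := Hd ((e / (2 * rn x))%:C%C *: x).
  rewrite -ball_normE /= !sub0r !normrN (linZ lT) rnE rnZ normc_real dE ltcR.
  have -> : `|e / (2 * rn x)| * rn x = e / 2.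
    rewrite ger0_norm; last by rewrite divr_ge0// ?mulr_ge0// ltW.
    by field; rewrite gt_eqF.
  rewrite ltr_pdivrMr// ltr_pMr// ltr1n => /(_ isT).
  rewrite rnE rnZ normc_real ger0_norm; last by rewrite divr_ge0 ?mulr_ge0// ltW.
  rewrite (_ : 1 = 1%:C%C)// ltcR => h.
  have : e / (2 * rn x) * rn (T x) * (2 / e * rn x) <= 1 * (2 / e * rn x).
    by rewrite ler_wpM2r ?mulr_ge0 ?rn_ge0 ?invr_ge0 // ltW.
  rewrite mul1r; apply: le_trans; rewrite le_eqVlt; apply/orP; left; apply/eqP.
  by field; rewrite !gt_eqF.
move=> x; apply/cvgrPdist_lt => e e0.
have eE : e = (complex.Re e)%:C%C by rewrite RRe_real// gtr0_real.
have e0' : 0 < complex.Re e by rewrite -ltcR -eE.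
have c1 : 0 < c + 1 by rewrite ltr_wpDl.
rewrite nearE; apply/nbhs_ballP.
exists (complex.Re e / (c + 1))%:C%C => /=; first by rewrite ltcR divr_gt0.
move=> y; rewrite -ball_normE /= -(linB lT) !rnE eE !ltcR ltr_pdivlMr// => h.
rewrite (le_lt_trans (Tc _))// (le_lt_trans _ h)// mulrC ler_wpM2l ?rn_ge0//.
by rewrite lerDl.
Qed.

Lemma bounded_lin H K (T : H -> K) : bounded_op T -> linear T.
Proof. by case. Qed.

Lemma bounded_ge0 H K (T : H -> K) : bounded_op T -> exists2 c, 0 <= c & obound T c.
Proof. by move=> /bounded_opP[]. Qed.

Lemma bounded_of H K (T : H -> K) c : linear T -> obound T c -> bounded_op T.
Proof.
move=> lT Tc; apply/bounded_opP; split=> //; exists `|c| => // x.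
by rewrite (le_trans (Tc x))// ler_wpM2r ?rn_ge0// ler_norm.
Qed.

Lemma obound_le H K (T : H -> K) c d : obound T c -> c <= d -> obound T d.
Proof. by move=> Tc cd x; rewrite (le_trans (Tc x))// ler_wpM2r ?rn_ge0. Qed.

Lemma oboundD H K (S T : H -> K) c d :
  obound S c -> obound T d -> obound (S + T) (c + d).
Proof. by move=> Sc Td x; rewrite (le_trans (rnD _ _))// mulrDl lerD. Qed.

Lemma oboundZ H K (T : H -> K) a c : obound T c -> obound (a *: T) (normc a * c).
Proof. by move=> Tc x; rewrite rnZ -mulrA ler_wpM2l ?normc_ge0. Qed.

Lemma oboundN H K (T : H -> K) c : obound T c -> obound (- T) c.
Proof. by move=> Tc x; rewrite rnN. Qed.

Lemma oboundB H K (S T : H -> K) c d :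
  obound S c -> obound T d -> obound (S - T) (c + d).
Proof. by move=> Sc Td; apply: oboundD => //; exact: oboundN. Qed.

Lemma obound_distC H K (S T : H -> K) c : obound (S - T) c -> obound (T - S) c.
Proof. by move=> h x; rewrite rn_distC; exact: h. Qed.

Lemma obound_comp H K L (S : K -> L) (T : H -> K) c d : 0 <= c ->
  obound S c -> obound T d -> obound (S \o T) (c * d).
Proof. by move=> c0 Sc Td x; rewrite (le_trans (Sc _))// -mulrA ler_wpM2l. Qed.

Lemma obound0 H K c : 0 <= c -> obound (0 : H -> K) c.
Proof. by move=> c0 x; rewrite rn0 mulr_ge0 ?rn_ge0. Qed.

Lemma obound_eps H K (T : H -> K) c :
  (forall e, 0 < e -> obound T (c + e)) -> obound T c.
Proof.
move=> Tc x; apply/ler_addgt0Pr => e e0.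
have n0 : 0 < rn x + 1 by rewrite ltr_wpDl ?rn_ge0.
have := Tc _ (divr_gt0 e0 n0) x; rewrite mulrDl => /le_trans; apply.
by rewrite lerD2l mulrAC ler_pdivrMr// ler_wpM2l ?lerDl// ltW.
Qed.

Lemma obound_zero H K (T : H -> K) : (forall e, 0 < e -> obound T e) -> T = 0.
Proof.
move=> T0; apply/funext => x; apply: rn_eq0; apply/eqP.
rewrite eq_le rn_ge0 andbT -(mul0r (rn x)).
by move: x; apply: obound_eps => e e0; rewrite add0r; exact: T0.
Qed.

Lemma linear_comp H K L (S : K -> L) (T : H -> K) :
  linear S -> linear T -> linear (S \o T).
Proof. by move=> lS lT a x y; rewrite /= lT lS. Qed.

Lemma bounded_id H : bounded_op (idfun : H -> H).
Proof. by apply: (@bounded_of _ _ _ 1) => // x; rewrite mul1r. Qed.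

Lemma bounded_comp H K L (S : K -> L) (T : H -> K) :
  bounded_op S -> bounded_op T -> bounded_op (S \o T).
Proof.
move=> /bounded_opP[lS [c c0 Sc]] /bounded_opP[lT [d d0 Td]].
by apply: (@bounded_of _ _ _ (c * d)); [exact: linear_comp|exact: obound_comp].
Qed.

Lemma bounded_lincomb H K a (S T : H -> K) :
  bounded_op S -> bounded_op T -> bounded_op (a *: S + T).
Proof.
move=> /bounded_opP[lS [c c0 Sc]] /bounded_opP[lT [d d0 Td]].
apply: (@bounded_of _ _ _ (normc a * c + d)).
  move=> b x y; rewrite !fctE lS lT !scalerDr !scalerA (mulrC a b).
  by rewrite -!addrA; congr (_ + _); rewrite addrCA.
by apply: oboundD => //; exact: oboundZ.
Qed.

Lemma bounded_0 H K : bounded_op (0 : H -> K).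
Proof.
apply: (@bounded_of _ _ _ 0) => [a x y|x]; first by rewrite /= scaler0 addr0.
by rewrite rn0 mul0r.
Qed.

Lemma bounded_D H K (S T : H -> K) : bounded_op S -> bounded_op T -> bounded_op (S + T).
Proof. by move=> bS bT; rewrite -[S]scale1r; exact: bounded_lincomb. Qed.

Lemma bounded_Z H K a (T : H -> K) : bounded_op T -> bounded_op (a *: T).
Proof. by move=> bT; rewrite -[_ *: _]addr0; apply: bounded_lincomb => //; exact: bounded_0. Qed.

Lemma bounded_B H K (S T : H -> K) : bounded_op S -> bounded_op T -> bounded_op (S - T).
Proof. by move=> bS bT; rewrite -scaleN1r addrC; exact: bounded_lincomb. Qed.

Lemma bounded_sum H K I (r : seq I) (F : I -> H -> K) :
  (forall i, bounded_op (F i)) -> bounded_op (\sum_(i <- r) F i).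
Proof.
move=> bF; elim: r => [|i r IH]; first by rewrite big_nil; exact: bounded_0.
by rewrite big_cons; exact: bounded_D.
Qed.

Lemma comp_suml H K L I (r : seq I) (F : I -> K -> L) (T : H -> K) :
  (\sum_(i <- r) F i) \o T = \sum_(i <- r) (F i \o T).
Proof. by apply/funext => x; rewrite /= !sumfE. Qed.

Lemma comp_sumr H K L I (r : seq I) (F : I -> H -> K) (T : K -> L) : linear T ->
  T \o (\sum_(i <- r) F i) = \sum_(i <- r) (T \o F i).
Proof. by move=> lT; apply/funext => x; rewrite /= !sumfE (lin_sum lT). Qed.

Lemma comp_Zl H K L a (F : K -> L) (T : H -> K) : (a *: F) \o T = a *: (F \o T).
Proof. by []. Qed.

Lemma comp_Zr H K L a (F : H -> K) (T : K -> L) : linear T ->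
  T \o (a *: F) = a *: (T \o F).
Proof. by move=> lT; apply/funext => x; rewrite /= (linZ lT). Qed.

End Bounded.

(** * Adjoints, limits and extensions of operators *)

Section Adjoint.
Variable R : realType.
Local Notation C := R[i].
Local Notation normc := ComplexField.Normc.normc.
Implicit Types (H K L : hilbertType R).

Lemma Re_sub (x y : C) : complex.Re (x - y) = complex.Re x - complex.Re y.
Proof. by case: x y => [? ?] [? ?]. Qed.

Lemma lincombB (V : lmodType C) a (p q r s : V) :
  a *: p + q - (a *: r + s) = a *: (p - r) + (q - s).
Proof. by rewrite scalerBr opprD addrACA. Qed.

(** A linear form is recovered from its real part, as Im (f x) = - Re (f (i x)). *)
Lemma lin_form_eq H (f g : H -> C) :
  (forall a x, f (a *: x) = a * f x) -> (forall a x, g (a *: x) = a * g x) ->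
  (forall x, complex.Re (f x) = complex.Re (g x)) -> forall x, f x = g x.
Proof.
move=> fZ gZ fg x; have := fg ('i%C *: x); rewrite fZ gZ; move: (fg x).
by case: (f x) (g x) => [a b] [c d] /= -> h; congr Complex; lra.
Qed.

(** Riesz representation, by minimising the strictly convex functional
    |x|^2 - 2 Re (f x): the parallelogram law makes every minimising sequence
    Cauchy, and the first variation at the minimum is the representation. *)
Lemma riesz H (f : H -> C) c :
  (forall a x y, f (a *: x + y) = a * f x + f y) ->
  (forall x, normc (f x) <= c * rn x) ->
  exists z, forall x, f x = hdot x z.
Proof.
move=> fl fc.
have f0 : f 0 = 0 by have := fl (-1) 0 0; rewrite scaler0 addr0 mulN1r addNr.
have fZ a x : f (a *: x) = a * f x by have := fl a x 0; rewrite f0 !addr0.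
have fD x y : f (x + y) = f x + f y by have := fl 1 x y; rewrite scale1r mul1r.
pose J x := rn x ^+ 2 - 2 * complex.Re (f x).
have Jlow x : - c ^+ 2 <= J x.
  have h : complex.Re (f x) <= c * rn x.
    by apply: le_trans (fc x); apply: le_trans (ler_norm _) (normc_ge_Re_Im _).1.
  have := sqr_ge0 (rn x - c); rewrite /J => h2.
  rewrite -subr_ge0; move: h2; rewrite -subr_ge0 in h; nra.
have lbJ : has_inf (range J).
  by split; [exists (J 0), 0|exists (- c ^+ 2) => _ [x _ <-]].
pose I := inf (range J).
have JI x : I <= J x by apply: ge_inf; [case: lbJ|exists x].
have ex p : exists x, J x < I + (p.+1%:R^-1) ^+ 2.
  have [|_ [x _ <-] Jx] := inf_adherent (eps := (p.+1%:R^-1) ^+ 2) _ lbJ.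
    by rewrite exprn_gt0// invr_gt0.
  by exists x.
have [v Jv] := choice ex.
have key x y : rn (x - y) ^+ 2 <= 2 * (J x - I) + 2 * (J y - I).
  have := parallelogram x y; have := JI (2^-1%:C%C *: (x + y)).
  rewrite /J rnZ normc_real ger0_norm ?invr_ge0// fZ fD.
  have -> : complex.Re ((2^-1)%:C%C * (f x + f y)) =
     2^-1 * (complex.Re (f x) + complex.Re (f y)).
    by case: (f x) (f y) => [? ?] [? ?] /=; lra.
  rewrite exprMn; move: (rn (x + y)) (rn (x - y)) (rn x) (rn y) => a b r s; nra.
have [z Hz] : exists l, forall p, rn (v p - l) <= 2 * p.+1%:R^-1.
  apply: hilbert_complete => [d d0|p q].
    have [N HN] := invn_small (divr_gt0 d0 (ltr0n _ 2)).
    by exists N => p /HN; rewrite ltr_pdivlMr// mulrC.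
  have p0 : 0 < p.+1%:R^-1 :> R by rewrite invr_gt0.
  have q0 : 0 < q.+1%:R^-1 :> R by rewrite invr_gt0.
  rewrite -(@ler_pXn2r _ 2)// ?nnegrE ?rn_ge0// ?addr_ge0 ?mulr_ge0// ?ltW//.
  have := key (v p) (v q); have := Jv p; have := Jv q.
  by move: (p.+1%:R^-1) (q.+1%:R^-1) p0 q0 (J _) (J _) (rn _) => a b ? ? j k r; nra.
have Jz : J z = I.
  apply/eqP; rewrite eq_le JI andbT; apply/ler_addgt0Pr => e e0.
  pose B := 4 * rn z + 4 * `|c| + 6.
  have B0 : 0 < B.
    by rewrite /B; have := rn_ge0 z; have := normr_ge0 c; lra.
  have [N HN] := invn_small (divr_gt0 e0 B0).
  set t := N.+1%:R^-1 : R.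
  have t0 : 0 < t by rewrite invr_gt0.
  have t1 : t <= 1 by rewrite invf_le1// ler1n.
  have tB : t * B < e by rewrite -ltr_pdivlMr// HN.
  have Jvz : J z <= J (v N) + 4 * (rn z + `|c|) * t.
    rewrite /J; have := Hz N; rewrite -/t => h.
    have h1 := rn_sqD (v N) (z - v N); rewrite addrC subrK rn_distC in h1.
    have h2 : complex.Re (hdot (v N) (z - v N)) =
       complex.Re (hdot z (z - v N)) - rn (z - v N) ^+ 2.
      by rewrite rn_hdot -Re_sub -hdotBl subKr.
    have h3 : complex.Re (hdot z (z - v N)) <= rn z * rn (z - v N) := hdot_Re_CS _ _.
    have h4 : - complex.Re (f (z - v N)) <= `|c| * rn (z - v N).
      apply: le_trans (ler_norm _) _; rewrite normrN.
      apply: le_trans (normc_ge_Re_Im _).1 _; apply: le_trans (fc _) _.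
      by rewrite ler_wpM2r ?rn_ge0// ler_norm.
    have h5 : complex.Re (f z) = complex.Re (f (v N)) + complex.Re (f (z - v N)).
      by rewrite -[in LHS](subrK (v N) z) addrC fD; case: (f _) (f _) => ? ? [].
    rewrite (rn_distC z) in h2 h3 h4.
    have rz := rn_ge0 z; have nc := normr_ge0 c; have rd := rn_ge0 (v N - z).
    have k1 := ler_wpM2l rz h; have k2 := ler_wpM2l nc h.
    by have := sqr_ge0 (rn (v N - z)); lra.
  have := Jv N; rewrite -/t => h.
  move: tB; rewrite /B; nra.
exists z; apply: lin_form_eq => // [a x|x]; first by rewrite hdotZl.
have var t : 0 <= t ^+ 2 * rn x ^+ 2 + 2 * t * complex.Re (hdot x z - f x).
  have := JI (t%:C%C *: x + z); rewrite -Jz /J rn_sqD rnZ normc_real hdotZl fD fZ.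
  rewrite exprMn real_normK ?num_real//.
  by case: (f x) (f z) (hdot x z) => [a b] [c' d] [c1 d1] /=; lra.
apply/esym/eqP; rewrite -subr_eq0 -Re_sub; set s := complex.Re _ in var *.
apply/eqP; apply: contrapT => /eqP s0.
have q0 : 0 < rn x ^+ 2 + 1 by rewrite ltr_wpDl// sqr_ge0.
(* a small step against the sign of s makes the variation negative unless s = 0 *)
have := var (- s / (rn x ^+ 2 + 1)).
set q := rn x ^+ 2 in q0 *.
have -> : (- s / (q + 1)) ^+ 2 * q + 2 * (- s / (q + 1)) * s =
   - (s / (q + 1)) ^+ 2 * (q + 2) by field; rewrite gt_eqF.
rewrite mulNr oppr_ge0 leNgt mulr_gt0//; last by rewrite ltr_wpDl ?sqr_ge0.
by rewrite exprn_even_gt0//= mulf_neq0// invr_eq0 gt_eqF.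
Qed.

Lemma adjoint_unique H K (T : H -> K) (S : K -> H) :
  (forall x y, hdot (T x) y = hdot x (S y)) -> adjoint T = S.
Proof.
move=> TS; apply/funext => y; apply: hdot_extr => x; rewrite -TS /adjoint.
by case: xgetP => [z _ /= ->//|/(_ (S y))]; case=> z; exact: TS.
Qed.

Lemma adjointP H K (T : H -> K) : bounded_op T ->
  forall x y, hdot (T x) y = hdot x (adjoint T y).
Proof.
move=> /bounded_opP[lT [c c0 Tc]] x y; rewrite /adjoint.
case: xgetP => [z _ /= -> //|none].
have [| |z zP] := @riesz _ (fun x => hdot (T x) y) (c * rn y).
- by move=> a u v; rewrite lT hdotDl hdotZl.
- by move=> x'; rewrite (le_trans (hdot_CS _ _))// mulrAC ler_wpM2r ?rn_ge0.
- by case: (none z).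
Qed.

Lemma adjointPr H K (T : H -> K) : bounded_op T ->
  forall x y, hdot (adjoint T y) x = hdot y (T x).
Proof. by move=> bT x y; rewrite hdotC -adjointP// -hdotC. Qed.

Lemma obound_hdot H K (S : H -> K) c : 0 <= c ->
  (forall x y, normc (hdot (S x) y) <= c * rn x * rn y) -> obound S c.
Proof.
move=> c0 h x; have := h x (S x); rewrite hdot_rn normc_real ger0_norm ?sqr_ge0//.
have [->|n0] := eqVneq (rn (S x)) 0.
  by move=> _; rewrite mulr_ge0 ?rn_ge0.
by rewrite expr2 ler_pM2r// lt_neqAle eq_sym n0 rn_ge0.
Qed.

Lemma adjoint_linear H K (T : H -> K) : bounded_op T -> linear (adjoint T).
Proof.
move=> bT a x y; apply: hdot_extr => z.
by rewrite hdotDr hdotZr -!adjointP// hdotDr hdotZr.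
Qed.

Lemma adjoint_obound H K (T : H -> K) c : 0 <= c -> bounded_op T -> obound T c ->
  obound (adjoint T) c.
Proof.
move=> c0 bT Tc; apply: obound_hdot => // y x; rewrite adjointPr//.
by rewrite (le_trans (hdot_CS _ _))// mulrC mulrAC ler_wpM2r ?rn_ge0.
Qed.

Lemma bounded_adjoint H K (T : H -> K) : bounded_op T -> bounded_op (adjoint T).
Proof.
move=> bT; have [c c0 Tc] := bounded_ge0 bT.
by apply: (@bounded_of _ _ _ _ c); [exact: adjoint_linear|exact: adjoint_obound].
Qed.

Lemma adjointK H K (T : H -> K) : bounded_op T -> adjoint (adjoint T) = T.
Proof. by move=> bT; apply: adjoint_unique => x y; rewrite adjointPr. Qed.

Lemma adjoint_comp H K L (S : K -> L) (T : H -> K) : bounded_op S -> bounded_op T ->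
  adjoint (S \o T) = adjoint T \o adjoint S.
Proof. by move=> bS bT; apply: adjoint_unique => x y; rewrite /= !adjointP. Qed.

Lemma adjoint_lincomb H K a (S T : H -> K) : bounded_op S -> bounded_op T ->
  adjoint (a *: S + T) = Num.conj a *: adjoint S + adjoint T.
Proof.
move=> bS bT; apply: adjoint_unique => x y.
by rewrite !fctE hdotDl hdotZl hdotDr hdotZr conjCK !adjointP.
Qed.

Lemma adjoint_id H : adjoint (idfun : H -> H) = idfun.
Proof. exact: adjoint_unique. Qed.

Lemma adjoint_0 H K : adjoint (0 : H -> K) = 0.
Proof. by apply: adjoint_unique => x y; rewrite hdot0l hdot0r. Qed.

Lemma adjoint_D H K (S T : H -> K) : bounded_op S -> bounded_op T ->
  adjoint (S + T) = adjoint S + adjoint T.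
Proof. by move=> bS bT; rewrite -[S]scale1r adjoint_lincomb// rmorph1 !scale1r. Qed.

Lemma adjoint_Z H K a (T : H -> K) : bounded_op T ->
  adjoint (a *: T) = Num.conj a *: adjoint T.
Proof.
move=> bT; rewrite -[a *: T]addr0 adjoint_lincomb//; last exact: bounded_0.
by rewrite adjoint_0 addr0.
Qed.

Lemma adjoint_sum H K I (r : seq I) (F : I -> H -> K) :
  (forall i, bounded_op (F i)) ->
  adjoint (\sum_(i <- r) F i) = \sum_(i <- r) adjoint (F i).
Proof.
move=> bF; elim: r => [|i r IH]; first by rewrite !big_nil adjoint_0.
by rewrite !big_cons adjoint_D// ?IH//; exact: bounded_sum.
Qed.

Lemma isometric_rn H K (T : H -> K) : isometric T -> forall x, rn (T x) = rn x.
Proof. by move=> iT x; rewrite /rn iT. Qed.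

Lemma isometric_bounded H K (T : H -> K) : linear T -> isometric T -> bounded_op T.
Proof.
move=> lT iT; apply: (@bounded_of _ _ _ _ 1) => // x.
by rewrite isometric_rn// mul1r.
Qed.

(** The real parts agree by polarisation. *)
Lemma isometric_hdot H K (T : H -> K) : linear T -> isometric T ->
  forall x y, hdot (T x) (T y) = hdot x y.
Proof.
move=> lT iT x y; move: x; apply: lin_form_eq => [a x|a x|x].
- by rewrite (linZ lT) hdotZl.
- by rewrite hdotZl.
have := rn_sqD (T x) (T y); rewrite -(linD lT) !(isometric_rn iT) rn_sqD; lra.
Qed.

Lemma isometric_adjointK H K (T : H -> K) : bounded_op T -> isometric T ->
  adjoint T \o T = idfun.
Proof.
move=> bT iT; apply/funext => x; apply: hdot_extr => y.
by rewrite /= -adjointP// isometric_hdot//; exact: bounded_lin.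
Qed.

(** The limit is taken pointwise; the rate is uniform on vectors of a given norm,
    which makes the limit linear and bounded. *)
Lemma op_complete H K (T : nat -> H -> K) (e : nat -> R) :
  (forall d, 0 < d -> exists N, forall p, (N <= p)%N -> e p < d) ->
  (forall p, bounded_op (T p)) -> (forall p, 0 <= e p) ->
  (forall p q, obound (T p - T q) (e p + e q)) ->
  exists2 S, bounded_op S & forall p, obound (T p - S) (e p).
Proof.
move=> e0 bT ege TT.
have /choice[S Sx] x : exists l, forall p, rn (T p x - l) <= e p * rn x.
  apply: hilbert_complete => [d d0|p q].
    have n0 : 0 < rn x + 1 by rewrite ltr_wpDl ?rn_ge0.
    have [N HN] := e0 _ (divr_gt0 d0 n0); exists N => p /HN.
    rewrite ltr_pdivlMr//; apply: le_lt_trans.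
    by rewrite ler_wpM2l// lerDl.
  by rewrite -mulrDl; exact: TT.
exists S; last by move=> p x; exact: Sx.
have [c c0 Tc] := bounded_ge0 (bT 0%N).
apply: (@bounded_of _ _ _ _ (c + e 0%N)) => [a x y|x].
  apply: subr0_eq; apply: rn_eq0; apply/eqP; rewrite eq_le rn_ge0 andbT.
  apply/ler_addgt0Pr => d d0; rewrite add0r.
  pose B := rn (a *: x + y) + normc a * rn x + rn y + 1.
  have B0 : 0 < B.
    by rewrite /B ltr_wpDl// !addr_ge0 ?mulr_ge0 ?rn_ge0 ?normc_ge0.
  have [N HN] := e0 _ (divr_gt0 d0 B0).
  have := HN N (leqnn _); rewrite ltr_pdivlMr// => /ltW; apply: le_trans.
  have -> : S (a *: x + y) - (a *: S x + S y) =
     - (T N (a *: x + y) - S (a *: x + y)) + (a *: (T N x - S x) + (T N y - S y)).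
    by rewrite (bounded_lin (bT N)) -lincombB opprB addrA subrK.
  rewrite (le_trans (rnD _ _))// rnN.
  have h1 := Sx (a *: x + y) N; have h2 := Sx x N; have h3 := Sx y N.
  have h4 := rnD (a *: (T N x - S x)) (T N y - S y); rewrite rnZ in h4.
  have h5 : normc a * rn (T N x - S x) <= normc a * (e N * rn x).
    by rewrite ler_wpM2l ?normc_ge0.
  by rewrite /B; have := ege N; nra.
rewrite mulrDl; have := rn_distD (T 0%N x) (S x) 0; rewrite !subr0 => /le_trans; apply.
by rewrite addrC lerD ?Tc// rn_distC.
Qed.

(** An operator prescribed on generators is a priori a linear relation, which may
    depend on how a vector is written; the bound makes it single-valued and lets
    it extend to the closure of its domain. *)
Lemma extend_graph H K (G : H -> K -> Prop) (c : R) : 0 <= c ->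
  (forall a x y x' y', G x y -> G x' y' -> G (a *: x + x') (a *: y + y')) ->
  (forall x y, G x y -> rn y <= c * rn x) ->
  closure [set x | exists y, G x y] = setT ->
  exists T : H -> K, [/\ bounded_op T, obound T c & forall x y, G x y -> T x = y].
Proof.
move=> c0 Glin Gc Gdense.
have GB x y x' y' : G x y -> G x' y' -> G (x - x') (y - y').
  move=> g g'; rewrite addrC [y - y']addrC -[- x']scaleN1r -[- y']scaleN1r.
  exact: Glin.
have ex x n : exists xy : H * K, G xy.1 xy.2 /\ rn (x - xy.1) < n.+1%:R^-1.
  have := (closure_rnP [set x | exists y, G x y] x).1; rewrite Gdense => /(_ I n.+1%:R^-1).
  by rewrite invr_gt0 ltr0n => /(_ isT)[x' [y g] h]; exists (x', y).
have /choice[T HT] x : exists y, forall x' y', G x' y' -> rn (y' - y) <= c * rn (x' - x).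
  have [v Hv] := choice (ex x).
  have vG n : G (v n).1 (v n).2 := (Hv n).1.
  have vx n : rn ((v n).1 - x) <= n.+1%:R^-1 by rewrite rn_distC ltW// (Hv n).2.
  have small d : 0 < d -> exists N, forall p, (N <= p)%N -> c * p.+1%:R^-1 < d.
    move=> d0; have [N HN] := invn_small (divr_gt0 d0 (ltr_pwDl ltr01 c0)).
    exists N => p /HN; rewrite ltr_pdivlMr ?ltr_pwDl// => h.
    apply: le_lt_trans h; rewrite mulrC ler_wpM2l ?invr_ge0// lerDr//.
  have [p q|y Hy] := hilbert_complete (v := fun n => (v n).2) small.
    rewrite (le_trans (Gc _ _ (GB _ _ _ _ (vG p) (vG q))))// -mulrDr ler_wpM2l//.
    by rewrite (le_trans (rn_distD x _ _))// lerD// rn_distC.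
  exists y => x' y' g; apply/ler_addgt0Pr => d d0.
  have [N HN] := small _ (divr_gt0 d0 (ltr0n _ 2)).
  have := HN N (leqnn _) => h.
  rewrite (le_trans (rn_distD (v N).2 _ _))//.
  have h1 := Gc _ _ (GB _ _ _ _ g (vG N)).
  have h2 := rn_distD x x' (v N).1; rewrite (rn_distC x) in h2.
  have h3 := ler_wpM2l c0 (le_trans h2 (lerD (lexx _) (vx N))).
  have := Hy N; move: h1 h3 h; rewrite mulrDr.
  move: (c * rn (x' - x)) (c * N.+1%:R^-1) (c * rn (x' - _)) => a b e; lra.
have Gx x e : 0 < e -> exists x' y', G x' y' /\ rn (x' - x) <= e.
  move=> e0; have := (closure_rnP [set x | exists y, G x y] x).1; rewrite Gdense => /(_ I _ e0)[x' [y g] h].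
  by exists x', y; split=> //; rewrite rn_distC ltW.
have Tg x y : G x y -> T x = y.
  by move=> /(HT x); rewrite subrr rn0 mulr0 => h; apply/esym/subr0_eq/rn_eq0/eqP;
  rewrite eq_le h rn_ge0.
have Tc : obound T c.
  move=> x; apply/ler_addgt0Pr => d d0.
  have B0 : 0 < 2 * c + 1 by rewrite ltr_wpDl// mulr_ge0.
  have [x' [y' [g h]]] := Gx x _ (divr_gt0 d0 B0).
  have h1 := HT x _ _ g; have h2 := Gc _ _ g.
  have := rn_distD y' (T x) 0; rewrite !subr0 rn_distC => /le_trans; apply.
  have := rn_distD x x' 0; rewrite !subr0 => h3.
  have h4 := ler_wpM2l c0 h3; have h5 := ler_wpM2l c0 h.
  have qd : d / (2 * c + 1) * (2 * c + 1) = d by rewrite divfK// gt_eqF.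
  have q0 := divr_gt0 d0 B0.
  by move: (d / _) h4 h5 qd q0 => q; rewrite mulrDr; lra.
exists T; split=> //; apply: (@bounded_of _ _ _ _ c) => //.
  move=> a x y; apply/subr0_eq/rn_eq0/eqP; rewrite eq_le rn_ge0 andbT.
  apply/ler_addgt0Pr => d d0; rewrite add0r.
  pose B := 2 * c * (normc a + 1) + 1.
  have B0 : 0 < B by rewrite ltr_wpDl// !mulr_ge0// addr_ge0 ?normc_ge0.
  have [x1 [y1 [g1 h1]]] := Gx x _ (divr_gt0 d0 B0).
  have [x2 [y2 [g2 h2]]] := Gx y _ (divr_gt0 d0 B0).
  have k1 := HT x _ _ g1; have k2 := HT y _ _ g2.
  have k3 := HT (a *: x + y) _ _ (Glin a _ _ _ _ g1 g2).
  set t := d / B in h1 h2.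
  have tB : t * B = d by rewrite divfK// gt_eqF.
  have := rn_distD (a *: y1 + y2) (T (a *: x + y)) (a *: T x + T y).
  move=> /le_trans; apply; rewrite rn_distC.
  rewrite !lincombB in k3 *.
  have k4 := rnD (a *: (x1 - x)) (x2 - y); rewrite rnZ in k4.
  have k5 := rnD (a *: (y1 - T x)) (y2 - T y); rewrite rnZ in k5.
  have na := normc_ge0 a.
  have k6 := ler_wpM2l na h1; have k7 := ler_wpM2l na k1.
  have k8 := ler_wpM2l c0 k4.
  have k9 := ler_wpM2l (mulr_ge0 c0 na) h1.
  have k10 := ler_wpM2l c0 h2.
  have t0 : 0 <= t by rewrite ltW// divr_gt0.
  move: tB k8 k9 k10 k7 k5 k3 k2; rewrite /B; nra.
Qed.

Lemma bounded_eq_dense H K (S T : H -> K) (D : set H) :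
  bounded_op S -> bounded_op T -> closure D = setT ->
  (forall x, D x -> S x = T x) -> S = T.
Proof.
move=> bS bT Ddense ST; apply/funext => x; apply/subr0_eq/rn_eq0/eqP.
have /bounded_opP[lB [c c0 Bc]] := bounded_B bS bT.
rewrite eq_le rn_ge0 andbT; apply/ler_addgt0Pr => d d0; rewrite add0r.
have c1 : 0 < c + 1 by rewrite ltr_wpDl.
have := (closure_rnP D x).1; rewrite Ddense => /(_ I _ (divr_gt0 d0 c1))[y Dy].
rewrite ltr_pdivlMr// => h.
have -> : S x - T x = (S - T) (x - y).
  by rewrite (linB lB) !fctE (ST _ Dy) subrr subr0.
rewrite (le_trans (Bc _))// (le_trans _ (ltW h))// mulrC ler_wpM2l ?rn_ge0//.
by rewrite lerDl.
Qed.

End Adjoint.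

(** * Operator norms *)

Section OperatorNorms.
Variable R : realType.
Local Notation C := R[i].
Implicit Types (H K L : hilbertType R).

Lemma normr_bound H K (T : H -> K) (c : R) x :
  (`|T x| <= c%:C%C * `|x|) = (rn (T x) <= c * rn x).
Proof. by rewrite !rnE -rmorphM lecR. Qed.

(** This turns the norms, which are infima, into the best admissible constants. *)
Lemma inf_attained (P : R -> Prop) :
  (exists2 c, 0 <= c & P c) -> (forall c d, c <= d -> P c -> P d) ->
  (forall c, (forall e, 0 < e -> P (c + e)) -> P c) ->
  [/\ 0 <= inf [set c | 0 <= c /\ P c], P (inf [set c | 0 <= c /\ P c]) &
      forall c, 0 <= c -> (inf [set c | 0 <= c /\ P c] <= c <-> P c)].
Proof.
move=> [c0 c00 Pc0] mono clo; set A := [set c | _].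
have hA : has_inf A by split; [exists c0|exists 0 => c []].
have lb c : A c -> inf A <= c by move=> Ac; apply: ge_inf Ac; case: hA.
have P_inf : P (inf A).
  apply: clo => e e0; have [c [_ Pc] ce] := inf_adherent e0 hA.
  exact: mono (ltW ce) Pc.
split=> // [|c c1]; first by apply: lb_le_inf => [|c []//]; exists c0.
by split=> [le|Pc]; [exact: mono le P_inf|exact: lb].
Qed.

Lemma opnormP H K (T : H -> K) : bounded_op T ->
  [/\ 0 <= opnorm T, obound T (opnorm T) &
      forall c, 0 <= c -> (opnorm T <= c <-> obound T c)].
Proof.
move=> bT; have -> : opnorm T = inf [set c | 0 <= c /\ obound T c].
  rewrite /opnorm; congr inf; apply/seteqP; split=> c [c0 Tc]; split=> // x.
    by rewrite -normr_bound.
  by rewrite normr_bound.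
apply: inf_attained => [|c d cd Tc|c Tc]; last exact: obound_eps.
  exact: bounded_ge0.
exact: obound_le Tc cd.
Qed.

Lemma norm_closedP H (A : set (H -> H)) :
  (forall T, A T -> bounded_op T) ->
  norm_closed A <-> (forall T, bounded_op T ->
    (forall e, 0 < e -> exists2 T', A T' & obound (T - T') e) -> A T).
Proof.
move=> Ab; split=> cA T bT h; apply: cA => // e e0.
  have [T' AT' TT'] := h _ (divr_gt0 e0 (ltr0n _ 2)); exists T' => //.
  have [_ _ /(_ (e / 2))[|_ le]] := opnormP (bounded_B bT (Ab _ AT')).
    by rewrite divr_ge0// ltW.
  by rewrite (le_lt_trans (le TT'))// ltr_pdivrMr// ltr_pMr// ltr1n.
have [T' AT' TT'] := h _ e0; exists T' => //.
have [_ b _] := opnormP (bounded_B bT (Ab _ AT')).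
exact: obound_le b (ltW TT').
Qed.

End OperatorNorms.

(** * Finite direct sums and operator matrices *)

(** Matrices of operators act between such sums, so that facts about single
    operators apply to them. *)
Definition dsum (R : realType) (J : finType) (K : hilbertType R) := {ffun J -> K}.

Section DirectSum.
Variables (R : realType) (J : finType) (K : hilbertType R).
Local Notation C := R[i].
Local Notation D := (dsum J K).
Implicit Types x y z : D.

HB.instance Definition _ := GRing.Lmodule.on D.

Definition dsdot x y : C := \sum_j hdot (x j) (y j).

Lemma dsdot_addl z : zmod_morphism (dsdot^~ z).
Proof.
move=> x y; rewrite /dsdot -sumrB; apply: eq_bigr => j _.
by rewrite !ffunE hdotBl.
Qed.

Lemma dsdot_addr z : zmod_morphism (dsdot z).
Proof.
move=> x y; rewrite /dsdot -sumrB; apply: eq_bigr => j _.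
by rewrite !ffunE hdotBr.
Qed.

Lemma dsdot_scalel z : GRing.scalable_for *%R (dsdot^~ z).
Proof.
move=> a x; rewrite /dsdot mulr_sumr; apply: eq_bigr => j _.
by rewrite ffunE hdotZl.
Qed.

Lemma dsdot_scaler z : GRing.scalable_for (Num.Def.conjC \; *%R) (dsdot z).
Proof.
move=> a x; rewrite /dsdot /= mulr_sumr; apply: eq_bigr => j _.
by rewrite ffunE hdotZr.
Qed.

HB.instance Definition _ := isBilinear.Build C D D C
  ( *%R ) (Num.Def.conjC \; *%R) dsdot
  dsdot_addl dsdot_addr dsdot_scalel dsdot_scaler.

Lemma dsdot_herm x y : dsdot x y = (-1) ^+ false * Num.conj (dsdot y x).
Proof.
rewrite expr0 mul1r /dsdot rmorph_sum; apply: eq_bigr => j _ /=.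
by rewrite hdotC.
Qed.

HB.instance Definition _ := isHermitianSesquilinear.Build C D false
  Num.Def.conjC dsdot dsdot_herm.

Lemma dsdot_rn x : dsdot x x = (\sum_j rn (x j) ^+ 2)%:C%C.
Proof. by rewrite rmorph_sum; apply: eq_bigr => j _; rewrite hdot_rn. Qed.

Lemma dsdot_pos x : x != 0 -> 0 < dsdot x x.
Proof.
move=> x0; rewrite dsdot_rn ltcR lt_neqAle sumr_ge0 ?andbT; last first.
  by move=> j _; exact: sqr_ge0.
rewrite eq_sym psumr_neq0; last by move=> j _; exact: sqr_ge0.
apply: contra_notT (negP x0) => /hasPn h; apply/eqP/ffunP => j.
rewrite ffunE; apply/rn_eq0/eqP; have := h j (mem_index_enum j); rewrite /= -leNgt => h'.
by rewrite -sqrf_eq0 eq_le h' sqr_ge0.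
Qed.

HB.instance Definition _ := isDotProduct.Build C D dsdot dsdot_pos.

HB.instance Definition _ := @Lmodule_isNormed.Build C D
  (dnorm dsdot) (dnorm_triangle dsdot) (dnormZ_sqrt dsdot) (@dnorm0_eq0 _ _ dsdot).

Lemma dsdot_norm x : dsdot x x = `|x| ^+ 2.
Proof. exact: esym (dnormK dsdot x). Qed.

Lemma norm_coord x j : `|x j| <= `|x|.
Proof.
have h := dsdot_norm x; rewrite dsdot_rn in h.
rewrite -(@ler_pXn2r _ 2)// ?nnegrE// -[leRHS]h rnE -rmorphXn lecR.
by rewrite (bigD1 j)//= lerDl sumr_ge0// => i _; exact: sqr_ge0.
Qed.

Lemma norm_le_sum x (e : C) : 0 <= e -> (forall j, `|x j| <= e) ->
  `|x| <= e *+ #|J|.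
Proof.
move=> e0 xe.
have E : x = \sum_j ([ffun i => if i == j then x j else 0] : D).
  apply/ffunP => i; rewrite sum_ffunE (bigD1 i)//= ffunE eqxx.
  by rewrite big1 ?addr0// => j /negPf ji; rewrite ffunE eq_sym ji.
rewrite {1}E (le_trans (ler_norm_sum _ _ _))// -sumr_const.
apply: ler_sum => j _; set y := (X in `|X|).
rewrite -(@ler_pXn2r _ 2)// ?nnegrE// -dsdot_norm dsdot_rn (bigD1 j)//=.
rewrite big1 ?addr0 => [|i /negPf ij].
  by rewrite ffunE eqxx rmorphXn /= -rnE lerXn2r ?nnegrE.
by rewrite ffunE ij rn0 expr0n.
Qed.

Lemma dsum_complete (F : set_system D) : ProperFilter F -> cauchy F -> cvg F.
Proof.
move=> FF /cauchyP Fc.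
have cv j : cvg ((fun x => x j) @ F).
  apply: cauchy_cvg; apply/cauchyP => e e0.
  have [x Fx] := Fc e e0; exists (x j).
  apply: (@filterS _ F _ (ball x e)) => // y; rewrite -!ball_normE /=.
  apply: le_lt_trans.
  by have := norm_coord (x - y) j; rewrite !ffunE.
pose l : D := [ffun j => lim ((fun x => x j) @ F)].
apply/cvg_ex; exists l; apply/cvgrPdist_lt => e e0.
pose d : C := e / #|J|.+1%:R.
have d0 : 0 < d by rewrite divr_gt0.
have : F [set x : D | forall j, `|l j - x j| <= d].
  apply: filter_forall => j; rewrite ffunE.
  have /cvgrPdist_le /(_ _ d0) := cv j; exact.
apply: filterS => x h; have := @norm_le_sum (l - x) d (ltW d0).
have h' j : `|(l - x) j| <= d by have := h j; rewrite /= !ffunE.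
move=> /(_ h') /le_lt_trans; apply.
rewrite -[ltLHS]mulr_natr /d -mulrA gtr_pMr// mulrC ltr_pdivrMr// mul1r ltr_nat.
exact: leqnn.
Qed.

HB.instance Definition _ := Uniform_isComplete.Build D dsum_complete.

HB.instance Definition _ := isHilbert.Build R D dsdot_norm.

Lemma dsum_hdot x y : hdot x y = \sum_j hdot (x j) (y j).
Proof. by []. Qed.

Lemma dsum_rn x : rn x ^+ 2 = \sum_j rn (x j) ^+ 2.
Proof. by rewrite rn_hdot (_ : hdot x x = dsdot x x)// dsdot_rn. Qed.

Lemma dsum_coord x j : rn (x j) <= rn x.
Proof. by rewrite -lecR -!rnE norm_coord. Qed.

Definition dsin (j : J) (v : K) : D := [ffun i => if i == j then v else 0].

Lemma dsum_dsin x : x = \sum_j dsin j (x j).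
Proof.
apply/ffunP => i; rewrite sum_ffunE (bigD1 i)//= ffunE eqxx.
by rewrite big1 ?addr0// => j /negPf ji; rewrite ffunE eq_sym ji.
Qed.

Lemma dsin_linear j : linear (dsin j).
Proof.
move=> a u v; apply/ffunP => i; rewrite !ffunE; case: eqP => //.
by rewrite scaler0 addr0.
Qed.

Lemma dsin_isometric j : isometric (dsin j).
Proof.
move=> v; rewrite !rnE; congr (_%:C)%C.
apply/eqP; rewrite -(@eqrXn2 _ 2)// ?rn_ge0// dsum_rn (bigD1 j)//=.
rewrite ffunE eqxx big1 ?addr0// => i /negPf ij.
by rewrite ffunE ij rn0 expr0n.
Qed.

End DirectSum.

Section OperatorMatrices.
Variable R : realType.
Local Notation C := R[i].
Implicit Types (H K L : hilbertType R) (I J : finType).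

Definition mxop I J H K (T : I -> J -> H -> K) (x : dsum J H) : dsum I K :=
  [ffun i => \sum_j T i j (x j)].

Definition mxbound I J H K (T : I -> J -> H -> K) (c : R) := obound (mxop T) c.

Definition entry I J H K (X : dsum J H -> dsum I K) i j : H -> K :=
  fun v => X (dsin j v) i.

Lemma rn_le_sq H K (x : H) (y : K) (c : R) : 0 <= c ->
  (rn x <= c * rn y) = (rn x ^+ 2 <= c ^+ 2 * rn y ^+ 2).
Proof.
by move=> c0; rewrite -exprMn ler_pXn2r// ?nnegrE ?mulr_ge0 ?rn_ge0.
Qed.

Lemma mxboundP I J H K (T : I -> J -> H -> K) c : 0 <= c ->
  mxbound T c <-> forall x : J -> H, \sum_i rn (\sum_j T i j (x j)) ^+ 2 <=
     c ^+ 2 * \sum_j rn (x j) ^+ 2.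
Proof.
move=> c0; split=> h x.
  have := h [ffun j => x j]; rewrite rn_le_sq// !dsum_rn.
  have -> : \sum_i rn (mxop T [ffun j => x j] i) ^+ 2 =
     \sum_i rn (\sum_j T i j (x j)) ^+ 2.
    by apply: eq_bigr => i _; rewrite ffunE; under eq_bigr do rewrite ffunE.
  by under [X in _ * X]eq_bigr do rewrite ffunE.
rewrite rn_le_sq// !dsum_rn; apply: le_trans (h x).
by apply: ler_sum => i _; rewrite ffunE.
Qed.

Lemma mxop_linear I J H K (T : I -> J -> H -> K) :
  (forall i j, linear (T i j)) -> linear (mxop T).
Proof.
move=> lT a x y; apply/ffunP => i; rewrite !ffunE scaler_sumr -big_split /=.
by apply: eq_bigr => j _; rewrite !ffunE lT.
Qed.

Lemma mxbound_sum I J H K (T : I -> J -> H -> K) e :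
  (forall i j, obound (T i j) e) -> mxbound T (e *+ (#|J| * #|I|)).
Proof.
move=> Te x; rewrite [mxop T x]dsum_dsin (le_trans (rn_sum _ _))//.
rewrite mulrnA mulrnAl -[leRHS]sumr_const; apply: ler_sum => i _.
rewrite (isometric_rn (@dsin_isometric _ _ _ i)) ffunE (le_trans (rn_sum _ _))//.
rewrite mulrnAl -sumr_const; apply: ler_sum => j _.
rewrite (le_trans (Te i j _))//.
have [e0|e0] := leP 0 e; first by rewrite ler_wpM2l// dsum_coord.
have := Te i j (x j) => h; have := le_trans (rn_ge0 _) h.
rewrite (nmulr_rge0 _ e0) => h2.
suff -> : rn x = 0 by rewrite mulr0 nmulr_rle0// rn_ge0.
apply/eqP; rewrite -sqrf_eq0 dsum_rn psumr_eq0; last by move=> *; exact: sqr_ge0.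
apply/allP => k _ /=; rewrite sqrf_eq0 eq_le rn_ge0 andbT.
by have := le_trans (rn_ge0 _) (Te i k (x k)); rewrite (nmulr_rge0 _ e0).
Qed.

Lemma bounded_mxop I J H K (T : I -> J -> H -> K) :
  (forall i j, bounded_op (T i j)) -> bounded_op (mxop T).
Proof.
move=> bT; have /choice[c Hc] (p : I * J) : exists c, 0 <= c /\ obound (T p.1 p.2) c.
  by have [c ? ?] := bounded_ge0 (bT p.1 p.2); exists c.
apply: (@bounded_of _ _ _ _ ((\sum_p c p) *+ (#|J| * #|I|))).
  by apply: mxop_linear => i j; exact: bounded_lin.
apply: mxbound_sum => i j; apply: obound_le (Hc (i, j)).2 _.
by rewrite (bigD1 (i, j))//= lerDl sumr_ge0// => p _; exact: (Hc p).1.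
Qed.

Lemma mxopB I J H K (S T : I -> J -> H -> K) :
  mxop (fun i j => S i j - T i j) = mxop S - mxop T.
Proof.
apply/funext => x; apply/ffunP => i; rewrite !ffunE -sumrB.
by apply: eq_bigr => j _.
Qed.

Lemma mxbound_near I J H K (S T : I -> J -> H -> K) c e :
  mxbound S c -> (forall i j, obound (T i j - S i j) e) ->
  mxbound T (c + e *+ (#|J| * #|I|)).
Proof.
move=> Sc ST; have -> : T = (fun i j => S i j + (T i j - S i j)).
  by apply/funext => i; apply/funext => j; rewrite addrC subrK.
have := mxbound_sum ST; rewrite /mxbound mxopB => h.
have -> : mxop (fun i j => S i j + (T i j - S i j)) = mxop S + (mxop T - mxop S).
  by rewrite addrC subrK; congr mxop; apply/funext => i; apply/funext => j; rewrite addrC subrK.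
exact: oboundD.
Qed.

Lemma entry_linear I J H K (X : dsum J H -> dsum I K) i j :
  linear X -> linear (entry X i j).
Proof. by move=> lX a u v; rewrite /entry dsin_linear lX !ffunE. Qed.

Lemma bounded_entry I J H K (X : dsum J H -> dsum I K) i j :
  bounded_op X -> bounded_op (entry X i j).
Proof.
move=> bX; have [c c0 Xc] := bounded_ge0 bX.
apply: (@bounded_of _ _ _ _ c); first exact/entry_linear/bounded_lin.
move=> v; rewrite (le_trans (dsum_coord _ _))// (le_trans (Xc _))//.
by rewrite (isometric_rn (@dsin_isometric _ _ _ j)).
Qed.

Lemma entryK I J H K (X : dsum J H -> dsum I K) : linear X -> mxop (entry X) = X.
Proof.
move=> lX; apply/funext => x; rewrite [in RHS](dsum_dsin x) (lin_sum lX).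
by apply/ffunP => i; rewrite ffunE sum_ffunE.
Qed.

Lemma mxopK I J H K (T : I -> J -> H -> K) :
  (forall i j, linear (T i j)) -> entry (mxop T) = T.
Proof.
move=> lT; apply/funext => i; apply/funext => j; apply/funext => v.
rewrite /entry ffunE (bigD1 j)//= ffunE eqxx big1 ?addr0// => k /negPf kj.
by rewrite ffunE kj (lin0 (lT _ _)).
Qed.

Lemma adjoint_mxop I J H K (T : I -> J -> H -> K) :
  (forall i j, bounded_op (T i j)) ->
  adjoint (mxop T) = mxop (fun j i => adjoint (T i j)).
Proof.
move=> bT; apply: adjoint_unique => x y; rewrite !dsum_hdot.
under eq_bigr do rewrite ffunE hdot_suml.
under [RHS]eq_bigr do rewrite ffunE hdot_sumr.
rewrite exchange_big; apply: eq_bigr => j _; apply: eq_bigr => i _.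
by rewrite adjointP.
Qed.

Lemma mxop_comp I J (N : finType) H1 H2 H3 (S : I -> J -> H2 -> H3) (T : J -> N -> H1 -> H2) :
  (forall i j, linear (S i j)) ->
  mxop S \o mxop T = mxop (fun i k => \sum_j (S i j \o T j k)).
Proof.
move=> lS; apply/funext => x; apply/ffunP => i; rewrite !ffunE.
under eq_bigr do rewrite ffunE (lin_sum (lS _ _)).
rewrite exchange_big; apply: eq_bigr => k _.
by rewrite sumfE.
Qed.

Lemma mx_opnormP H k (T : 'M[H -> H]_k) : (forall i j, bounded_op (T i j)) ->
  [/\ 0 <= mx_opnorm T, mxbound (fun i j => T i j) (mx_opnorm T) &
     forall c, 0 <= c -> (mx_opnorm T <= c <-> mxbound (fun i j => T i j) c)].
Proof.
move=> bT.
have -> : mx_opnorm T = inf [set c | 0 <= c /\ mxbound (fun i j => T i j) c].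
  rewrite /mx_opnorm; congr inf; apply/seteqP.
  have E c (x : 'I_k -> H) : (\sum_i `|\sum_j T i j (x j)| ^+ 2 <=
      c%:C%C ^+ 2 * \sum_j `|x j| ^+ 2) =
    (\sum_i rn (\sum_j T i j (x j)) ^+ 2 <= c ^+ 2 * \sum_j rn (x j) ^+ 2).
    rewrite -lecR rmorphM rmorphXn !rmorph_sum /=.
    have sq (y : H) : (rn y ^+ 2)%:C%C = `|y| ^+ 2 :> C by rewrite rmorphXn /= -rnE.
    by under [X in _ = (X <= _)]eq_bigr do rewrite sq;
       under [X in _ = (_ <= _ * X)]eq_bigr do rewrite sq.
  split=> c [c0 Tc]; split=> //.
    by apply/(mxboundP _ c0) => x; rewrite -E.
  by move=> x; rewrite E; move: x; exact/mxboundP.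
apply: inf_attained => [|c d cd Tc|c Tc]; last exact: obound_eps.
  exact/bounded_ge0/bounded_mxop.
exact: obound_le Tc cd.
Qed.

End OperatorMatrices.

(** * Operator algebras and *-homomorphisms *)

Section Algebras.
Variable R : realType.
Local Notation C := R[i].
Local Notation normc := ComplexField.Normc.normc.
Implicit Types (H K L : hilbertType R).

Section OperatorAlgebra.
Variables (H : hilbertType R) (A : set (H -> H)).
Hypothesis opA : operator_algebra A.

Lemma opalg_bounded T : A T -> bounded_op T.
Proof. by case: opA => h *; exact: h. Qed.

Lemma opalg_id : A idfun. Proof. by case: opA. Qed.

Lemma opalg_lin a S T : A S -> A T -> A (a *: S + T).
Proof. by case: opA => _ _ h *; exact: h. Qed.

Lemma opalg_comp S T : A S -> A T -> A (S \o T).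
Proof. by case: opA => _ _ _ h *; exact: h. Qed.

Lemma opalg_0 : A 0.
Proof. by rewrite -(addNr (idfun : H -> H)) -scaleN1r; apply: opalg_lin; exact: opalg_id. Qed.

Lemma opalg_Z a T : A T -> A (a *: T).
Proof. by move=> AT; rewrite -[_ *: _]addr0; apply: opalg_lin => //; exact: opalg_0. Qed.

Lemma opalg_D S T : A S -> A T -> A (S + T).
Proof. by move=> AS AT; rewrite -[S]scale1r; exact: opalg_lin. Qed.

Lemma opalg_B S T : A S -> A T -> A (S - T).
Proof. by move=> AS AT; rewrite addrC -scaleN1r; exact: opalg_lin. Qed.

Lemma opalg_sum I (r : seq I) (F : I -> H -> H) :
  (forall i, A (F i)) -> A (\sum_(i <- r) F i).
Proof.
move=> AF; elim: r => [|i r IH]; first by rewrite big_nil; exact: opalg_0.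
by rewrite big_cons; exact: opalg_D.
Qed.

Lemma opalg_closed T : bounded_op T ->
  (forall e, 0 < e -> exists2 T', A T' & obound (T - T') e) -> A T.
Proof.
by case: opA => _ _ _ _ c; move: T; apply/norm_closedP => // T; exact: opalg_bounded.
Qed.

End OperatorAlgebra.

Lemma adjoint_B H K (S T : H -> K) : bounded_op S -> bounded_op T ->
  adjoint (S - T) = adjoint S - adjoint T.
Proof.
move=> bS bT; rewrite addrC -scaleN1r adjoint_lincomb// rmorphN rmorph1 scaleN1r.
by rewrite addrC.
Qed.

Lemma limit_eq H K (S T : H -> K) (e : nat -> R) :
  (forall d, 0 < d -> exists N, forall p, (N <= p)%N -> e p < d) ->
  (forall p, obound (S - T) (e p)) -> S = T.
Proof.
move=> e0 ST; apply/subr0_eq/obound_zero => d d0.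
by have [N HN] := e0 _ d0; apply: obound_le (ST N) _; rewrite ltW// HN.
Qed.

Lemma small_scale (e : nat -> R) B : 0 <= B ->
  (forall d, 0 < d -> exists N, forall p, (N <= p)%N -> e p < d) ->
  (forall d, 0 < d -> exists N, forall p, (N <= p)%N -> B * e p < d).
Proof.
move=> B0 e0 d d0; have B1 : 0 < B + 1 by rewrite ltr_wpDl.
have [N HN] := e0 _ (divr_gt0 d0 B1); exists N => p /HN; rewrite ltr_pdivlMr// => h.
have [ep|ep] := leP 0 (e p); first by apply: le_lt_trans h; rewrite mulrC ler_wpM2l// lerDl.
by rewrite (le_lt_trans _ d0)// mulr_ge0_le0// ltW.
Qed.

Lemma small_geometric (r : R) : 0 <= r -> r < 1 ->
  forall d, 0 < d -> exists N, forall p, (N <= p)%N -> r ^+ p < d.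
Proof.
move=> r0 r1 d d0.
have := @cvg_expr R r; rewrite ger0_norm// => /(_ r1) /cvgrPdist_lt /(_ d d0)[N _ HN].
by exists N => p /HN; rewrite /= sub0r normrN ger0_norm// exprn_ge0.
Qed.

(** If the square root is written 1 - b, the equation becomes
    b = (T^* T + b^2) / 2. The right-hand side is a contraction of the ball of
    radius r, and its fixed point is a norm limit of elements of A. *)
Lemma cstar_sqrt H (A : set (H -> H)) T (r : R) : cstar_algebra A -> A T ->
  0 <= r -> r < 1 -> obound T r ->
  exists b, [/\ A b, adjoint b = b &
     (idfun - b) \o (idfun - b) = idfun - (adjoint T \o T)].
Proof.
move=> [opA adjA] AT r0 r1 Tr.
have bA S : A S -> bounded_op S by exact: opalg_bounded.
have lA S : A S -> linear S by move=> /bA /bounded_lin.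
pose a := adjoint T \o T.
have Aa : A a by apply: (opalg_comp opA) => //; exact: adjA.
have ba : bounded_op a by exact: bA.
have aa : adjoint a = a.
  have bT := bA _ AT; have bT' := bounded_adjoint bT.
  by rewrite adjoint_comp ?adjointK.
have ar : obound a (r * r) by apply: obound_comp => //; apply: adjoint_obound => //; exact: bA.
pose h : C := (2^-1)%:C%C.
have hc : Num.conj h = h by rewrite /h /Num.conj /= oppr0.
have nh : normc h = 2^-1 by rewrite /h normc_real ger0_norm ?invr_ge0.
pose F (b : H -> H) := h *: (a + (b \o b)).
pose b n := iter n F 0.
have FA S : A S -> A (F S).
  by move=> AS; apply/(opalg_Z opA)/(opalg_D opA) => //; exact: opalg_comp.
have Ab n : A (b n) by elim: n => [|n IH]; [exact: opalg_0|exact: FA].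
have adjb n : adjoint (b n) = b n.
  elim: n => [|n IH]; first exact: adjoint_0.
  have bb := bA _ (Ab n); have bbb := bounded_comp bb bb.
  have -> : b n.+1 = h *: (a + (b n \o b n)) by [].
  rewrite (adjoint_Z _ (bounded_D ba bbb)) hc (adjoint_D ba bbb).
  by rewrite (adjoint_comp bb bb) IH aa.
have br n : obound (b n) r.
  elim: n => [|n IH]; first exact: obound0.
  apply: (@obound_le _ _ _ _ (normc h * (r * r + r * r))).
    by apply/oboundZ/oboundD => //; exact: obound_comp.
  by rewrite nh; nra.
(* F is r-Lipschitz on the ball of radius r: S^2 - T'^2 = (S - T') S + T' (S - T') *)
have FB S T' c : 0 <= c -> A S -> A T' -> obound S r -> obound T' r -> obound (S - T') c ->
    obound (F S - F T') (r * c).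
  move=> c0 AS AT' Sr Tr' STc; have c2 : r * c = normc h * (r * c + r * c).
    by rewrite nh; lra.
  have -> : F S - F T' = h *: (((S - T') \o S) + (T' \o (S - T'))).
    rewrite /F -scalerBr; congr (_ *: _); apply/funext => x.
    by rewrite !fctE /= (linB (lA _ AT')) opprD addrACA subrr add0r addrA subrK.
  rewrite c2; apply/oboundZ/oboundD; last exact: obound_comp.
  move=> x; rewrite (le_trans (STc _))//.
  by rewrite (mulrC r) -mulrA ler_wpM2l.
have step n : obound (b n.+1 - b n) (r ^+ n).
  elim: n => [|n IH]; last by rewrite exprS; exact: (FB _ _ _ (exprn_ge0 n r0) (Ab _) (Ab _) (br _) (br _) IH).
  apply: (@obound_le _ _ _ _ (r + 0)); last by rewrite addr0 expr0 ltW.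
  by apply: oboundB; [exact: (br 1%N)|exact: obound0].
have s0 : 0 < 1 - r by rewrite subr_gt0.
have si : 0 <= (1 - r)^-1 by rewrite invr_ge0 ltW.
have tele p k : obound (b (p + k)%N - b p) ((1 - r)^-1 * (r ^+ p - r ^+ (p + k))).
  elim: k => [|k IH]; first by rewrite addn0 !subrr mulr0; exact: obound0.
  have -> : b (p + k.+1)%N - b p = (b (p + k).+1 - b (p + k)%N) + (b (p + k)%N - b p).
    by rewrite addnS addrA subrK.
  apply: obound_le (oboundD (step _) IH) _.
  rewrite addnS exprS; rewrite le_eqVlt; apply/orP; left; apply/eqP.
  by field; rewrite gt_eqF.
pose e p := (1 - r)^-1 * r ^+ p.
have e0 p : 0 <= e p by rewrite mulr_ge0// exprn_ge0.
have esmall := small_scale si (small_geometric r0 r1).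
have cauchy p q : obound (b p - b q) (e p + e q).
  wlog pq : p q / (q <= p)%N.
    by move=> w; have [/w//|/ltnW/w] := leqP q p; rewrite [X in obound _ X]addrC;
    exact: obound_distC.
  have := tele q (p - q)%N; rewrite subnKC// => h'; apply: obound_le h' _.
  by rewrite /e mulrBr; have := e0 p; have := e0 q; rewrite /e; lra.
have [B bB Be] := op_complete esmall (fun p => bA _ (Ab p)) e0 cauchy.
have AB : A B.
  apply: (opalg_closed opA) => // d d0; have [N HN] := esmall _ d0.
  exists (b N) => //; apply: obound_distC; apply: obound_le (Be N) _.
  by rewrite ltW// HN.
have Br : obound B r.
  apply: obound_eps => d d0; have [N HN] := esmall _ d0.
  have -> : B = b N - (b N - B) by rewrite subKr.
  by apply: oboundB => //; apply: obound_le (Be N) _; rewrite ltW// HN.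
have adjB : adjoint B = B.
  apply: (limit_eq (small_scale (ler0n _ 2) esmall)) => p.
  have -> : adjoint B - B = (b p - B) - adjoint (b p - B).
    rewrite adjoint_B ?adjb//; last exact: bA.
    by rewrite opprB [RHS]addrC addrA subrK.
  have bbB := bounded_B (bA _ (Ab p)) bB.
  apply: obound_le (oboundB (Be p) (adjoint_obound (e0 p) bbB (Be p))) _.
  by rewrite mulrDl mul1r.
have FBB : F B = B.
  apply: (limit_eq (small_scale (ler0n _ 2) esmall)) => p.
  have -> : F B - B = (F B - F (b p)) + (b p.+1 - B) by rewrite addrA subrK.
  apply: obound_le (oboundD (FB _ _ _ (e0 p) AB (Ab p) Br (br p) (obound_distC (Be p))) (Be p.+1)) _.
  rewrite /e exprS; have := e0 p; rewrite /e; nra.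
exists B; split=> //.
apply/funext => x; have := congr1 (fun f => f x) FBB; rewrite /F !fctE /= => E.
have {}E : a x + B (B x) = B x + B x.
  have h2 : 2%:R * h = 1 by rewrite /h -[2%:R](rmorph_nat (real_complex R)) -rmorphM divff.
  by rewrite -mulr2n -scaler_nat -[in RHS]E scalerA h2 scale1r.
have -> : adjoint T (T x) = B x + B x - B (B x) by rewrite -E addrK.
by rewrite (linB (lA _ AB)) -addrA -opprD addrA.
Qed.

Section StarHom.
Variables (K H : hilbertType R) (A : set (K -> K)) (s : (K -> K) -> (H -> H)).
Hypotheses (cA : cstar_algebra A) (homs : star_hom A s).
Let opA := cstar_operator_algebra cA.
Let uh := star_hom_unital homs.

Lemma hom0 : s 0 = 0.
Proof.
rewrite -(addNr (idfun : K -> K)) -scaleN1r (hom_linear uh); try exact: opalg_id.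
by rewrite scaleN1r addNr.
Qed.

Lemma homZ a T : A T -> s (a *: T) = a *: s T.
Proof.
move=> AT; rewrite -[a *: T]addr0 (hom_linear uh) ?hom0 ?addr0//.
exact: opalg_0.
Qed.

Lemma homD S T : A S -> A T -> s (S + T) = s S + s T.
Proof. by move=> AS AT; rewrite -[S]scale1r (hom_linear uh)// !scale1r. Qed.

Lemma homB S T : A S -> A T -> s (S - T) = s S - s T.
Proof.
by move=> AS AT; rewrite addrC -scaleN1r (hom_linear uh)// scaleN1r addrC.
Qed.

Lemma hom_sum I (r : seq I) (F : I -> K -> K) :
  (forall i, A (F i)) -> s (\sum_(i <- r) F i) = \sum_(i <- r) s (F i).
Proof.
move=> AF; elim: r => [|i r IH]; first by rewrite !big_nil hom0.
rewrite !big_cons homD ?IH//; exact: opalg_sum.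
Qed.

(** If T is a strict contraction then 1 - T^* T is the square of a selfadjoint
    element, hence so is its image, which is therefore positive. *)
Lemma star_hom_contr T c : 0 <= c -> A T -> obound T c -> obound (s T) c.
Proof.
have small S r : 0 <= r -> r < 1 -> A S -> obound S r -> obound (s S) 1.
  move=> r0 r1 AS Sr; have [b [Ab bb E]] := cstar_sqrt cA AS r0 r1 Sr.
  have Ai := opalg_id opA; have A1b := opalg_B opA Ai Ab.
  have AaS := cstar_adjoint cA AS.
  have AaSS := opalg_comp opA AaS AS.
  have := congr1 s E; rewrite (hom_comp uh)// (homB Ai AaSS).
  rewrite (hom_comp uh)// (star_hom_adjoint homs)// (hom_id uh) => {}E x.
  have bS := hom_bounded uh AS; have b1b := hom_bounded uh A1b.
  have sa : adjoint (s (idfun - b)) = s (idfun - b).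
    rewrite -(star_hom_adjoint homs)// adjoint_B ?bb ?adjoint_id//.
      exact: bounded_id.
    exact: (opalg_bounded opA).
  have := congr1 (fun f => hdot (f x) x) E; rewrite /= !fctE /= hdotBl adjointPr//.
  rewrite -{1}sa adjointPr// !hdot_rn => /(congr1 (@complex.Re _)); rewrite Re_sub /=.
  move=> E2; rewrite mul1r -(@ler_pXn2r _ 2)// ?nnegrE ?rn_ge0//.
  by rewrite -subr_ge0 -E2 sqr_ge0.
move=> c0 AT Tc; apply: obound_eps => e e0.
have ce : 0 < c + e by rewrite ltr_wpDl.
have ce2 : 0 < c + e / 2 by rewrite ltr_wpDl// divr_gt0.
(* T is rescaled to a strict contraction *)
pose t : C := ((c + e)^-1)%:C%C.
have nt : normc t = (c + e)^-1 by rewrite normc_real ger0_norm// invr_ge0 ltW.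
have tT := oboundZ t Tc.
have r1 : normc t * c < 1 by rewrite nt mulrC ltr_pdivrMr// mul1r ltrDl.
have r0 : 0 <= normc t * c by rewrite mulr_ge0 ?normc_ge0.
have := small _ _ r0 r1 (opalg_Z opA t AT) tT; rewrite homZ// => h x.
have := h x; rewrite mul1r rnZ nt mulrC ler_pdivrMr//.
by rewrite mulrC.
Qed.

End StarHom.

(** The algebra of matrices over A. *)
Definition amplify (I : finType) K (A : set (K -> K)) : set (dsum I K -> dsum I K) :=
  [set X | bounded_op X /\ forall i j, A (entry X i j)].

Lemma entry_id (I : finType) K (i j : I) :
  entry (idfun : dsum I K -> dsum I K) i j = if i == j then idfun else 0.
Proof. by apply/funext => v; rewrite /entry ffunE; case: eqP. Qed.

Lemma amplify_cstar (I : finType) K (A : set (K -> K)) :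
  cstar_algebra A -> cstar_algebra (amplify (I := I) A).
Proof.
move=> [opA adjA].
have bA T : A T -> bounded_op T by exact: opalg_bounded.
have lX X : amplify (I := I) A X -> linear X by case=> /bounded_lin.
split; last first.
  move=> X [bX AX]; split=> [|i j]; first exact: bounded_adjoint.
  rewrite -[X]entryK; last exact: bounded_lin.
  rewrite adjoint_mxop; last by move=> *; exact: bA.
  by rewrite mxopK => [|i' j']; [exact: adjA|exact/bounded_lin/bounded_adjoint/bA].
split.
- by move=> T [].
- split=> [|i j]; first exact: bounded_id.
  by rewrite entry_id; case: eqP => _; [exact: opalg_id|exact: opalg_0].
- move=> a X Y [bX AX] [bY AY]; split=> [|i j]; first exact: bounded_lincomb.
  have -> : entry (a *: X + Y) i j = a *: entry X i j + entry Y i j.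
    by apply/funext => v; rewrite /entry !fctE !ffunE.
  exact: opalg_lin.
- move=> X Y [bX AX] [bY AY]; split=> [|i j]; first exact: bounded_comp.
  rewrite -[X]entryK -1?[Y]entryK; try exact: bounded_lin.
  rewrite mxop_comp; last by move=> *; exact/bounded_lin/bA.
  rewrite mxopK => [|i' j'].
    by apply: opalg_sum => // k; exact: opalg_comp.
  apply: bounded_lin; apply: bounded_sum => k; apply: bounded_comp; exact: bA.
apply/norm_closedP => [T []//|X bX h]; split=> // i j.
apply: (opalg_closed opA) => [|e e0]; first exact: bounded_entry.
have [Y [bY AY] XY] := h e e0; exists (entry Y i j) => // v.
have := XY (dsin j v); rewrite (isometric_rn (@dsin_isometric _ _ _ j)).
by apply: le_trans; have := dsum_coord ((X - Y) (dsin j v)) i; rewrite !fctE !ffunE.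
Qed.

(** The amplification of a *-homomorphism to matrices is a *-homomorphism, hence
    contractive. *)
Lemma star_hom_mxcontr K H (A : set (K -> K)) (s : (K -> K) -> (H -> H))
    (I : finType) (T : I -> I -> K -> K) c :
  cstar_algebra A -> star_hom A s -> 0 <= c ->
  (forall i j, A (T i j)) -> mxbound T c -> mxbound (fun i j => s (T i j)) c.
Proof.
move=> cA homs c0 AT Tc; have [opA adjA] := cA; have uh := star_hom_unital homs.
have bA S : A S -> bounded_op S by exact: opalg_bounded.
have bs S (AS : A S) : bounded_op (s S) := hom_bounded uh AS.
pose sI (X : dsum I K -> dsum I K) : dsum I H -> dsum I H :=
  mxop (fun i j => s (entry X i j)).
have homsI : star_hom (amplify A) sI.
  split; last first.
    move=> X [bX AX]; rewrite /sI adjoint_mxop; last by move=> *; exact: bs.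
    congr mxop; apply/funext => i; apply/funext => j.
    rewrite -(star_hom_adjoint homs)//; congr s.
    rewrite -[X in adjoint X](entryK (bounded_lin bX)) adjoint_mxop; last by move=> *; exact: bA.
    by rewrite mxopK// => *; exact/bounded_lin/bounded_adjoint/bA.
  split.
  - by move=> X [bX AX]; apply: bounded_mxop => i j; exact: bs.
  - rewrite /sI; have -> : (fun i j => s (entry (idfun : dsum I K -> dsum I K) i j)) =
       (fun i j => if i == j then idfun else 0).
      apply/funext => i; apply/funext => j; rewrite entry_id.
      by case: eqP => _; [exact: (hom_id uh)|exact: (hom0 cA homs)].
    apply/funext => x; apply/ffunP => i; rewrite ffunE (bigD1 i)//= eqxx.
    by rewrite big1 ?addr0// => j /negPf ji; rewrite eq_sym ji.
  - move=> a X Y [bX AX] [bY AY]; rewrite /sI.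
    have -> : (fun i j => s (entry (a *: X + Y) i j)) =
        (fun i j => a *: s (entry X i j) + s (entry Y i j)).
      apply/funext => i; apply/funext => j; rewrite -(hom_linear uh)//; congr s.
      by apply/funext => v; rewrite /entry !fctE !ffunE.
    apply/funext => x; apply/ffunP => i.
    by rewrite !fctE !ffunE scaler_sumr -big_split.
  - move=> X Y [bX AX] [bY AY]; rewrite /sI mxop_comp; last by move=> *; exact/bounded_lin/bs.
    congr mxop; apply/funext => i; apply/funext => j.
    rewrite -[X in entry (X \o _)](entryK (bounded_lin bX)).
    rewrite -[X in entry (_ \o X)](entryK (bounded_lin bY)).
    rewrite mxop_comp; last by move=> *; exact/bounded_lin/bA.
    rewrite mxopK => [|i' j']; last first.
      by apply: bounded_lin; apply: bounded_sum => k; apply: bounded_comp; exact: bA.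
    rewrite (hom_sum cA homs) => [|k]; last exact: opalg_comp.
    by apply: eq_bigr => k _; rewrite (hom_comp uh).
have eT : entry (mxop T) = T by apply: mxopK => *; exact/bounded_lin/bA.
have AT' : amplify A (mxop T).
  by split=> [|i j]; [apply: bounded_mxop => *; exact: bA|rewrite eT].
by have := star_hom_contr (amplify_cstar I cA) homsI c0 AT' Tc; rewrite /sI eT.
Qed.

End Algebras.

(** * Homomorphisms as closed graphs *)

Section ContractiveGraphs.
Variable R : realType.
Local Notation normc := ComplexField.Normc.normc.
Implicit Types (H K L : hilbertType R).

(** Graphs of completely contractive unital homomorphisms. Unlike maps, they are
    immediate to define on the polynomials in given generators, where they need
    not be known in advance to be single-valued, and they can be closed in norm. *)
Record contr_graph H K (G : (H -> H) -> (K -> K) -> Prop) : Prop := {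
  graph_bddl : forall T S, G T S -> bounded_op T;
  graph_bddr : forall T S, G T S -> bounded_op S;
  graph_id : G idfun idfun;
  graph_lin : forall a T S T' S', G T S -> G T' S' -> G (a *: T + T') (a *: S + S');
  graph_comp : forall T S T' S', G T S -> G T' S' -> G (T \o T') (S \o S');
  graph_contr : forall (I : finType) (T : I -> I -> H -> H) (S : I -> I -> K -> K) c,
    0 <= c -> (forall i j, G (T i j) (S i j)) -> mxbound T c -> mxbound S c }.

Definition graph_closure H K (G : (H -> H) -> (K -> K) -> Prop) T S :=
  [/\ bounded_op T, bounded_op S & forall e, 0 < e ->
     exists T' S', [/\ G T' S', obound (T - T') e & obound (S - S') e]].

Lemma obound_split H K (T T' : H -> K) c e :
  obound T' c -> obound (T - T') e -> obound T (c + e).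
Proof. by move=> h h'; rewrite -[T](subrK T') addrC; exact: oboundD. Qed.

Lemma mxbound_eps (I J : finType) H K (T : I -> J -> H -> K) c :
  (forall e, 0 < e -> mxbound T (c + e)) -> mxbound T c.
Proof. exact: obound_eps. Qed.

Lemma sub_graph_closure H K (G : (H -> H) -> (K -> K) -> Prop) T S :
  contr_graph G -> G T S -> graph_closure G T S.
Proof.
move=> cG g; split=> [||e e0]; [exact: graph_bddl g|exact: graph_bddr g|].
by exists T, S; split; rewrite // subrr; apply: obound0; exact: ltW.
Qed.

Lemma graph_closure_contr H K (G : (H -> H) -> (K -> K) -> Prop) :
  contr_graph G -> contr_graph (graph_closure G).
Proof.
move=> cG; split.
- by move=> T S [].
- by move=> T S [].
- by apply: sub_graph_closure => //; exact: graph_id.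
- move=> a T S T' S' [bT bS h] [bT' bS' h'].
  split=> [||e e0]; [exact: bounded_lincomb|exact: bounded_lincomb|].
  have a1 : 0 < normc a + 1 by rewrite ltr_wpDl ?normc_ge0.
  have [T1 [S1 [g TT1 SS1]]] := h _ (divr_gt0 e0 a1).
  have e2 : 0 < e / (normc a + 1) by rewrite divr_gt0.
  have [T2 [S2 [g' TT2 SS2]]] := h' _ e2.
  exists (a *: T1 + T2), (a *: S1 + S2); split; first exact: graph_lin.
  + rewrite lincombB; apply: obound_le (oboundD (oboundZ a TT1) TT2) _.
    by rewrite -[X in _ + X]mul1r -mulrDl mulrC divfK// gt_eqF.
  + rewrite lincombB; apply: obound_le (oboundD (oboundZ a SS1) SS2) _.
    by rewrite -[X in _ + X]mul1r -mulrDl mulrC divfK// gt_eqF.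
- move=> T S T' S' [bT bS h] [bT' bS' h'].
  split=> [||e e0]; [exact: bounded_comp|exact: bounded_comp|].
  have [c1 c10 Tc1] := bounded_ge0 bT; have [c2 c20 Sc2] := bounded_ge0 bS.
  have [c3 c30 Tc3] := bounded_ge0 bT'; have [c4 c40 Sc4] := bounded_ge0 bS'.
  (* errors get multiplied by the norms of the factors and of their approximants *)
  pose B := c1 + c2 + c3 + c4 + 2.
  have B0 : 0 < B by rewrite /B; lra.
  pose d := Num.min (e / B) 1.
  have d0 : 0 < d by rewrite lt_min ltr01 andbT divr_gt0.
  have d1 : d <= 1 by rewrite ge_min lexx orbT.
  have dB : d * B <= e by rewrite -ler_pdivlMr// ge_min lexx.
  have [T1 [S1 [g TT1 SS1]]] := h _ d0; have [T2 [S2 [g' TT2 SS2]]] := h' _ d0.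
  have comp_near (X : hilbertType R) (P Q P1 Q1 : X -> X) p q : bounded_op P ->
      0 <= p -> 0 <= q -> p + q + 2 <= B ->
      obound P p -> obound Q q -> obound (P - P1) d -> obound (Q - Q1) d ->
      obound ((P \o Q) - (P1 \o Q1)) e.
    move=> bP p0 q0 pq Pp Qq PP1 QQ1.
    have -> : (P \o Q) - (P1 \o Q1) = (P \o (Q - Q1)) + ((P - P1) \o Q1).
      apply/funext => x; rewrite !fctE /= (linB (bounded_lin bP)).
      by rewrite addrA subrK.
    have Q1q := obound_split Qq (obound_distC QQ1).
    apply: obound_le (oboundD (obound_comp p0 Pp QQ1) (obound_comp (ltW d0) PP1 Q1q)) _.
    by nra.
  exists (T1 \o T2), (S1 \o S2); split; first exact: graph_comp.
  + by apply: (comp_near _ _ _ _ _ c1 c3) => //; rewrite /B; lra.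
  + by apply: (comp_near _ _ _ _ _ c2 c4) => //; rewrite /B; lra.
- move=> I T S c c0 GTS Tc; apply: mxbound_eps => e e0.
  pose N := (#|I| * #|I|)%N.
  have N0 : 0 < 2 * N%:R + 1 :> R by rewrite ltr_wpDl// mulr_ge0.
  pose d := e / (2 * N%:R + 1); have d0 : 0 < d by rewrite divr_gt0.
  have /choice[T1 HT1] (ij : I * I) : exists TS : (H -> H) * (K -> K),
      [/\ G TS.1 TS.2, obound (T ij.1 ij.2 - TS.1) d & obound (S ij.1 ij.2 - TS.2) d].
    have [_ _ /(_ d d0)[T1 [S1 h]]] := GTS ij.1 ij.2; by exists (T1, S1).
  have G1 i j : G (T1 (i, j)).1 (T1 (i, j)).2 by have [] := HT1 (i, j).
  have T1c : mxbound (fun i j => (T1 (i, j)).1) (c + d *+ N).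
    apply: mxbound_near Tc _ => i j; apply: obound_distC.
    by have [] := HT1 (i, j).
  have cd0 : 0 <= c + d *+ N by rewrite addr_ge0// mulrn_wge0// ltW.
  have := graph_contr cG cd0 G1 T1c => S1c.
  apply: obound_le (mxbound_near S1c (e := d) _) _.
    by move=> i j; have [] := HT1 (i, j).
  rewrite -/N -addrA lerD2l -mulr2n -mulrnA -mulr_natr /d mulrAC ler_pdivrMr//.
  by rewrite ler_wpM2l ?(ltW e0)// natrM mulrC lerDl.
Qed.

Section Closed.
Variables (H K : hilbertType R) (G : (H -> H) -> (K -> K) -> Prop).
Hypothesis cG : contr_graph G.
Let cGc := graph_closure_contr cG.
Let Gc := graph_closure G.

Lemma graph_contr1 T S c : 0 <= c -> Gc T S -> obound T c -> obound S c.
Proof.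
move=> c0 g Tc.
have h : mxbound (fun _ _ : 'I_1 => T) c.
  by apply/mxboundP => // x; rewrite !big_ord1 -rn_le_sq.
have /mxboundP := graph_contr cGc (S := fun _ _ : 'I_1 => S) c0 (fun _ _ => g) h.
by move=> /(_ c0) h' x; have := h' (fun=> x); rewrite !big_ord1 -rn_le_sq.
Qed.

(** A contraction maps 0 to 0 only, so the closure is single-valued. *)
Lemma graph_fun T S S' : Gc T S -> Gc T S' -> S = S'.
Proof.
move=> g g'; have := graph_lin cGc (-1) g' g.
rewrite scaleN1r addNr scaleN1r addrC => g0.
apply/subr0_eq/obound_zero => e e0; apply: obound_le (ltW e0).
by apply: (@graph_contr1 0 (S - S') 0) => //; exact: obound0.
Qed.

Definition graph_dom : set (H -> H) := [set T | exists S, Gc T S].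

(** The domain is norm closed because, by contractivity, the images of a
    convergent sequence form a Cauchy sequence. *)
Lemma graph_dom_opalg : operator_algebra graph_dom.
Proof.
split.
- by move=> T [S /(graph_bddl cGc)].
- by exists idfun; exact: graph_id cGc.
- by move=> a T T' [S g] [S' g']; exists (a *: S + S'); exact: graph_lin.
- by move=> T T' [S g] [S' g']; exists (S \o S'); exact: graph_comp.
apply/norm_closedP => [T [S /(graph_bddl cGc)]//|T bT h].
have /choice[TS HTS] p : exists TS : (H -> H) * (K -> K),
    Gc TS.1 TS.2 /\ obound (T - TS.1) p.+1%:R^-1.
  have [|T' [S' g] TT'] := h p.+1%:R^-1; first by rewrite invr_gt0.
  by exists (T', S').
pose e p : R := p.+1%:R^-1.
have e0 p : 0 <= e p by rewrite invr_ge0.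
have [p|p q|S bS TSS] := op_complete (T := fun p => (TS p).2) (@invn_small R) _ e0.
- by apply: (graph_bddr cGc); exact: (HTS p).1.
- have g : Gc (-1 *: (TS q).1 + (TS p).1) (-1 *: (TS q).2 + (TS p).2).
    by apply: (graph_lin cGc); exact: (HTS _).1.
  rewrite !scaleN1r [- (TS q).1 + _]addrC [- (TS q).2 + _]addrC in g.
  apply: graph_contr1 g _; first by rewrite addr_ge0.
  have -> : (TS p).1 - (TS q).1 = (T - (TS q).1) - (T - (TS p).1).
    by rewrite opprB [RHS]addrC addrA subrK.
  rewrite [X in obound _ X]addrC.
  by apply: oboundB; exact: (HTS _).2.
exists S; split=> // d d0; have [N HN] := invn_small (divr_gt0 d0 (ltr0n _ 2)).
have d2 : 0 < d / 2 by rewrite divr_gt0.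
have eN := ltW (HN N (leqnn _)).
have [[_ _ /(_ _ d2)[T1 [S1 [g h1 h2]]]] TN] := HTS N.
exists T1, S1; split=> //.
  have -> : T - T1 = (T - (TS N).1) + ((TS N).1 - T1) by rewrite addrA subrK.
  by rewrite [d]splitr; apply: oboundD => //; exact: obound_le TN eN.
have -> : S - S1 = (S - (TS N).2) + ((TS N).2 - S1) by rewrite addrA subrK.
rewrite [d]splitr; apply: oboundD => //; apply: obound_distC.
exact: obound_le (TSS N) eN.
Qed.

Hypothesis G_adjoint : forall T S, G T S -> G (adjoint T) (adjoint S).

Lemma graph_closure_adjoint T S : Gc T S -> Gc (adjoint T) (adjoint S).
Proof.
move=> [bT bS h]; split=> [||e e0]; try exact: bounded_adjoint.
have [T' [S' [g TT' SS']]] := h e e0; exists (adjoint T'), (adjoint S').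
have near (X : hilbertType R) (P P' : X -> X) : bounded_op P -> bounded_op P' ->
    obound (P - P') e -> obound (adjoint P - adjoint P') e.
  move=> bP bP' PP'; rewrite -adjoint_B//.
  by apply: adjoint_obound => //; [exact: ltW|exact: bounded_B].
split; [exact: G_adjoint|apply: near => //|apply: near => //].
  exact: (graph_bddl cG g).
exact: (graph_bddr cG g).
Qed.

Lemma graph_dom_cstar : cstar_algebra graph_dom.
Proof.
split; first exact: graph_dom_opalg.
by move=> T [S g]; exists (adjoint S); exact: graph_closure_adjoint.
Qed.

End Closed.

Definition graph_ext H K (G : (H -> H) -> (K -> K) -> Prop) (T : H -> H) : K -> K :=
  xget 0 [set S | graph_closure G T S].

Lemma graph_extP H K (G : (H -> H) -> (K -> K) -> Prop) T :
  graph_dom G T -> graph_closure G T (graph_ext G T).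
Proof. by move=> [S g]; rewrite /graph_ext; case: xgetP => [S' _ //|/(_ S)]. Qed.

Lemma graph_extE H K (G : (H -> H) -> (K -> K) -> Prop) T S : contr_graph G ->
  graph_closure G T S -> graph_ext G T = S.
Proof.
by move=> cG g; apply: (graph_fun cG (T := T)) => //; apply: graph_extP; exists S.
Qed.

Lemma graph_ext_hom H K (G : (H -> H) -> (K -> K) -> Prop) (A : set (H -> H)) :
  contr_graph G -> A `<=` graph_dom G -> unital_hom A (graph_ext G).
Proof.
move=> cG AG; have cGc := graph_closure_contr cG.
split.
- by move=> T /AG/graph_extP/(graph_bddr cGc).
- by apply: (graph_extE cG); exact: graph_id.
- by move=> a T T' /AG/graph_extP g /AG/graph_extP g'; apply: (graph_extE cG); exact: graph_lin.
- by move=> T T' /AG/graph_extP g /AG/graph_extP g'; apply: (graph_extE cG); exact: graph_comp.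
Qed.

Lemma graph_ext_star H K (G : (H -> H) -> (K -> K) -> Prop) (A : set (H -> H)) :
  contr_graph G -> (forall T S, G T S -> G (adjoint T) (adjoint S)) ->
  A `<=` graph_dom G -> star_hom A (graph_ext G).
Proof.
move=> cG Gadj AG; split; first exact: graph_ext_hom.
by move=> T /AG/graph_extP g; apply: (graph_extE cG); exact: graph_closure_adjoint.
Qed.

End ContractiveGraphs.

(** * Noncommutative polynomials and generated algebras *)

Section Polynomials.
Variable R : realType.
Local Notation C := R[i].
Implicit Types (H K L : hilbertType R) (X : Type).

(** Noncommutative polynomials are lists of monomials, so that the same formal
    polynomial can be evaluated in different representations. *)
Definition ncpoly X := seq (C * seq X).

Definition wev X H (f : X -> H -> H) (z : seq X) : H -> H :=
  foldr (fun x T => f x \o T) idfun z.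

Definition pev X H (f : X -> H -> H) (p : ncpoly X) : H -> H :=
  \sum_(t <- p) t.1 *: wev f t.2.

Definition pscale X (a : C) (p : ncpoly X) : ncpoly X :=
  [seq (a * t.1, t.2) | t <- p].

Definition pmul X (p q : ncpoly X) : ncpoly X :=
  [seq (t.1 * s.1, t.2 ++ s.2) | t <- p, s <- q].

(** In the starred alphabet (true, x) stands for the adjoint of x. *)
Definition srep X H (f : X -> H -> H) (x : bool * X) : H -> H :=
  if x.1 then adjoint (f x.2) else f x.2.

Definition padj X (p : ncpoly (bool * X)) : ncpoly (bool * X) :=
  [seq (Num.conj t.1, rev [seq (~~ x.1, x.2) | x <- t.2]) | t <- p].

Section Evaluation.
Variables (X : Type) (H : hilbertType R) (f : X -> H -> H).
Hypothesis bf : forall x, bounded_op (f x).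
Implicit Types (p q : ncpoly X) (z : seq X).

Lemma wev_cat z1 z2 : wev f (z1 ++ z2) = wev f z1 \o wev f z2.
Proof. by elim: z1 => //= x z1 ->. Qed.

Lemma wev_bounded z : bounded_op (wev f z).
Proof. by elim: z => [|x z IH]; [exact: bounded_id|exact: bounded_comp]. Qed.

Lemma pev_bounded p : bounded_op (pev f p).
Proof. by apply: bounded_sum => t; exact/bounded_Z/wev_bounded. Qed.

Lemma pev_cat p q : pev f (p ++ q) = pev f p + pev f q.
Proof. exact: big_cat. Qed.

Lemma pev_scale a p : pev f (pscale a p) = a *: pev f p.
Proof.
by rewrite /pev big_map scaler_sumr; apply: eq_bigr => t _; rewrite scalerA.
Qed.

Lemma pev_mul p q : pev f (pmul p q) = pev f p \o pev f q.
Proof.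
rewrite /pev big_allpairs_dep comp_suml; apply: eq_bigr => t _.
rewrite comp_Zl comp_sumr; last exact/bounded_lin/wev_bounded.
rewrite scaler_sumr; apply: eq_bigr => s _.
by rewrite wev_cat comp_Zr ?scalerA//; exact/bounded_lin/wev_bounded.
Qed.

Lemma pev_word z : pev f [:: (1, z)] = wev f z.
Proof. by rewrite /pev big_seq1 scale1r. Qed.

Lemma opalg_wev (A : set (H -> H)) z :
  operator_algebra A -> (forall x, A (f x)) -> A (wev f z).
Proof.
move=> opA Af; elim: z => [|x z IH]; first exact: opalg_id.
exact: opalg_comp.
Qed.

Lemma opalg_pev (A : set (H -> H)) p :
  operator_algebra A -> (forall x, A (f x)) -> A (pev f p).
Proof.
by move=> opA Af; apply: opalg_sum => // t; apply: opalg_Z => //; exact: opalg_wev.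
Qed.

End Evaluation.

Section StarEvaluation.
Variables (X : Type) (H : hilbertType R) (f : X -> H -> H).
Hypothesis bf : forall x, bounded_op (f x).

Lemma srep_bounded x : bounded_op (srep f x).
Proof. by case: x => -[] x; [exact: bounded_adjoint|exact: bf]. Qed.

Lemma pev_adj p : pev (srep f) (padj p) = adjoint (pev (srep f) p).
Proof.
rewrite /pev big_map adjoint_sum; last by move=> t; exact/bounded_Z/wev_bounded/srep_bounded.
apply: eq_bigr => t _; rewrite adjoint_Z; last exact/wev_bounded/srep_bounded.
congr (_ *: _); elim: t.2 => [|x z IH] /=; first by rewrite adjoint_id.
rewrite adjoint_comp; [|exact: srep_bounded|exact/wev_bounded/srep_bounded].
rewrite -IH rev_cons -cats1 wev_cat; congr (_ \o _).
case: x => -[] x //=; rewrite /srep /=.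
by rewrite adjointK.
Qed.

End StarEvaluation.

Definition poly_graph X H K (f : X -> H -> H) (g : X -> K -> K) T S :=
  exists p : ncpoly X, T = pev f p /\ S = pev g p.

Section PolyGraph.
Variables (X : Type) (H K : hilbertType R) (f : X -> H -> H) (g : X -> K -> K).
Hypotheses (bf : forall x, bounded_op (f x)) (bg : forall x, bounded_op (g x)).
Hypothesis fg : forall (I : finType) (p : I -> I -> ncpoly X) c, 0 <= c ->
  mxbound (fun i j => pev f (p i j)) c -> mxbound (fun i j => pev g (p i j)) c.

Lemma poly_graph_contr : contr_graph (poly_graph f g).
Proof.
split.
- by move=> T S [p [-> _]]; exact: pev_bounded.
- by move=> T S [p [_ ->]]; exact: pev_bounded.
- by exists [:: (1, [::])]; rewrite !pev_word.
- move=> a T S T' S' [p [-> ->]] [q [-> ->]]; exists (pscale a p ++ q).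
  by rewrite !pev_cat !pev_scale.
- move=> T S T' S' [p [-> ->]] [q [-> ->]]; exists (pmul p q).
  by rewrite !pev_mul.
- move=> I T S c c0 h.
  have /choice[p Hp] (ij : I * I) : exists p : ncpoly X,
    T ij.1 ij.2 = pev f p /\ S ij.1 ij.2 = pev g p by exact: h.
  have -> : T = fun i j => pev f (p (i, j)).
    by apply/funext => i; apply/funext => j; have [] := Hp (i, j).
  have -> : S = fun i j => pev g (p (i, j)).
    by apply/funext => i; apply/funext => j; have [] := Hp (i, j).
  exact: (@fg I (fun i j => p (i, j)) c c0).
Qed.

Lemma poly_graph_pev p : graph_closure (poly_graph f g) (pev f p) (pev g p).
Proof. by apply: sub_graph_closure; [exact: poly_graph_contr|exists p]. Qed.

Lemma poly_graph_gen x : graph_closure (poly_graph f g) (f x) (g x).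
Proof. by have := poly_graph_pev [:: (1, [:: x])]; rewrite !pev_word. Qed.

(** The domain of the extension is an operator algebra that contains the generators. *)
Lemma opalg_gen_dom : opalg_gen (range f) `<=` graph_dom (poly_graph f g).
Proof.
apply: smallest_sub => [|_ [x _ <-]]; first exact/graph_dom_opalg/poly_graph_contr.
by exists (g x); exact: poly_graph_gen.
Qed.

End PolyGraph.

Lemma poly_graph_adjoint X H K (f : X -> H -> H) (g : X -> K -> K) :
  (forall x, bounded_op (f x)) -> (forall x, bounded_op (g x)) ->
  forall T S, poly_graph (srep f) (srep g) T S ->
    poly_graph (srep f) (srep g) (adjoint T) (adjoint S).
Proof.
by move=> bf bg T S [p [-> ->]]; exists (padj p); rewrite !pev_adj.
Qed.

Lemma cstar_gen_dom X H K (f : X -> H -> H) (g : X -> K -> K) :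
  (forall x, bounded_op (f x)) -> (forall x, bounded_op (g x)) ->
  contr_graph (poly_graph (srep f) (srep g)) ->
  cstar_gen (range f) `<=` graph_dom (poly_graph (srep f) (srep g)).
Proof.
move=> bf bg cG; apply: smallest_sub => [|_ [x _ <-]].
  by apply: graph_dom_cstar => //; exact: poly_graph_adjoint.
exists (g x); apply: sub_graph_closure => //.
by exists [:: (1, [:: (false, x)])]; rewrite !pev_word.
Qed.

Lemma bounded_opalg H : operator_algebra [set T : H -> H | bounded_op T].
Proof.
split=> //; first exact: bounded_id.
  by move=> *; exact: bounded_lincomb.
by move=> *; exact: bounded_comp.
Qed.

Lemma opalg_gen_opalg H (G : set (H -> H)) : (forall T, G T -> bounded_op T) ->
  operator_algebra (opalg_gen G).
Proof.
move=> Gb; have allb := bounded_opalg H.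
have sub A : operator_algebra A -> G `<=` A -> opalg_gen G `<=` A.
  by move=> ? ?; exact: smallest_sub.
have Gall : G `<=` [set T : H -> H | bounded_op T] by [].
split.
- exact: sub allb Gall.
- by move=> A [opA _]; exact: opalg_id.
- by move=> a T T' GT GT' A [opA GA]; apply: opalg_lin => //; [exact: GT|exact: GT'].
- by move=> T T' GT GT' A [opA GA]; apply: opalg_comp => //; [exact: GT|exact: GT'].
apply/norm_closedP => [T|T bT h A [opA GA]]; first exact: sub allb Gall T.
apply: (opalg_closed opA) => // e e0; have [T' GT' TT'] := h e e0.
by exists T' => //; exact: GT'.
Qed.

Lemma cstar_gen_cstar H (G : set (H -> H)) : (forall T, G T -> bounded_op T) ->
  cstar_algebra (cstar_gen G).
Proof.
move=> Gb; have allb := bounded_opalg H.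
have allc : cstar_algebra [set T : H -> H | bounded_op T].
  by split=> // T; exact: bounded_adjoint.
have Gall : G `<=` [set T : H -> H | bounded_op T] by [].
have bT T : cstar_gen G T -> bounded_op T by exact: smallest_sub allc Gall T.
split; last by move=> T GT A [cA GA]; apply: cstar_adjoint => //; exact: GT.
split=> //.
- by move=> A [[opA _] _]; exact: opalg_id.
- by move=> a T T' GT GT' A cA; have [[opA _] _] := cA; apply: opalg_lin => //; [exact: GT|exact: GT'].
- by move=> T T' GT GT' A cA; have [[opA _] _] := cA; apply: opalg_comp => //; [exact: GT|exact: GT'].
apply/norm_closedP => // T bT' h A cA; have [[opA _] _] := cA.
apply: (opalg_closed opA) => // e e0; have [T' GT' TT'] := h e e0.
by exists T' => //; exact: GT'.
Qed.

Lemma gen_opalg H (G : set (H -> H)) : G `<=` opalg_gen G.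
Proof. by move=> T GT A [_]; exact. Qed.

Lemma gen_cstar H (G : set (H -> H)) : G `<=` cstar_gen G.
Proof. by move=> T GT A [_]; exact. Qed.

Lemma star_hom_wev X K H (f : X -> K -> K) (g : X -> H -> H) s z :
  (forall x, bounded_op (f x)) -> star_hom (cstar_gen (range f)) s ->
  (forall x, s (f x) = g x) -> s (wev f z) = wev g z.
Proof.
move=> bf hs sfg; have uh := star_hom_unital hs.
have cO : cstar_algebra (cstar_gen (range f)).
  by apply: cstar_gen_cstar => _ [x _ <-]; exact: bf.
have Of x : cstar_gen (range f) (f x) by apply: gen_cstar; exists x.
elim: z => [|x z IH]; first exact: (hom_id uh).
rewrite /= (hom_comp uh)// ?IH ?sfg//.
exact: (opalg_wev z (cstar_operator_algebra cO) Of).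
Qed.

Lemma opalg_gen_eq H (G G' : set (H -> H)) :
  (forall T, G T -> bounded_op T) -> (forall T, G' T -> bounded_op T) ->
  G `<=` opalg_gen G' -> G' `<=` opalg_gen G -> opalg_gen G = opalg_gen G'.
Proof.
move=> bG bG' h h'; apply/seteqP; split; apply: smallest_sub => //;
  exact: opalg_gen_opalg.
Qed.

Lemma cstar_gen_eq H (G G' : set (H -> H)) :
  (forall T, G T -> bounded_op T) -> (forall T, G' T -> bounded_op T) ->
  G `<=` cstar_gen G' -> G' `<=` cstar_gen G -> cstar_gen G = cstar_gen G'.
Proof.
move=> bG bG' h h'; apply/seteqP; split; apply: smallest_sub => //;
  exact: cstar_gen_cstar.
Qed.

End Polynomials.

(** * Words and the unitary relations *)

Fixpoint words (T : finType) k : seq (seq T) :=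
  if k is k'.+1 then [seq a :: w | a <- enum T, w <- words T k'] else [:: [::]].

Lemma mem_words (T : finType) k w : (w \in words T k) = (size w == k).
Proof.
elim: k w => [|k IH] w /=; first by rewrite inE; case: w.
apply/allpairsP/idP => [[[a v] /= [_ vk ->]] /=|]; first by rewrite eqSS -IH.
by case: w => // a w; rewrite eqSS -IH => wk; exists (a, w); rewrite /= mem_enum.
Qed.

Lemma words_uniq (T : finType) k : uniq (words T k).
Proof.
elim: k => //= k IH; apply: allpairs_uniq => //; first exact: enum_uniq.
by move=> [a v] [b w] _ _ /= [-> ->].
Qed.

Lemma big_words (V : nmodType) (T : finType) k (F : seq T -> V) :
  \sum_(w <- words T k.+1) F w = \sum_a \sum_(w <- words T k) F (a :: w).
Proof. by rewrite /= big_allpairs_dep big_enum. Qed.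

Definition bwords m n k l : seq (fock_basis m n) :=
  [seq (w, v) | w <- words 'I_m k, v <- words 'I_n l].

Lemma mem_bwords m n k l (s : fock_basis m n) :
  (s \in bwords m n k l) = (size s.1 == k) && (size s.2 == l).
Proof.
apply/allpairsP/andP => [[[w v] /= [wk vl ->]]|[wk vl]]; first by rewrite -!mem_words.
by exists s; rewrite !mem_words; split=> //; case: s {wk vl}.
Qed.

Lemma bwords_uniq m n k l : uniq (bwords m n k l).
Proof.
apply: allpairs_uniq; [exact: words_uniq|exact: words_uniq|].
by move=> [w v] [w' v'] _ _ /= [-> ->].
Qed.

Section Relations.
Variables (R : realType) (m n : nat) (u : 'M[R[i]]_(m * n)).
Hypothesis u_unitary : u \is unitarymx.
Local Notation C := R[i].
Local Notation letter := (letter m n).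
Local Notation ix := mxvec_index.
Implicit Types (H K L : hilbertType R).

Lemma mxvec_indexE (i i' : 'I_m) (j j' : 'I_n) :
  (ix i j == ix i' j') = (i == i') && (j == j').
Proof. by rewrite (inj_eq (@cast_ord_inj _ _ _)) (inj_eq enum_rank_inj). Qed.

Lemma sum_mxvec_index (F : 'I_(m * n) -> C) :
  \sum_k F k = \sum_i \sum_j F (ix i j).
Proof. by rewrite pair_bigA /= (reindex _ (curry_mxvec_bij _ _)) /=; apply: eq_bigr => -[]. Qed.

Lemma unitary_cols i j i' j' :
  \sum_a \sum_b Num.conj (u (ix a b) (ix i j)) * u (ix a b) (ix i' j') =
  ((i == i') && (j == j'))%:R.
Proof.
have h := mulmx1C (elimT unitarymxP u_unitary).
have := congr1 (fun M : 'M[C]_(m * n) => M (ix i j) (ix i' j')) h.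
rewrite !mxE mxvec_indexE sum_mxvec_index => <-.
by apply: eq_bigr => a _; apply: eq_bigr => b _; rewrite !mxE.
Qed.

Definition is_e (x : letter) := if x is inl _ then true else false.
Definition ce (z : seq letter) := count is_e z.
Definition cf (z : seq letter) := count (predC is_e) z.

(** Linear representations of the relations. Rewriting words involves no adjoint,
    and applies to the creation operators too, which do not form a
    *-representation. *)
Record rel_rep H (f : letter -> H -> H) : Prop := {
  rel_linear : forall x, linear (f x);
  rel_ef : forall i j, f (inl i) \o f (inr j) =
    \sum_i' \sum_j' u (ix i j) (ix i' j') *: (f (inr j') \o f (inl i'));
  rel_fe : forall i j, f (inr j) \o f (inl i) =
    \sum_a \sum_b Num.conj (u (ix a b) (ix i j)) *: (f (inl a) \o f (inr b)) }.

(** The unitarity of u lets the relations be solved for the products f_j e_i. *)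
Lemma rel_repP H (f : letter -> H -> H) : (forall x, linear (f x)) ->
  (forall i j, f (inl i) \o f (inr j) =
    \sum_i' \sum_j' u (ix i j) (ix i' j') *: (f (inr j') \o f (inl i'))) ->
  rel_rep f.
Proof.
move=> lf ef; split=> // i j.
under eq_bigr do under eq_bigr do rewrite ef scaler_sumr.
under eq_bigr do rewrite exchange_big.
rewrite exchange_big /=.
under eq_bigr do under eq_bigr do under eq_bigr do rewrite scaler_sumr.
under eq_bigr do under eq_bigr do rewrite exchange_big /=.
under eq_bigr do rewrite exchange_big /=.
under eq_bigr do under eq_bigr do under eq_bigr do under eq_bigr do rewrite scalerA.
under eq_bigr do under eq_bigr do under eq_bigr do rewrite -scaler_suml.
under eq_bigr do under eq_bigr do rewrite -scaler_suml unitary_cols.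
rewrite (bigD1 i)//= (bigD1 j)//= !eqxx scale1r big1 ?addr0 => [|j' /negPf j'j].
  rewrite big1 ?addr0// => i' /negPf i'i; rewrite big1// => j' _.
  by rewrite eq_sym i'i scale0r.
by rewrite eq_sym j'j scale0r.
Qed.

(** sw y x rewrites the product of y and x, two letters of different kinds, with
    the kinds in the opposite order; pull uses it to bring the first letter of
    kind P to the front. *)
Section Pull.
Variables (P : pred letter) (sw : letter -> letter -> seq (C * (letter * letter))).
Hypothesis sw_kind : forall y x, ~~ P y -> P x ->
  all (fun t => P t.2.1 && ~~ P t.2.2) (sw y x).
Fixpoint pull (z : seq letter) : seq (C * (letter * seq letter)) :=
  if z is y :: z' then
    if P y then [:: (1, (y, z'))]
    else flatten [seq [seq (t.1 * s.1, (s.2.1, s.2.2 :: t.2.2)) | s <- sw y t.2.1] |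
                    t <- pull z']
  else [::].

Lemma pull_count z : has P z -> all (fun t => [&& P t.2.1,
   (count P t.2.2).+1 == count P z & count (predC P) t.2.2 == count (predC P) z]) (pull z).
Proof.
elim: z => //= y z IH; case: ifP => [Py _|/negbT nPy /= hz] /=.
  by rewrite Py /= !add0n add1n !eqxx.
apply/allP => _ /flattenP[_ /mapP[t tz ->] /mapP[s sy ->]] /=.
have /allP /(_ _ tz) /and3P[Pt c1 c2] := IH hz.
have /allP /(_ _ sy) /andP[Ps nPs] := sw_kind nPy Pt.
by rewrite Ps (negPf nPs) /= !add0n !add1n c1 eqSS c2.
Qed.

Hypothesis sw_ev : forall H (f : letter -> H -> H), rel_rep f -> forall y x,
  ~~ P y -> P x ->
  f y \o f x = \sum_(t <- sw y x) t.1 *: (f t.2.1 \o f t.2.2).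

Lemma pull_ev H (f : letter -> H -> H) z : rel_rep f -> has P z ->
  wev f z = \sum_(t <- pull z) t.1 *: (f t.2.1 \o wev f t.2.2).
Proof.
move=> rf; elim: z => //= y z IH; case: ifP => [Py _|/negbT nPy /= hz] /=.
  by rewrite big_seq1 scale1r.
rewrite (IH hz) comp_sumr; last exact: (rel_linear rf).
rewrite big_flatten big_map /= big_seq [RHS]big_seq.
apply: eq_bigr => t /(allP (pull_count hz)) /and3P[Pt _ _].
rewrite big_map comp_Zr; last exact: (rel_linear rf).
transitivity (t.1 *: ((f y \o f t.2.1) \o wev f t.2.2)) => //.
rewrite (sw_ev rf nPy Pt) comp_suml scaler_sumr; apply: eq_bigr => s _.
by rewrite comp_Zl scalerA.
Qed.

End Pull.

Definition swap_fe (y x : letter) : seq (C * (letter * letter)) :=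
  match y, x with
  | inr j, inl i => [seq (Num.conj (u (ix a b) (ix i j)), (inl a, inr b)) |
      a <- enum 'I_m, b <- enum 'I_n]
  | _, _ => [::] end.

Definition swap_ef (y x : letter) : seq (C * (letter * letter)) :=
  match y, x with
  | inl i, inr j => [seq (u (ix i j) (ix a b), (inr b, inl a)) |
      a <- enum 'I_m, b <- enum 'I_n]
  | _, _ => [::] end.

Definition pull_e := pull is_e swap_fe.
Definition pull_f := pull (predC is_e) swap_ef.

Lemma swap_fe_kind y x : ~~ is_e y -> is_e x ->
  all (fun t => is_e t.2.1 && ~~ is_e t.2.2) (swap_fe y x).
Proof. by case: y x => // j [] // i _ _; apply/allP => _ /allpairsP[[a b] [_ _ ->]]. Qed.

Lemma swap_ef_kind y x : ~~ predC is_e y -> predC is_e x ->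
  all (fun t => predC is_e t.2.1 && ~~ predC is_e t.2.2) (swap_ef y x).
Proof. by case: y x => // j [] // i _ _; apply/allP => _ /allpairsP[[a b] [_ _ ->]]. Qed.

Lemma swap_fe_ev H (f : letter -> H -> H) : rel_rep f -> forall y x, ~~ is_e y -> is_e x ->
  f y \o f x = \sum_(t <- swap_fe y x) t.1 *: (f t.2.1 \o f t.2.2).
Proof.
move=> rf [//|j] [i|//] _ _; rewrite (rel_fe rf) big_allpairs_dep /= big_enum /=.
by apply: eq_bigr => a _; rewrite big_enum.
Qed.

Lemma swap_ef_ev H (f : letter -> H -> H) : rel_rep f ->
  forall y x, ~~ predC is_e y -> predC is_e x ->
  f y \o f x = \sum_(t <- swap_ef y x) t.1 *: (f t.2.1 \o f t.2.2).
Proof.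
move=> rf [i|//] [//|j] _ _; rewrite (rel_ef rf) big_allpairs_dep /= big_enum /=.
by apply: eq_bigr => a _; rewrite big_enum.
Qed.

Lemma ceP z : has is_e z = (0 < ce z)%N. Proof. exact: has_count. Qed.
Lemma cfP z : has (predC is_e) z = (0 < cf z)%N. Proof. exact: has_count. Qed.

Lemma pull_e_count z : (0 < ce z)%N -> all (fun t => [&& is_e t.2.1,
  (ce t.2.2).+1 == ce z & cf t.2.2 == cf z]) (pull_e z).
Proof. by rewrite -ceP; exact: (pull_count swap_fe_kind). Qed.

Lemma pull_f_count z : (0 < cf z)%N -> all (fun t => [&& ~~ is_e t.2.1,
  (cf t.2.2).+1 == cf z & ce t.2.2 == ce z]) (pull_f z).
Proof.
rewrite -cfP => hz; have := pull_count swap_ef_kind hz; apply: sub_all => t /and3P[h1 h2 h3].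
apply/and3P; split; [exact: h1|exact: h2|].
by move: h3; rewrite /ce !(@eq_count _ (predC (predC is_e)) is_e)// => x /=; rewrite negbK.
Qed.

Lemma pull_e_ev H (f : letter -> H -> H) z : rel_rep f -> (0 < ce z)%N ->
  wev f z = \sum_(t <- pull_e z) t.1 *: (f t.2.1 \o wev f t.2.2).
Proof. by move=> rf; rewrite -ceP; exact: (pull_ev swap_fe_kind swap_fe_ev). Qed.

Lemma pull_f_ev H (f : letter -> H -> H) z : rel_rep f -> (0 < cf z)%N ->
  wev f z = \sum_(t <- pull_f z) t.1 *: (f t.2.1 \o wev f t.2.2).
Proof. by move=> rf; rewrite -cfP; exact: (pull_ev swap_ef_kind swap_ef_ev). Qed.

Lemma word_of_f z : ce z = 0%N -> exists v : seq 'I_n, z = word_of ([::], v).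
Proof.
elim: z => [|[i|j] z IH] //=; first by exists [::].
by rewrite /ce /= add0n => /IH[v ->]; exists (j :: v).
Qed.

Lemma word_of_counts (s : fock_basis m n) : ce (word_of s) = size s.1 /\ cf (word_of s) = size s.2.
Proof.
rewrite /ce /cf /word_of !count_cat !count_map; split.
  rewrite (@eq_count _ _ predT)// count_predT (@eq_count _ _ pred0)// count_pred0.
  by rewrite addn0.
by rewrite (@eq_count _ _ pred0)// count_pred0 (@eq_count _ _ predT)// count_predT.
Qed.

(** The letters e are pulled to the front one at a time. The combination r does
    not depend on the representation, and so transports identities from one
    representation to another. *)
Lemma normal_form z : exists r : seq (C * fock_basis m n),
  all (fun t => (size t.2.1 == ce z) && (size t.2.2 == cf z)) r /\
  forall H (f : letter -> H -> H), rel_rep f ->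
    wev f z = \sum_(t <- r) t.1 *: wev f (word_of t.2).
Proof.
move: {2}(ce z) (erefl (ce z)) => k; elim: k z => [|k IH] z kz.
  have [v zv] := word_of_f kz; exists [:: (1, ([::], v))]; split.
    by have [h1 h2] := word_of_counts ([::], v); rewrite /= zv h1 h2 /= !eqxx.
  by move=> H f rf; rewrite big_seq1 scale1r zv.
have z0 : (0 < ce z)%N by rewrite kz.
have : exists r : seq (C * fock_basis m n),
    all (fun t => (size t.2.1 == ce z) && (size t.2.2 == cf z)) r /\
    forall H (f : letter -> H -> H), rel_rep f ->
    \sum_(t <- pull_e z) t.1 *: (f t.2.1 \o wev f t.2.2) =
       \sum_(t <- r) t.1 *: wev f (word_of t.2).
  have := pull_e_count z0; elim: (pull_e z) => [_|[c [x z']] p IHp].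
    by exists [::]; split=> // H f rf; rewrite !big_nil.
  rewrite [all _ _]/= => /andP[/and3P[/= xe h1 h2]] /IHp[r [rz Hr]].
  case: x xe => // a _.
  have /IH[r' [r'z' Hr']] : ce z' = k by apply/eqP; rewrite -eqSS -kz.
  exists ([seq (c * t.1, (a :: t.2.1, t.2.2)) | t <- r'] ++ r); split.
    rewrite all_cat rz andbT; apply/allP => _ /mapP[t /(allP r'z') /andP[/= s1 s2] ->] /=.
    by rewrite (eqP s2) h2 andbT -(eqP h1) eqSS.
  move=> H f rf; rewrite big_cons big_cat (Hr _ _ rf) big_map; congr (_ + _).
  rewrite /= (Hr' _ _ rf) comp_sumr; last exact: (rel_linear rf).
  rewrite scaler_sumr; apply: eq_bigr => t _.
  by rewrite comp_Zr ?scalerA//; exact: (rel_linear rf).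
move=> [r [rz Hr]]; exists r; split=> // H f rf.
by rewrite (pull_e_ev rf z0) Hr.
Qed.

(** * Representations of Cuntz type *)

Definition star_rep H (f : letter -> H -> H) : Prop :=
  star_representation u (fun i => f (inl i)) (fun j => f (inr j)).

Section StarRep.
Variables (H : hilbertType R) (f : letter -> H -> H).
Hypothesis sf : star_rep f.

Lemma star_bounded x : bounded_op (f x).
Proof.
by case: x => i; [exact: (star_rep_boundedA sf)|exact: (star_rep_boundedB sf)].
Qed.

Lemma star_isometric x : isometric (f x).
Proof.
by case: x => i; [exact: (star_rep_isometricA sf)|exact: (star_rep_isometricB sf)].
Qed.

Lemma star_rel : rel_rep f.
Proof.
apply: rel_repP => [x|i j]; first exact/bounded_lin/star_bounded.
exact: (star_rep_relation sf).
Qed.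

Lemma cuntz_norm I (r : seq I) (g : I -> H -> H) : (forall i, bounded_op (g i)) ->
  \sum_(i <- r) (g i \o adjoint (g i)) = idfun ->
  forall x, \sum_(i <- r) rn (adjoint (g i) x) ^+ 2 = rn x ^+ 2.
Proof.
move=> bg sg x; have := congr1 (fun T => hdot (T x) x) sg.
rewrite /= sumfE hdot_suml hdot_rn => /(congr1 (@complex.Re _)) /= <-.
rewrite raddf_sum /=; apply: eq_bigr => i _.
by rewrite rn_hdot [in RHS]adjointP.
Qed.

(** A row of operators with \sum_i g_i g_i^* = 1 is a coisometry, hence a
    contraction. *)
Lemma cuntz_row_contr I (r : seq I) (g : I -> H -> H) : (forall i, bounded_op (g i)) ->
  \sum_(i <- r) (g i \o adjoint (g i)) = idfun ->
  forall y : I -> H, rn (\sum_(i <- r) g i (y i)) ^+ 2 <= \sum_(i <- r) rn (y i) ^+ 2.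
Proof.
move=> bg sg y; set z := \sum_(i <- r) _.
have E : rn z ^+ 2 = \sum_(i <- r) complex.Re (hdot (y i) (adjoint (g i) z)).
  rewrite rn_hdot {1}/z hdot_suml raddf_sum /=; apply: eq_bigr => i _.
  by rewrite adjointP.
have h : rn z ^+ 2 <= \sum_(i <- r) (rn (y i) ^+ 2 / 2 + rn (adjoint (g i) z) ^+ 2 / 2).
  rewrite {1}E; apply: ler_sum => i _; apply: le_trans (hdot_Re_CS _ _) _.
  set a := rn _; set b := rn _; have := sqr_ge0 (a - b); nra.
by move: h; rewrite big_split /= -!mulr_suml (cuntz_norm bg sg); lra.
Qed.

(** For y = g_k x the k-th term alone exhausts the sum of the squared norms of
    the g_i^* y, so that the other terms vanish. *)
Lemma cuntz_orth (I : finType) (g : I -> H -> H) : (forall i, bounded_op (g i)) ->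
  (forall i, isometric (g i)) ->
  \sum_i (g i \o adjoint (g i)) = idfun ->
  forall i k, adjoint (g i) \o g k = if i == k then idfun else 0.
Proof.
move=> bg ig sg i k; case: eqP => [->|/eqP ik]; first exact: isometric_adjointK.
apply/funext => x; apply/rn_eq0/eqP; rewrite -sqrf_eq0 /=.
have := cuntz_norm bg sg (g k x); rewrite (bigD1 k)//=.
have -> : adjoint (g k) (g k x) = x.
  exact: (congr1 (fun T => T x) (isometric_adjointK (bg k) (ig k))).
rewrite (isometric_rn (ig k)) -[RHS]addr0 => /addrI/eqP.
rewrite psumr_eq0; last by move=> *; exact: sqr_ge0.
by move=> /allP /(_ i (mem_index_enum i)); rewrite ik.
Qed.

Lemma star_orth x y : is_e x = is_e y ->
  adjoint (f x) \o f y = if x == y then idfun else 0.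
Proof.
case: x y => [i|j] [i'|j'] // _.
  exact: (@cuntz_orth _ (fun i => f (inl i)) (fun i => star_bounded _)
    (fun i => star_isometric _) (star_rep_sumA sf)).
exact: (@cuntz_orth _ (fun i => f (inr i)) (fun i => star_bounded _)
    (fun i => star_isometric _) (star_rep_sumB sf)).
Qed.

Lemma star_sum_words (T : finType) (g : T -> letter) k :
  \sum_i (f (g i) \o adjoint (f (g i))) = idfun ->
  \sum_(w <- words T k) (wev f (map g w) \o adjoint (wev f (map g w))) = idfun.
Proof.
move=> sg; elim: k => [|k IH]; first by rewrite big_seq1 adjoint_id.
rewrite big_words -[RHS]sg; apply: eq_bigr => a _.
have bw w := wev_bounded star_bounded (map g w).
transitivity (f (g a) \o (\sum_(w <- words T k)
    (wev f (map g w) \o adjoint (wev f (map g w)))) \o adjoint (f (g a))).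
  rewrite comp_sumr ?comp_suml; last exact/bounded_lin/star_bounded.
  apply: eq_bigr => w _; rewrite /= adjoint_comp//; exact: star_bounded.
by rewrite IH.
Qed.

Lemma star_sum_bwords k l : \sum_(s <- bwords m n k l)
  (wev f (word_of s) \o adjoint (wev f (word_of s))) = idfun.
Proof.
rewrite big_allpairs_dep -(star_sum_words k (star_rep_sumA sf)).
apply: eq_bigr => w _; rewrite /word_of /=.
have bw z := wev_bounded star_bounded z.
transitivity (wev f (map inl w) \o (\sum_(v <- words 'I_n l)
    (wev f (map inr v) \o adjoint (wev f (map inr v)))) \o adjoint (wev f (map inl w))).
  rewrite comp_sumr ?comp_suml; last exact/bounded_lin/bw.
  by apply: eq_bigr => v _; rewrite wev_cat adjoint_comp.
by rewrite (star_sum_words l (star_rep_sumB sf)).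
Qed.

Lemma star_bwords_norm k l x :
  \sum_(s <- bwords m n k l) rn (adjoint (wev f (word_of s)) x) ^+ 2 = rn x ^+ 2.
Proof.
apply: (@cuntz_norm _ _ (fun s => wev f (word_of s))); last exact: star_sum_bwords.
by move=> s; exact: (wev_bounded star_bounded).
Qed.

(** The operator x^* is absorbed into a word on its right: a letter of the kind
    of x is pulled to the front, and by orthogonality of the ranges only the
    terms that begin with x survive. *)
Definition strip (x : letter) (z : seq letter) : ncpoly R letter :=
  [seq (t.1 * (x == t.2.1)%:R, t.2.2) | t <- if is_e x then pull_e z else pull_f z].

Lemma strip_ev x z : (0 < ce z)%N -> (0 < cf z)%N ->
  adjoint (f x) \o wev f z = pev f (strip x z).
Proof.
move=> e0 f0; have rf := star_rel; rewrite /pev /strip big_map.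
have la : linear (adjoint (f x)) by exact/adjoint_linear/star_bounded.
have key (c : C) y z' : is_e x = is_e y ->
    adjoint (f x) \o (c *: (f y \o wev f z')) = (c * (x == y)%:R) *: wev f z'.
  move=> xy; rewrite comp_Zr//; have /(congr1 (fun T => T \o wev f z')) := star_orth xy.
  rewrite -compA => ->; case: eqP => _; rewrite ?mulr1// mulr0 scale0r.
  by apply/funext => v; rewrite /= scaler0.
case: ifP => ex.
  rewrite (pull_e_ev rf e0) comp_sumr// big_seq [RHS]big_seq.
  apply: eq_bigr => t /(allP (pull_e_count e0)) /and3P[te _ _].
  by rewrite key// ex te.
rewrite (pull_f_ev rf f0) comp_sumr// big_seq [RHS]big_seq.
apply: eq_bigr => t /(allP (pull_f_count f0)) /and3P[te _ _].
by rewrite key// ex (negPf te).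
Qed.

End StarRep.

Lemma strip_count x z : (0 < ce z)%N -> (0 < cf z)%N ->
  all (fun t => (ce z <= (ce t.2).+1)%N && (cf z <= (cf t.2).+1)%N) (strip x z).
Proof.
move=> e0 f0; rewrite /strip; apply/allP => _ /mapP[t + ->] /=; case: ifP => _.
  by move=> /(allP (pull_e_count e0)) /and3P[_ /eqP <- /eqP <-]; rewrite leqnn leqnSn.
by move=> /(allP (pull_f_count f0)) /and3P[_ /eqP <- /eqP <-]; rewrite leqnn leqnSn.
Qed.

Fixpoint reduce (t : seq (bool * letter)) (z : seq letter) : ncpoly R letter :=
  if t is (b, x) :: t' then
    flatten [seq (if b then pscale s.1 (strip x s.2) else [:: (s.1, x :: s.2)]) |
               s <- reduce t' z]
  else [:: (1, z)].

(** Each letter of t uses up at most one letter of each kind, so that enough of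
    them remain for the next step. *)
Lemma reduce_count t z : (size t <= ce z)%N -> (size t <= cf z)%N ->
  all (fun s => (ce z <= ce s.2 + size t)%N && (cf z <= cf s.2 + size t)%N) (reduce t z).
Proof.
elim: t => [_ _|[b x] t IH] /=; first by rewrite !addn0 !leqnn.
move=> e1 f1; apply/allP => s /flattenP[_ /mapP[r rz ->]].
have /allP /(_ _ rz) /andP[re rf] := IH (ltnW e1) (ltnW f1).
have re0 : (0 < ce r.2)%N by rewrite -(ltn_add2r (size t)) add0n (leq_trans e1).
have rf0 : (0 < cf r.2)%N by rewrite -(ltn_add2r (size t)) add0n (leq_trans f1).
case: b => [/mapP[q /(allP (strip_count x re0 rf0)) /andP[h1 h2] ->]|] /=.
  rewrite !addnS -!addSn (leq_trans re) ?leq_add2r// (leq_trans rf) ?leq_add2r//.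
rewrite inE => /eqP -> /=; rewrite !addnS -!addSn.
by rewrite (leq_trans re) ?(leq_trans rf)// leq_add2r leq_addl.
Qed.

Lemma reduce_ev H (f : letter -> H -> H) t z : star_rep f ->
  (size t <= ce z)%N -> (size t <= cf z)%N ->
  wev (srep f) t \o wev f z = pev f (reduce t z).
Proof.
move=> sf; elim: t => [_ _|[b x] t IH] /=; first by rewrite pev_word.
move=> e1 f1; have bs := srep_bounded (star_bounded sf).
rewrite -compA (IH (ltnW e1) (ltnW f1)) /pev comp_sumr; last exact/bounded_lin/bs.
rewrite big_flatten big_map /= big_seq [RHS]big_seq; apply: eq_bigr => r rz.
have /allP /(_ _ rz) /andP[re rf] := reduce_count (ltnW e1) (ltnW f1).
have re0 : (0 < ce r.2)%N by rewrite -(ltn_add2r (size t)) add0n (leq_trans e1).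
have rf0 : (0 < cf r.2)%N by rewrite -(ltn_add2r (size t)) add0n (leq_trans f1).
rewrite comp_Zr; last exact/bounded_lin/bs.
case: b => /=; last by rewrite big_seq1.
rewrite {1}/srep /= strip_ev//; exact/esym/pev_scale.
Qed.

Definition reduce_poly (p : ncpoly R (bool * letter)) z : ncpoly R letter :=
  flatten [seq pscale t.1 (reduce t.2 z) | t <- p].

(** The polynomial reduce_poly p z is the same in all *-representations, whose
    norms on *-polynomials can thus be compared on polynomials without adjoints. *)
Lemma reduce_poly_ev H (f : letter -> H -> H) p z : star_rep f ->
  all (fun t => (size t.2 <= ce z)%N && (size t.2 <= cf z)%N) p ->
  pev (srep f) p \o wev f z = pev f (reduce_poly p z).
Proof.
move=> sf /allP pz; rewrite /pev /reduce_poly big_flatten big_map /= comp_suml.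
rewrite big_seq [RHS]big_seq; apply: eq_bigr => t /pz /andP[h1 h2].
by rewrite comp_Zl (reduce_ev sf h1 h2) -(pev_scale f).
Qed.

Definition poly_degree (X : eqType) (p : ncpoly R X) : nat := \max_(t <- p) size t.2.

Lemma poly_degreeP (X : eqType) (p : ncpoly R X) :
  all (fun t => (size t.2 <= poly_degree p)%N) p.
Proof. by apply/allP => t tp; apply: (@leq_bigmax_seq _ _ predT (fun t => size t.2)). Qed.

End Relations.

(** * Orthonormal families and l2 spaces *)

Section Orthonormal.
Variables (R : realType) (S : choiceType) (H : hilbertType R) (d : S -> H).
Local Notation C := R[i].
Local Notation normc := ComplexField.Normc.normc.
Hypothesis hd : forall s t, hdot (d s) (d t) = (s == t)%:R.

Lemma ortho_coord (r : seq S) (h : S -> C) s : uniq r ->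
  hdot (\sum_(t <- r) h t *: d t) (d s) = if s \in r then h s else 0.
Proof.
move=> ur; rewrite hdot_suml; case: ifPn => sr.
  rewrite (bigD1_seq s)//= hdotZl hd eqxx mulr1 big1 ?addr0// => t /negPf ts.
  by rewrite hdotZl hd ts mulr0.
rewrite big_seq big1// => t tr; rewrite hdotZl hd; case: eqP => [ts|]; last by rewrite mulr0.
by rewrite -ts tr in sr.
Qed.

Lemma ortho_rn (r : seq S) (h : S -> C) : uniq r ->
  rn (\sum_(t <- r) h t *: d t) ^+ 2 = \sum_(t <- r) normc (h t) ^+ 2.
Proof.
move=> ur; rewrite rn_hdot {1}hdot_suml raddf_sum big_seq [RHS]big_seq.
by apply: eq_bigr => t tr; rewrite hdotZl hdotC ortho_coord// tr mul_conj.
Qed.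

Lemma ortho_dist (f : H) (r : seq S) : uniq r ->
  rn (f - \sum_(t <- r) hdot f (d t) *: d t) ^+ 2 =
  rn f ^+ 2 - \sum_(t <- r) normc (hdot f (d t)) ^+ 2.
Proof.
move=> ur; set g := \sum_(t <- r) _.
have fg : hdot g (f - g) = 0.
  rewrite {1}/g hdot_suml big_seq big1// => t tr.
  by rewrite hdotZl [hdot (d t) _]hdotC hdotBl ortho_coord// tr subrr rmorph0 mulr0.
by have := pythagoras fg; rewrite [g + _]addrC subrK {2}/g ortho_rn// => ->; lra.
Qed.

Lemma bessel (f : H) (r : seq S) : uniq r ->
  \sum_(t <- r) normc (hdot f (d t)) ^+ 2 <= rn f ^+ 2.
Proof. by move=> ur; rewrite -subr_ge0 -ortho_dist// sqr_ge0. Qed.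

End Orthonormal.

Lemma isometric_dense (R : realType) (H K : hilbertType R) (T : H -> K) (D : set H) :
  bounded_op T -> closure D = setT -> (forall x, D x -> rn (T x) = rn x) ->
  isometric T.
Proof.
move=> bT Dd TD x; rewrite !rnE; congr (_%:C)%C; apply: subr0_eq.
have [c c0 Tc] := bounded_ge0 bT; have lT := bounded_lin bT.
apply/eqP; rewrite -normr_le0; apply/ler_addgt0Pr => e e0; rewrite add0r.
have c1 : 0 < c + 1 by rewrite ltr_wpDl.
have := (closure_rnP D x).1; rewrite Dd => /(_ I _ (divr_gt0 e0 c1))[y Dy xy].
have Txy := Tc (x - y); rewrite (linB lT) in Txy.
have h1 := rnD (T x - T y) (T y); rewrite subrK in h1.
have h2 := rnD (x - y) y; rewrite subrK in h2.
have h3 := rnD (T y - T x) (T x); rewrite subrK rn_distC in h3.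
have h4 := rnD (y - x) x; rewrite subrK rn_distC in h4.
have E := TD _ Dy; move: xy; rewrite ltr_pdivlMr// => xy.
by rewrite ler_norml; apply/andP; split; lra.
Qed.

Section L2.
Variables (R : realType) (S : choiceType).
Local Notation C := R[i].
Local Notation normc := ComplexField.Normc.normc.
Local Notation l2 := (l2 R S).
Implicit Types (f g : l2) (s t : S) (H : hilbertType R).

Lemma delta_summable s : (fun t => (t == s)%:R : C) \in @l2_pred R S.
Proof.
apply/l2_predP; apply: (@square_summable_bounded _ _ _ 1) => X finX.
rewrite fsbig_finite//= (eq_bigr (fun t => if t == s then 1 else 0)); last first.
  by move=> t _; case: eqP => _; rewrite ?ComplexField.Normc.normc1 ?ComplexField.Normc.normc0 ?expr1n ?expr0n.
rewrite -big_mkcond; set r := finmap.enum_fset _.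
have ur : uniq r by exact: finmap.fset_uniq.
have [sr|sr] := boolP (s \in r); first by rewrite -big_filter filter_pred1_uniq// big_seq1.
rewrite big_seq_cond big1// => t /andP[tr /eqP ts].
by rewrite -ts tr in sr.
Qed.

Lemma deltaE s t : delta R s t = (t == s)%:R.
Proof. by rewrite /delta /to_l2 insubdK//; exact: delta_summable. Qed.

Lemma l2_addE f g s : (f + g) s = f s + g s. Proof. by []. Qed.

Lemma l2_scaleE a f s : (a *: f) s = a * f s. Proof. by []. Qed.

Lemma l2_subE f g s : (f - g) s = f s - g s. Proof. by []. Qed.

Lemma l2_sumE I (r : seq I) (F : I -> l2) s :
  (\sum_(i <- r) F i) s = \sum_(i <- r) F i s.
Proof. by elim: r => [|i r IH]; rewrite ?big_nil// !big_cons l2_addE IH. Qed.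

Lemma hdot_delta_delta s : hdot (delta R s) (delta R s) = 1 :> C.
Proof.
rewrite (_ : hdot _ _ = l2dot (delta R s) (delta R s))// l2dotxx.
rewrite rsum_ge0E => [|t]; last exact: sqr_ge0.
have -> : (\esum_(t in [set: S]) (normc (delta R s t) ^+ 2)%:E)%E =
    (\esum_(t in [set s]) (1%:E : \bar R))%E.
  rewrite [RHS]esum_mkcond; apply: eq_esum => t _; rewrite deltaE.
  have [->|/eqP ts] := eqVneq t s.
    by rewrite mem_set// ComplexField.Normc.normc1 expr1n.
  by rewrite memNset// ComplexField.Normc.normc0 expr0n.
by rewrite esum_set1// lee_fin.
Qed.

Lemma csum0 : csum (fun _ : S => 0 : C) = 0.
Proof.
by rewrite /csum /rsum; congr Complex; rewrite !esum1 ?subr0//= => t _;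
  rewrite ?oppr0 maxxx.
Qed.

Lemma l2dot_delta f s : l2dot f (delta R s) = f s.
Proof.
pose g := f - f s *: delta R s.
have fE : f = f s *: delta R s + g by rewrite /g [RHS]addrC subrK.
have dd : l2dot (delta R s) (delta R s) = 1 := hdot_delta_delta s.
rewrite [in LHS]fE l2dotP dd mulr1 [X in _ + X](_ : _ = 0) ?addr0//.
rewrite /l2dot -[RHS]csum0; congr csum; apply/funext => t.
rewrite deltaE; have [->|ts] := eqVneq t s.
  by rewrite /g l2_subE l2_scaleE deltaE eqxx mulr1 subrr mul0r.
by rewrite rmorph0 mulr0.
Qed.

Lemma hdot_delta f s : hdot f (delta R s) = f s.
Proof. exact: l2dot_delta. Qed.

Lemma hdot_deltas s t : hdot (delta R s) (delta R t) = (s == t)%:R :> C.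
Proof. by rewrite hdot_delta deltaE eq_sym. Qed.

Lemma l2_sum_deltaE (r : seq S) (h : S -> C) s : uniq r ->
  l2fun (\sum_(t <- r) h t *: delta R t) s = if s \in r then h s else 0.
Proof. by move=> ur; rewrite -(ortho_coord hdot_deltas)// hdot_delta. Qed.

Lemma delta_approx f (e : R) : 0 < e ->
  exists2 r : seq S, uniq r & rn (f - \sum_(t <- r) f t *: delta R t) < e.
Proof.
move=> e0.
have S0 s : 0 <= normc (f s) ^+ 2 by exact: sqr_ge0.
have fE : (rn f ^+ 2)%:E = (\esum_(s in [set: S]) (normc (f s) ^+ 2)%:E)%E.
  rewrite (_ : rn f = rnorm f)// rnorm_sq rsum_ge0E// fineK//.
  by apply: esum_fin; [|exact: l2_sum].
have [X finX HX] : exists2 X : set S, finite_set X &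
    rn f ^+ 2 - e ^+ 2 < \sum_(s \in X) normc (f s) ^+ 2.
  apply: contrapT => h.
  have : ((rn f ^+ 2)%:E <= (rn f ^+ 2 - e ^+ 2)%:E)%E.
    rewrite {1}fE; apply: ge_ereal_sup => _ [X [finX _] <-].
    rewrite fsumEFin// lee_fin leNgt; apply/negP => hX; apply: h; by exists X.
  by rewrite lee_fin lerBrDr gerDl leNgt exprn_gt0.
pose r : seq S := finmap.enum_fset (fset_set X).
have ur : uniq r by exact: finmap.fset_uniq.
exists r => //; have := ortho_dist hdot_deltas f ur.
under eq_bigr do rewrite hdot_delta.
have -> : \sum_(t <- r) normc (hdot f (delta R t)) ^+ 2 = \sum_(t <- r) normc (f t) ^+ 2.
  by apply: eq_bigr => t _; congr (normc _ ^+ 2); exact: hdot_delta.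
rewrite fsbig_finite//= -/r in HX => E.
by rewrite -(@ltr_pXn2r _ 2)// ?nnegrE ?rn_ge0 ?(ltW e0)// E; move: HX; lra.
Qed.

Lemma delta_dense : closure [set f : l2 | exists r : seq (C * S),
  f = \sum_(t <- r) t.1 *: delta R t.2] = setT.
Proof.
apply/seteqP; split=> // f _; apply/closure_rnP => e e0.
have [r _ fr] := delta_approx f e0; exists (\sum_(t <- r) l2fun f t *: delta R t) => //.
by exists [seq (l2fun f t, t) | t <- r]; rewrite big_map.
Qed.

Lemma bounded_eq_basis H (T T' : l2 -> H) : bounded_op T -> bounded_op T' ->
  (forall s, T (delta R s) = T' (delta R s)) -> T = T'.
Proof.
move=> bT bT' TT'; apply: (bounded_eq_dense bT bT' delta_dense) => _ [r ->].
rewrite (lin_sum (bounded_lin bT)) (lin_sum (bounded_lin bT')).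
apply: eq_bigr => t _.
by rewrite (linZ (bounded_lin bT)) (linZ (bounded_lin bT')) TT'.
Qed.

Lemma comb_rn (K : hilbertType R) (d : S -> K) (r : seq (C * S)) :
  (forall s t, hdot (d s) (d t) = (s == t)%:R) ->
  rn (\sum_(t <- r) t.1 *: d t.2) ^+ 2 =
  complex.Re (\sum_(t <- r) \sum_(s <- r) t.1 * (Num.conj s.1 * (t.2 == s.2)%:R)).
Proof.
move=> dd; rewrite rn_hdot hdot_suml; congr complex.Re; apply: eq_bigr => t _.
by rewrite hdot_sumr; apply: eq_bigr => s _; rewrite hdotZl hdotZr dd.
Qed.

(** The standard basis being orthonormal as well, finite combinations with the
    same coefficients have the same norm. *)
Lemma of_basisP H (c : S -> H) :
  (forall s t, hdot (c s) (c t) = (s == t)%:R) ->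
  [/\ bounded_op (of_basis c), isometric (of_basis c) &
      forall s, of_basis c (delta R s) = c s].
Proof.
move=> cc.
pose G (x : l2) (y : H) := exists r : seq (C * S),
  x = \sum_(t <- r) t.1 *: delta R t.2 /\ y = \sum_(t <- r) t.1 *: c t.2.
have Giso x y : G x y -> rn y = rn x.
  move=> [r [-> ->]]; apply/eqP; rewrite -(@eqrXn2 _ 2)// ?rn_ge0//.
  by rewrite (comb_rn _ cc) (comb_rn _ hdot_deltas).
have Glin a x y x' y' : G x y -> G x' y' -> G (a *: x + x') (a *: y + y').
  move=> [r [-> ->]] [r' [-> ->]].
  exists ([seq (a * t.1, t.2) | t : C * S <- r] ++ r').
  rewrite !big_cat !big_map !scaler_sumr; split; congr (_ + _);
    by apply: eq_bigr => t _; rewrite scalerA.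
have Gdense : closure [set x | exists y, G x y] = setT.
  rewrite -subTset -delta_dense; apply: closure_subset => x [r ->].
  by exists (\sum_(t <- r) t.1 *: c t.2), r.
have [|T [bT _ TG]] := @extend_graph _ _ _ G 1 ler01 Glin _ Gdense.
  by move=> x y /Giso ->; rewrite mul1r.
have Ts s : T (delta R s) = c s.
  by apply: TG; exists [:: (1, s)]; rewrite !big_seq1 !scale1r.
have -> : of_basis c = T.
  rewrite /of_basis; case: xgetP => [T' _ [bT' T'c]|/(_ T)].
    by apply: bounded_eq_basis => // s; rewrite T'c Ts.
  by case.
split=> //; apply: (isometric_dense bT Gdense) => x [y g].
by rewrite (TG _ _ g); exact: Giso.
Qed.

Lemma to_l2E (r : seq S) (h : S -> C) : uniq r -> (forall s, s \notin r -> h s = 0) ->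
  to_l2 h = \sum_(t <- r) h t *: delta R t.
Proof.
move=> ur h0.
have hE : h = l2fun (\sum_(t <- r) h t *: delta R t).
  by apply/funext => s; rewrite l2_sum_deltaE//; case: ifPn => // /h0.
by apply: val_inj; rewrite /to_l2 /= insubdK// hE; exact: l2_mem.
Qed.

End L2.

(** * The Fock space *)

Section Fock.
Variables (R : realType) (m n : nat) (u : 'M[R[i]]_(m * n)).
Hypothesis u_unitary : u \is unitarymx.
Local Notation C := R[i].
Local Notation letter := (letter m n).
Local Notation ix := mxvec_index.
Local Notation coefs := (seq 'I_m -> seq 'I_n -> C).
Local Notation fock := (fock R m n).
Local Notation S := (fock_basis m n).
Local Notation is_e := (@is_e m n).
Implicit Types (g : coefs) (x y : letter) (z : seq letter).

(** The coefficients of the elementary tensor z in the basis e_w f_v. *)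
Definition tfun z : coefs := foldr (tens_letter u) (vacuum R (m := m) (n := n)) z.

Lemma tens_letter_supp x g k l :
  (forall w v, g w v != 0 -> size w = k /\ size v = l) ->
  forall w v, tens_letter u x g w v != 0 ->
    size w = (is_e x + k)%N /\ size v = (~~ is_e x + l)%N.
Proof.
case: x => [i|j] gs w v /=.
  by case: w => [|a w] /=; rewrite ?eqxx// mulf_eq0 negb_or => /andP[_ /gs[-> ->]].
elim: w j g k gs v => [|a w IH] j g k gs v /=.
  case: v => [|b v]; rewrite ?eqxx// mulf_eq0 negb_or => /andP[_ /gs[/= <- ->]].
  by [].
have [kE|k0] := eqVneq k k.-1.+1; last first.
  move=> h; exfalso; move/negP: h; apply; rewrite big1// => i _; rewrite big1// => b _.
  apply/eqP; rewrite mulf_eq0; apply/orP; right; apply/eqP.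
  have g0 w' v' : g (i :: w') v' = 0.
    by apply/eqP/negPn/negP => /gs[/= h _]; rewrite -h eqxx in k0.
  have -> : (fun w'' => g (i :: w'')) = fun w' v' => 0 * g w' v'.
    by apply/funext => w'; apply/funext => v'; rewrite g0 mul0r.
  by rewrite tensFZ mul0r.
move=> h; have [i [b hib]] : exists i b, tensF u b (fun w'' => g (i :: w'')) w v != 0.
  apply: contrapT => none; move/negP: h; apply; rewrite big1// => i _; rewrite big1// => b _.
  apply/eqP; rewrite mulf_eq0; apply/orP; right; apply/negPn/negP => h; apply: none.
  by exists i, b.
have [|-> ->] := IH b (fun w'' => g (i :: w'')) k.-1 _ v hib.
  by move=> w' v' /gs[/= <- ->].
by rewrite !add0n -kE.
Qed.

Lemma tfun_supp z w v : tfun z w v != 0 -> size w = ce z /\ size v = cf z.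
Proof.
elim: z w v => [|x z IH] w v /=.
  by rewrite /vacuum; case: w v => [|? ?] [|? ?] //=; rewrite eqxx.
by move=> /(tens_letter_supp IH).
Qed.

Lemma tensor_sum z : tensor u z =
  \sum_(s <- bwords m n (ce z) (cf z)) tfun z s.1 s.2 *: delta R s.
Proof.
apply: (to_l2E (h := fun s : S => tfun z s.1 s.2)) => [|s]; first exact: bwords_uniq.
rewrite mem_bwords => h; apply/eqP/negPn/negP => /tfun_supp[h1 h2].
by rewrite h1 h2 !eqxx in h.
Qed.

Lemma tensorE z (s : S) : l2fun (tensor u z) s = tfun z s.1 s.2.
Proof.
rewrite tensor_sum (l2_sum_deltaE (fun s : S => tfun z s.1 s.2)) ?bwords_uniq//.
case: ifPn => //; rewrite mem_bwords => h; apply/esym/eqP/negPn/negP => /tfun_supp[h1 h2].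
by rewrite h1 h2 !eqxx in h.
Qed.

(** The inner product of E^k (x) F^l on coefficients. *)
Definition ip k l g g' : C :=
  \sum_(w <- words 'I_m k) \sum_(v <- words 'I_n l) g w v * Num.conj (g' w v).

Lemma ip_sum k l (I J : finType) (c : I -> C) (d : J -> C) (g : I -> coefs) (g' : J -> coefs) :
  ip k l (fun w v => \sum_i c i * g i w v) (fun w v => \sum_j d j * g' j w v) =
  \sum_i \sum_j c i * Num.conj (d j) * ip k l (g i) (g' j).
Proof.
rewrite /ip.
under eq_bigr do under eq_bigr do rewrite rmorph_sum mulr_suml.
under eq_bigr do under eq_bigr do under eq_bigr do rewrite mulr_sumr.
under eq_bigr do rewrite exchange_big /=.
rewrite exchange_big /=; apply: eq_bigr => i _.
under eq_bigr do rewrite exchange_big /=.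
rewrite exchange_big /=; apply: eq_bigr => j _.
rewrite mulr_sumr; apply: eq_bigr => w _; rewrite mulr_sumr; apply: eq_bigr => v _.
by rewrite rmorphM mulrACA.
Qed.

Lemma ip_tensE k l i i' g g' :
  ip k.+1 l (tensE i g) (tensE i' g') = (i == i')%:R * ip k l g g'.
Proof.
rewrite /ip big_words (bigD1 i)//= [X in _ + X]big1 ?addr0; last first.
  move=> a /negPf ai; rewrite big1// => w _; rewrite big1// => v _.
  by rewrite ai !mul0r.
rewrite mulr_sumr; apply: eq_bigr => w _; rewrite mulr_sumr; apply: eq_bigr => v _.
by rewrite eqxx mul1r rmorphM rmorph_nat mulrCA mulrA.
Qed.

(** The columns of u are orthonormal (unitary_cols): this makes the operators
    tensF j isometric, with pairwise orthogonal ranges. *)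
Lemma ip_tensF k l j j' g g' :
  ip k l.+1 (tensF u j g) (tensF u j' g') = (j == j')%:R * ip k l g g'.
Proof.
elim: k j j' g g' => [|k IH] j j' g g'.
  rewrite /ip !big_seq1 big_words (bigD1 j)//= [X in _ + X]big1 ?addr0; last first.
    by move=> b /negPf bj; rewrite big1// => v _; rewrite bj !mul0r.
  rewrite mulr_sumr; apply: eq_bigr => v _.
  by rewrite eqxx mul1r rmorphM rmorph_nat mulrCA mulrA.
pose G i i' := ip k l (fun w => g (i :: w)) (fun w => g' (i' :: w)).
transitivity (\sum_(a < m) \sum_(p : 'I_m * 'I_n) \sum_(q : 'I_m * 'I_n)
    Num.conj (u (ix a p.2) (ix p.1 j)) * u (ix a q.2) (ix q.1 j') *
      ((p.2 == q.2)%:R * G p.1 q.1)).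
  rewrite /ip big_words; apply: eq_bigr => a _.
  have E j0 (h : coefs) w v : tensF u j0 h (a :: w) v =
     \sum_(p : 'I_m * 'I_n) Num.conj (u (ix a p.2) (ix p.1 j0)) *
        tensF u p.2 (fun w => h (p.1 :: w)) w v.
    by rewrite /= pair_bigA.
  under eq_bigr do under eq_bigr do rewrite !E.
  rewrite -/(ip k l.+1 _ _) ip_sum; apply: eq_bigr => p _; apply: eq_bigr => q _.
  by rewrite conjCK IH.
transitivity (\sum_i \sum_i' (\sum_a \sum_b
    Num.conj (u (ix a b) (ix i j)) * u (ix a b) (ix i' j')) * G i i').
  under eq_bigr do rewrite -(pair_bigA _ (fun i b => \sum_(q : 'I_m * 'I_n)
    Num.conj (u (ix _ b) (ix i j)) * u (ix _ q.2) (ix q.1 j') *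
      ((b == q.2)%:R * G i q.1))) /=.
  rewrite exchange_big; apply: eq_bigr => i _.
  under [RHS]eq_bigr do rewrite mulr_suml.
  rewrite [RHS]exchange_big; apply: eq_bigr => a _ /=.
  under [RHS]eq_bigr do rewrite mulr_suml.
  rewrite [RHS]exchange_big; apply: eq_bigr => b _ /=.
  rewrite -(pair_bigA _ (fun i' b' => Num.conj (u (ix a b) (ix i j)) *
    u (ix a b') (ix i' j') * ((b == b')%:R * G i i'))) /=.
  apply: eq_bigr => i' _; rewrite (bigD1 b)//= eqxx mul1r big1 ?addr0// => b' /negPf b'b.
  by rewrite eq_sym b'b mul0r mulr0.
under eq_bigr do under eq_bigr do rewrite unitary_cols//.
rewrite /ip big_words mulr_sumr; apply: eq_bigr => i _.
rewrite (bigD1 i)//= eqxx /= big1 ?addr0// => i' /negPf i'i.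
by rewrite eq_sym i'i mul0r.
Qed.

Lemma hdot_tensor z z' : hdot (tensor u z) (tensor u z') = ip (ce z) (cf z) (tfun z) (tfun z').
Proof.
rewrite {1}tensor_sum hdot_suml big_allpairs_dep; apply: eq_bigr => w _; apply: eq_bigr => v _.
by rewrite hdotZl hdotC hdot_delta tensorE.
Qed.

Lemma tensor_orth z z' : map is_e z = map is_e z' ->
  hdot (tensor u z) (tensor u z') = (z == z')%:R.
Proof.
rewrite hdot_tensor; elim: z z' => [|x z IH] [|x' z'] //=.
  by rewrite /ip /= !big_seq1 /vacuum !eqxx mul1r rmorph1.
case: x x' => [i|j] [i'|j'] //= [/IH E]; rewrite /= ?add0n ?add1n.
  by rewrite ip_tensE E eqseq_cons -natrM mulnb.
by rewrite ip_tensF E eqseq_cons -natrM mulnb.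
Qed.

Lemma tensor_orth_counts z z' : (ce z, cf z) != (ce z', cf z') ->
  hdot (tensor u z) (tensor u z') = 0.
Proof.
move=> zz'; rewrite hdot_tensor /ip big_seq big1// => w; rewrite mem_words => /eqP wz.
rewrite big_seq big1// => v; rewrite mem_words => /eqP vz.
have [->|/tfun_supp[h1 h2]] := eqVneq (tfun z' w v) 0; first by rewrite rmorph0 mulr0.
by rewrite -wz -vz h1 h2 eqxx in zz'.
Qed.

Lemma word_of_inj : injective (@word_of m n).
Proof.
move=> [w v] [w' v']; rewrite /word_of /=; elim: w w' => [|a w IH] [|a' w'] /=.
- by move=> /inj_map -> // ? ? [].
- by case: v.
- by case: v' IH.
- by move=> [-> /IH[-> ->]].
Qed.

Lemma is_e_word_of (s : S) : map is_e (word_of s) = nseq (size s.1) true ++ nseq (size s.2) false.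
Proof.
rewrite /word_of map_cat -!map_comp; congr (_ ++ _).
  by elim: s.1 => //= a w ->.
by elim: s.2 => //= a w ->.
Qed.

(** Tensors with the same pattern of letters are compared by tensor_orth, and
    different bidegrees are orthogonal. The prefixes z1 and z1' give the creation
    operators, the suffix z2 the multiplications on the right. *)
Lemma tensor_family z1 z1' z2 (s t : S) : map is_e z1 = map is_e z1' ->
  hdot (tensor u (z1 ++ word_of s ++ z2)) (tensor u (z1' ++ word_of t ++ z2)) =
  ((z1 == z1') && (s == t))%:R.
Proof.
move=> z11; have c11 (P : pred letter) : P =1 is_e \/ P =1 predC is_e -> count P z1 = count P z1'.
  have E (Q : pred bool) : count (preim is_e Q) z1 = count (preim is_e Q) z1'.
    by have := congr1 (count Q) z11; rewrite !count_map.
  case=> h; rewrite !(eq_count h); first exact: (E id).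
  exact: (E negb).
have [h1 h2] := word_of_counts s; have [h3 h4] := word_of_counts t.
have [[es fs]|st] := eqVneq (size s.1, size s.2) (size t.1, size t.2); last first.
  have -> : (s == t) = false by apply/eqP => h; rewrite h eqxx in st.
  rewrite andbF tensor_orth_counts//.
  have cat_ce (a b : seq letter) : ce (a ++ b) = (ce a + ce b)%N by exact: count_cat.
  have cat_cf (a b : seq letter) : cf (a ++ b) = (cf a + cf b)%N by exact: count_cat.
  have -> : (ce (z1' ++ word_of t ++ z2), cf (z1' ++ word_of t ++ z2)) =
      (ce z1 + (size t.1 + ce z2), cf z1 + (size t.2 + cf z2))%N.
    rewrite (cat_ce z1') (cat_ce (word_of t)) (cat_cf z1') (cat_cf (word_of t)) h3 h4.
    by congr ((_ + _)%N, (_ + _)%N); apply/esym/c11; [left|right].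
  rewrite (cat_ce z1) (cat_ce (word_of s)) (cat_cf z1) (cat_cf (word_of s)) h1 h2.
  apply: contra st => /eqP[].
  by move=> /addnI/addIn -> /addnI/addIn ->.
have ew : map is_e (word_of s) = map is_e (word_of t) by rewrite !is_e_word_of es fs.
have sw : size (word_of s) = size (word_of t).
  by rewrite -(size_map is_e) ew size_map.
rewrite tensor_orth; last first.
  rewrite (map_cat is_e z1) (map_cat is_e z1') (map_cat is_e (word_of s)).
  by rewrite (map_cat is_e (word_of t)) z11 ew.
rewrite (eqseq_cat _ _ (_ : size z1 = size z1')); last by rewrite -(size_map is_e) z11 size_map.
by rewrite (eqseq_cat _ _ sw) eqxx andbT (inj_eq word_of_inj).
Qed.

Lemma tfun_word_of (s : S) w v : tfun (word_of s) w v = ((w, v) == s)%:R.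
Proof.
case: s => w0 v0; rewrite /word_of /=; elim: w0 w v => [|a w0 IH] w v /=.
  elim: v0 w v => [|b v0 IH] w v /=; first by rewrite /vacuum xpair_eqE.
  case: w v => [|a w] [|b' v] //=.
  - by rewrite IH !xpair_eqE /= eqseq_cons -natrM mulnb.
  - rewrite big1// => i _; rewrite big1// => b'' _.
    have -> : (fun w'' => tfun [seq inr i | i <- v0] (i :: w'')) = fun w' v' => 0 * vacuum R w' v'.
      by apply/funext => w'; apply/funext => v'; rewrite IH mul0r.
    by rewrite tensFZ mul0r mulr0.
  - rewrite big1// => i _; rewrite big1// => b'' _.
    have -> : (fun w'' => tfun [seq inr i | i <- v0] (i :: w'')) = fun w' v' => 0 * vacuum R w' v'.
      by apply/funext => w'; apply/funext => v''; rewrite IH mul0r.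
    by rewrite tensFZ mul0r mulr0.
case: w => [|a' w] /=; first by [].
by rewrite IH !xpair_eqE eqseq_cons -natrM mulnb andbA.
Qed.

Lemma tensor_word_of (s : S) : tensor u (word_of s) = delta R s.
Proof.
apply: l2_ext => t; rewrite tensorE tfun_word_of deltaE.
by case: t.
Qed.

Lemma creationP x : [/\ bounded_op (creation u x), isometric (creation u x) &
  forall s, creation u x (delta R s) = tensor u (x :: word_of s)].
Proof.
apply: of_basisP => s t.
have := @tensor_family [:: x] [:: x] [::] s t (erefl _).
by rewrite !cats0 eqxx.
Qed.

Lemma creation_bounded x : bounded_op (creation u x). Proof. by case: (creationP x). Qed.
Lemma creation_isometric x : isometric (creation u x). Proof. by case: (creationP x). Qed.
Lemma creation_delta x s : creation u x (delta R s) = tensor u (x :: word_of s).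
Proof. by case: (creationP x). Qed.

(** This makes the coefficients continuous in g, so that the formula for the
    creation operators on basis vectors holds on the whole Fock space. *)
Lemma tens_letter_fin x w v : exists r : seq (C * S),
  forall g, tens_letter u x g w v = \sum_(t <- r) t.1 * g t.2.1 t.2.2.
Proof.
case: x => [i|j] /=.
  case: w => [|a w]; first by exists [::] => g; rewrite big_nil.
  by exists [:: ((a == i)%:R, (w, v))] => g; rewrite big_seq1.
elim: w j => [|a w IH] j /=.
  case: v => [|b v]; first by exists [::] => g; rewrite big_nil.
  by exists [:: ((b == j)%:R, ([::], v))] => g; rewrite big_seq1.
have /choice[r Hr] := IH.
exists (flatten [seq [seq (Num.conj (u (ix a p.2) (ix p.1 j)) * t.1, (p.1 :: t.2.1, t.2.2)) |
   t <- r p.2] | p <- index_enum ('I_m * 'I_n)%type]) => g.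
rewrite big_flatten big_map /= pair_bigA; apply: eq_bigr => p _.
rewrite big_map Hr mulr_sumr; apply: eq_bigr => t _ /=.
by rewrite mulrA.
Qed.

Lemma creation_coord x (f : fock) (s : S) :
  l2fun (creation u x f) s = tens_letter u x (fun w v => f (w, v)) s.1 s.2.
Proof.
have [r Hr] := tens_letter_fin x s.1 s.2; rewrite Hr.
pose y : fock := \sum_(t <- r) Num.conj t.1 *: delta R t.2.
have yE (g : fock) : hdot g y = \sum_(t <- r) t.1 * l2fun g (t.2.1, t.2.2).
  rewrite hdot_sumr; apply: eq_bigr => t _.
  by rewrite hdotZr conjCK hdot_delta -surjective_pairing.
rewrite -yE -hdot_delta.
have bx := creation_bounded x.
suff -> : y = adjoint (creation u x) (delta R s) by rewrite -adjointP.
apply: l2_ext => t; rewrite -!hdot_delta [RHS]hdotC [LHS]hdotC; congr (Num.conj _).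
rewrite -adjointP// yE creation_delta hdot_delta tensorE /=.
rewrite -/(tfun _) Hr; apply: eq_bigr => q _.
by rewrite deltaE tfun_word_of.
Qed.

Lemma tensor_cons x z : tensor u (x :: z) = creation u x (tensor u z).
Proof.
apply: l2_ext => s; rewrite creation_coord tensorE /= -/(tfun z); congr (tens_letter _ _ _ _ _).
by apply/funext => w; apply/funext => v; rewrite tensorE.
Qed.

Lemma tensor_wev z z' : tensor u (z ++ z') = wev (creation u) z (tensor u z').
Proof. by elim: z => //= x z IH; rewrite tensor_cons IH. Qed.

Lemma creation_rel : rel_rep u (creation u).
Proof.
apply: rel_repP => // [x|i j]; first exact/bounded_lin/creation_bounded.
apply/funext => f; apply: l2_ext => s.
rewrite [LHS]creation_coord.
have cE x : (fun w v => l2fun (creation u x f) (w, v)) =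
    tens_letter u x (fun w v => l2fun f (w, v)).
  by apply/funext => w; apply/funext => v; rewrite creation_coord.
rewrite cE [LHS]tensE_tensF// sumfE l2_sumE; apply: eq_bigr => i' _.
rewrite sumfE l2_sumE; apply: eq_bigr => j' _.
by rewrite fctE l2_scaleE creation_coord cE.
Qed.

Lemma creation_orth x y : is_e x = is_e y ->
  adjoint (creation u x) \o creation u y = if x == y then idfun else 0.
Proof.
move=> xy; have bx := creation_bounded x; have by_ := creation_bounded y.
apply: bounded_eq_basis => [||s].
- by apply: bounded_comp => //; exact: bounded_adjoint.
- by case: eqP => _; [exact: bounded_id|exact: bounded_0].
apply: l2_ext => t; rewrite -hdot_delta adjointPr//.
have := @tensor_family [:: y] [:: x] [::] s t; rewrite /= xy => /(_ (erefl _)).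
rewrite !cats0 eqseq_cons andbT -!creation_delta => ->.
rewrite [y == x]eq_sym; case: eqP => _ /=; last by [].
by rewrite deltaE eq_sym.
Qed.

(** * Multiplication on the right *)

Lemma right_tensorP z : [/\ bounded_op (right_tensor u z), isometric (right_tensor u z) &
  forall s, right_tensor u z (delta R s) = tensor u (word_of s ++ z)].
Proof.
apply: of_basisP => s t.
exact: (@tensor_family [::] [::] z s t (erefl _)).
Qed.

Lemma right_tensor_bounded z : bounded_op (right_tensor u z).
Proof. by case: (right_tensorP z). Qed.

Lemma right_tensor_isometric z : isometric (right_tensor u z).
Proof. by case: (right_tensorP z). Qed.

Lemma right_tensor_delta z s : right_tensor u z (delta R s) = tensor u (word_of s ++ z).
Proof. by case: (right_tensorP z). Qed.

(** A word and its normal form act alike on every vector, in particular on tensor z. *)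
Lemma right_tensorE z z' : right_tensor u z (tensor u z') = tensor u (z' ++ z).
Proof.
have [r [_ Hr]] := normal_form u z'.
have E z0 : tensor u (z' ++ z0) = \sum_(t <- r) t.1 *: tensor u (word_of t.2 ++ z0).
  rewrite tensor_wev (Hr _ _ creation_rel) sumfE; apply: eq_bigr => t _.
  by rewrite tensor_wev.
have lR := bounded_lin (right_tensor_bounded z).
rewrite -{1}[z']cats0 !E (lin_sum lR); apply: eq_bigr => t _.
by rewrite cats0 (linZ lR) tensor_word_of right_tensor_delta.
Qed.

Lemma right_tensor_creation z x :
  right_tensor u z \o creation u x = creation u x \o right_tensor u z.
Proof.
have bz := right_tensor_bounded z; have bx := creation_bounded x.
apply: bounded_eq_basis => [||s]; [exact: bounded_comp..|].
rewrite [LHS](_ : _ = right_tensor u z (creation u x (delta R s)))//.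
rewrite [RHS](_ : _ = creation u x (right_tensor u z (delta R s)))//.
by rewrite creation_delta right_tensorE right_tensor_delta -tensor_cons.
Qed.

End Fock.

(** * Domination by the creation operators *)

Lemma pevE (R : realType) X (H : hilbertType R) (f : X -> H -> H) p x :
  pev f p x = \sum_(t <- p) t.1 *: wev f t.2 x.
Proof. exact: sumfE. Qed.

Section Dominance.
Variables (R : realType) (m n : nat) (u : 'M[R[i]]_(m * n)).
Hypothesis u_unitary : u \is unitarymx.
Local Notation C := R[i].
Local Notation normc := ComplexField.Normc.normc.
Local Notation letter := (letter m n).
Local Notation ix := mxvec_index.
Local Notation coefs := (seq 'I_m -> seq 'I_n -> C).
Local Notation fock := (fock R m n).
Local Notation S := (fock_basis m n).
Local Notation is_e := (@is_e m n).

(** Gram-Schmidt orthogonalisation. *)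
Lemma parseval_frame (H : hilbertType R) (s : seq H) : exists g : seq H,
  forall v, v \in s -> v = \sum_(x <- g) hdot v x *: x.
Proof.
(* the induction needs the expansion of the frame vectors themselves *)
suff [g Hg] : exists g : seq H,
    forall v, v \in s ++ g -> v = \sum_(x <- g) hdot v x *: x.
  by exists g => v vs; apply: Hg; rewrite mem_cat vs.
elim: s => [|v s [g Hg]]; first by exists [::].
pose r := v - \sum_(x <- g) hdot v x *: x.
have rO w : w \in s ++ g -> hdot w r = 0.
  move=> /Hg wE; have E : hdot w v = \sum_(x <- g) hdot w x * hdot x v.
    by rewrite {1}wE hdot_suml; apply: eq_bigr => x _; rewrite hdotZl.
  rewrite /r hdotBr hdot_sumr E -sumrB big1// => x _.
  by rewrite hdotZr -hdotC mulrC subrr.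
have vE : v = r + \sum_(x <- g) hdot v x *: x by rewrite subrK.
have [r0|r0] := eqVneq r 0.
  exists g => w; rewrite inE => /orP[/eqP ->|]; last exact: Hg.
  by rewrite {1}vE r0 add0r.
have rr : rn r != 0 by apply: contra_neq r0; exact: rn_eq0.
pose e := (rn r)^-1%:C%C *: r.
have rv : hdot v r = (rn r ^+ 2)%:C%C.
  rewrite {1}vE hdotDl hdot_rn hdot_suml big_seq big1 ?addr0// => x xg.
  by rewrite hdotZl rO ?mulr0// mem_cat xg orbT.
have eN (a : C) : a *: e = (a * (rn r)^-1%:C%C) *: r by rewrite scalerA.
have hde w : hdot w e = (rn r)^-1%:C%C * hdot w r.
  by rewrite hdotZr; congr (_ * _); rewrite /Num.conj /= oppr0.
exists (e :: g) => w; rewrite inE mem_cat inE big_cons => /orP[/eqP ->|].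
  rewrite {1}vE; congr (_ + _); rewrite eN hde rv mulrAC -rmorphM -rmorphM.
  rewrite (_ : _ * _ = 1) ?scale1r//.
  by field.
rewrite orbA orbC orbA => /orP[|/eqP ->].
  rewrite orbC => wsg; rewrite eN hde rO ?mem_cat// mulr0 mul0r scale0r add0r.
  by apply: Hg; rewrite mem_cat.
have -> : hdot e e = 1.
  rewrite hde hdotZl hdot_rn -!rmorphM (_ : _ * _ = 1)//.
  by field.
rewrite scale1r big_seq big1 ?addr0// => x xg.
by rewrite [hdot e x]hdotC hde rO ?mulr0 ?rmorph0 ?scale0r// mem_cat xg orbT.
Qed.

Lemma parseval (H : hilbertType R) (g : seq H) v :
  v = \sum_(x <- g) hdot v x *: x ->
  rn v ^+ 2 = \sum_(x <- g) normc (hdot v x) ^+ 2.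
Proof.
move=> vE; rewrite rn_hdot {1}vE hdot_suml raddf_sum; apply: eq_bigr => x _.
by rewrite hdotZl [hdot x v]hdotC mul_conj.
Qed.

Section Fixed.
Variables (H : hilbertType R) (f : letter -> H -> H).
Hypothesis sf : star_rep u f.
Let bf := star_bounded sf.

(** Insert \sum_i f(e_i) f(e_i)^* = 1 on the right, and exchange f_j and e_i by
    the relations. *)
Lemma star_cross (a : 'I_m) (j : 'I_n) :
  adjoint (f (inl a)) \o f (inr j) =
  \sum_i \sum_b Num.conj (u (ix a b) (ix i j)) *: (f (inr b) \o adjoint (f (inl i))).
Proof.
have la : linear (adjoint (f (inl a))) by exact/adjoint_linear.
have E i : adjoint (f (inl a)) \o (f (inr j) \o f (inl i)) =
    \sum_b Num.conj (u (ix a b) (ix i j)) *: f (inr b).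
  rewrite (rel_fe (star_rel u_unitary sf)) comp_sumr// (bigD1 a)//=.
  rewrite [X in _ + X]big1 ?addr0 => [|a' /negPf a'a].
    rewrite comp_sumr//; apply: eq_bigr => b _; rewrite comp_Zr//.
    have /(congr1 (fun T => T \o f (inr b))) := star_orth sf (erefl (is_e (inl a))) (y := inl a).
    by rewrite eqxx -compA => ->.
  rewrite comp_sumr// big1// => b _; rewrite comp_Zr//.
  have /(congr1 (fun T => T \o f (inr b))) := star_orth sf (erefl (is_e (inl a))) (y := inl a').
  rewrite -compA (_ : (inl a == inl a' :> letter) = false) => [->|].
    by apply/funext => x; rewrite !fctE /= scaler0.
  by apply/negbTE; apply/eqP => -[aa']; rewrite aa' eqxx in a'a.
transitivity (adjoint (f (inl a)) \o f (inr j) \o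
    (\sum_i (f (inl i) \o adjoint (f (inl i))))).
  by rewrite (star_rep_sumA sf).
rewrite comp_sumr; last by apply: linear_comp => //; exact/bounded_lin/bf.
apply: eq_bigr => i _; have := congr1 (fun T => T \o adjoint (f (inl i))) (E i).
by rewrite comp_suml.
Qed.

Variable g : H.
Local Notation matcoef h s := (hdot h (wev f (word_of s) g)).

(** The recursion that defines tensF is the one of star_cross. *)
Lemma tensF_matcoef w v j (G : coefs) h :
  (forall w' v', size w' = size w -> (size v').+1 = size v ->
     G w' v' = matcoef h ((w', v') : S)) ->
  (0 < size v)%N -> tensF u j G w v = matcoef (f (inr j) h) ((w, v) : S).
Proof.
elim: w j G h => [|a w IH] j G h GE v0 /=.
  case: v v0 GE => // b v _ GE; rewrite GE// /word_of /=.
  have := congr1 (fun T => hdot h (T (wev f (map inr v) g)))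
    (star_orth sf (erefl (is_e (inr j))) (y := inr b)).
  rewrite /= -adjointP// => ->; rewrite [b == j]eq_sym.
  have -> : (inr j == inr b :> letter) = (j == b) by [].
  by case: eqP => _; rewrite ?mul1r// mul0r hdot0r.
have E i b : tensF u b (fun w'' => G (i :: w'')) w v =
    matcoef (f (inr b) (adjoint (f (inl i)) h)) ((w, v) : S).
  apply: IH => // w' v' ww' vv'; rewrite GE /= ?ww'//.
  by rewrite adjointPr.
under eq_bigr do under eq_bigr do rewrite E.
rewrite -[RHS](adjointPr (bf (inl a))).
have /(congr1 (fun T => T h)) /= -> := star_cross a j.
rewrite sumfE hdot_suml; apply: eq_bigr => i _; rewrite sumfE hdot_suml.
by apply: eq_bigr => b _; rewrite hdotZl.
Qed.

(** The creation operators act on families of matrix coefficients truncated at N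
    as f acts on vectors, except that each step spoils the words with too few
    letters of one kind; a and b count these losses. *)
Definition matches N a b (y : fock) (h : H) := forall s : S,
  (a <= size s.1 < N)%N -> (b <= size s.2 < N)%N -> l2fun y s = matcoef h s.

Lemma matches_creation N a b y h x : matches N a b y h ->
  matches N (is_e x + a) (~~ is_e x + b) (creation u x y) (f x h).
Proof.
move=> yh [w v] /= /andP[aw wN] /andP[bv vN]; rewrite creation_coord//=.
case: x aw bv => [i|j] /=; rewrite ?add0n ?add1n => aw bv.
  case: w aw wN => // a' w aw wN /=.
  rewrite (yh (w, v)); last 2 first.
  - by apply/andP; split; [exact: aw|exact: ltnW wN].
  - by apply/andP.
  have := congr1 (fun T => hdot h (T (wev f (word_of ((w, v) : S)) g)))
    (star_orth sf (erefl (is_e (inl i))) (y := inl a')).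
  rewrite /= -adjointP// => ->; rewrite [a' == i]eq_sym.
  have -> : (inl i == inl a' :> letter) = (i == a') by [].
  by case: eqP => _; rewrite ?mul1r// mul0r hdot0r.
apply: tensF_matcoef => [w' v' ww' vv'|]; last exact: leq_ltn_trans bv.
by apply: (yh (w', v')); rewrite /= ?ww' ?aw// -ltnS vv' bv ltnW.
Qed.

Lemma matches_wev N a b y h z : matches N a b y h ->
  matches N (ce z + a) (cf z + b) (wev (creation u) z y) (wev f z h).
Proof.
move=> yh; elim: z => //= x z IH; rewrite /ce /cf /= -!addnA.
exact: matches_creation IH.
Qed.

End Fixed.

Definition words_rng (T : finType) a b : seq (seq T) :=
  flatten [seq words T k | k <- iota a (b - a)].

Lemma mem_words_rng (T : finType) a b w : (w \in words_rng T a b) = (a <= size w < b)%N.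
Proof.
apply/flattenP/idP => [[_ /mapP[k + ->]]|aw].
  rewrite mem_iota mem_words => /andP[ak kb] /eqP ->; rewrite ak /=.
  by move: kb; have [ab|/ltnW/eqP ->] := leqP a b; rewrite ?subnKC// addn0 ltnNge ak.
exists (words T (size w)); last by rewrite mem_words.
apply: map_f; rewrite mem_iota; case/andP: aw => aw wb; rewrite aw subnKC//.
exact: leq_trans (ltnW wb).
Qed.

Lemma words_rng_uniq (T : finType) a b : uniq (words_rng T a b).
Proof.
rewrite /words_rng; have := iota_uniq a (b - a); elim: (iota _ _) => //= k r IH /andP[kr ur].
rewrite cat_uniq words_uniq IH// andbT; apply/hasPn => w /flattenP[_ /mapP[k' k'r ->]].
rewrite mem_words => /eqP wk'; apply/negP; rewrite mem_words wk' => /eqP kk.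
by rewrite -kk k'r in kr.
Qed.

Definition box a b : seq S := [seq (w, v) | w <- words_rng 'I_m a b, v <- words_rng 'I_n a b].

Lemma mem_box a b (s : S) : (s \in box a b) = (a <= size s.1 < b)%N && (a <= size s.2 < b)%N.
Proof.
apply/allpairsP/andP => [[[w v] /= [ws vs ->]]|[ws vs]]; first by rewrite -!mem_words_rng.
by exists s; rewrite !mem_words_rng; split=> //; case: s {ws vs}.
Qed.

Lemma box_uniq a b : uniq (box a b).
Proof.
apply: allpairs_uniq; [exact: words_rng_uniq|exact: words_rng_uniq|].
by move=> [w v] [w' v'] _ _ /= [-> ->].
Qed.

Lemma big_box a b (F : S -> R) (c : R) :
  (forall k l, \sum_(s <- bwords m n k l) F s = c) ->
  \sum_(s <- box a b) F s = ((b - a) ^ 2)%:R * c.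
Proof.
move=> Fc; rewrite big_allpairs_dep big_flatten big_map.
under eq_bigr do under eq_bigr do rewrite big_flatten big_map.
under eq_bigr do rewrite exchange_big /=.
have Fc' k l : \sum_(w <- words 'I_m k) \sum_(v <- words 'I_n l) F (w, v) = c.
  by rewrite -[RHS](Fc k l) big_allpairs_dep.
under eq_bigr do under eq_bigr do rewrite Fc'.
by rewrite !big_const_seq !count_predT !size_iota !iter_addr_0 -mulrnA mulnn mulr_natl.
Qed.

(** A vector h is encoded by the vectors \sum <h, f_s g> delta_s of the Fock
    space, where s ranges over the words of bidegree less than N and g over a
    Parseval frame. As \sum f_s f_s^* = 1 in each bidegree, the encoding multiplies
    squared norms by N^2; up to boundary terms, whose share is O(1 / N), it
    intertwines f and the creation operators. *)
Lemma star_dominated (H : hilbertType R) (f : letter -> H -> H) (I : finType)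
    (p : I -> I -> ncpoly R letter) c : star_rep u f -> 0 <= c ->
  mxbound (fun i j => pev (creation u) (p i j)) c ->
  mxbound (fun i j => pev f (p i j)) c.
Proof.
move=> sf c0 /(mxboundP _ c0) pc; apply/(mxboundP _ c0) => h.
pose y i := \sum_j pev f (p i j) (h j).
pose D := (\max_i \max_j poly_degree (p i j))%N.
have bf := star_bounded sf; have bW s := wev_bounded bf (word_of s).
have degD i j t : t \in p i j -> (ce t.2 <= D)%N /\ (cf t.2 <= D)%N.
  move=> tp; have h1 := allP (poly_degreeP (p i j)) _ tp.
  have h2 : (poly_degree (p i j) <= D)%N.
    apply: leq_trans (leq_bigmax (F := fun j => poly_degree (p i j)) j) _.
    exact: (leq_bigmax (F := fun i => (\max_j poly_degree (p i j))%N) i).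
  by split; apply: leq_trans (count_size _ _) (leq_trans h1 h2).
set X := \sum_j rn (h j) ^+ 2; set Y := \sum_i rn (y i) ^+ 2.
have X0 : 0 <= X by apply: sumr_ge0 => *; exact: sqr_ge0.
(* division by M^2 makes the border of width D negligible for large M *)
suff key M : (0 < M)%N -> (M ^ 2)%:R * Y <= c ^+ 2 * (((D + M) ^ 2)%:R * X).
  rewrite -/X; apply/ler_addgt0Pr => e e0.
  pose B := c ^+ 2 * X * (2 * D%:R + D%:R ^+ 2).
  have B0 : 0 <= B by rewrite !mulr_ge0 ?sqr_ge0 ?addr_ge0 ?mulr_ge0 ?exprn_ge0.
  have [N HN] := invn_small (divr_gt0 e0 (ltr_pwDl ltr01 B0)).
  have := HN N (leqnn _); rewrite ltr_pdivlMr ?ltr_pwDl// => hN.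
  have := key N.+1 isT; rewrite !natrX natrD.
  have M1 : 1 <= N.+1%:R :> R by rewrite ler1n.
  have : N.+1%:R^-1 * N.+1%:R = 1 :> R by rewrite mulVf.
  have D0 : 0 <= D%:R :> R by [].
  move: (N.+1%:R) (N.+1%:R^-1) M1 hN => M q M1 hN qM; rewrite -/Y => hY.
  have M0 : 0 < M by lra.
  have hB : B <= e * M.
    have : q * (1 + B) * M <= e * M by rewrite ler_wpM2r// ltW.
    by rewrite mulrAC qM mul1r; lra.
  have cX : 0 <= c ^+ 2 * X by rewrite mulr_ge0 ?sqr_ge0.
  rewrite -(ler_pM2l (exprn_gt0 2 M0)); apply: le_trans hY _.
  have h3 : c ^+ 2 * X * (2 * D%:R * M + D%:R ^+ 2) <= B * M.
    rewrite /B -[leRHS]mulrA ler_wpM2l//.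
    have : D%:R ^+ 2 <= D%:R ^+ 2 * M :> R by rewrite ler_peMr ?sqr_ge0.
    by lra.
  have h4 : B * M <= e * M * M by rewrite ler_wpM2r// ltW.
  by move: h3 h4; lra.
move=> M0; pose N := (D + M)%N.
have ND : (N - D = M)%N by rewrite /N addKn.
have [g Hg] := parseval_frame (
  [seq adjoint (wev f (word_of s)) (h j) | s <- box 0 N, j <- enum I] ++
  [seq adjoint (wev f (word_of s)) (y i) | s <- box D N, i <- enum I]).
have frame_h s j : s \in box 0 N -> \sum_(x <- g) normc (hdot (h j) (wev f (word_of s) x)) ^+ 2 =
    rn (adjoint (wev f (word_of s)) (h j)) ^+ 2.
  move=> sN; rewrite [RHS](@parseval _ g); last first.
    apply: Hg; rewrite mem_cat; apply/orP; left.
    by apply/allpairsP; exists (s, j); rewrite /= mem_enum.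
  by apply: eq_bigr => x _; rewrite adjointPr.
have frame_y s i : s \in box D N -> \sum_(x <- g) normc (hdot (y i) (wev f (word_of s) x)) ^+ 2 =
    rn (adjoint (wev f (word_of s)) (y i)) ^+ 2.
  move=> sN; rewrite [RHS](@parseval _ g); last first.
    apply: Hg; rewrite mem_cat; apply/orP; right.
    by apply/allpairsP; exists (s, i); rewrite /= mem_enum.
  by apply: eq_bigr => x _; rewrite adjointPr.
pose enc (x : H) j : fock := \sum_(s <- box 0 N) hdot (h j) (wev f (word_of s) x) *: delta R s.
have enc_matches x j : matches f x N 0 0 (enc x j) (h j).
  move=> s sa sb; rewrite /enc (l2_sum_deltaE (fun s => hdot (h j) (wev f (word_of s) x))) ?box_uniq//.
  by rewrite mem_box sa sb.
have enc_norm x j : rn (enc x j) ^+ 2 =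
    \sum_(s <- box 0 N) normc (hdot (h j) (wev f (word_of s) x)) ^+ 2.
  exact: (ortho_rn (@hdot_deltas R S) (fun s => hdot (h j) (wev f (word_of s) x)) (box_uniq 0 N)).
pose out x i : fock := \sum_j pev (creation u) (p i j) (enc x j).
have outE x i s : s \in box D N -> l2fun (out x i) s = hdot (y i) (wev f (word_of s) x).
  rewrite mem_box => /andP[/andP[s1 s2] /andP[s3 s4]].
  rewrite l2_sumE hdot_suml; apply: eq_bigr => j _; rewrite !pevE l2_sumE hdot_suml.
  rewrite big_seq [RHS]big_seq; apply: eq_bigr => t /degD[te tf].
  rewrite l2_scaleE hdotZl; congr (_ * _).
  apply: (matches_wev sf (enc_matches x j)); rewrite addn0.
    by rewrite (leq_trans te s1).
  by rewrite (leq_trans tf s3).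
have bound x : \sum_i \sum_(s <- box D N) normc (hdot (y i) (wev f (word_of s) x)) ^+ 2 <=
    c ^+ 2 * \sum_j \sum_(s <- box 0 N) normc (hdot (h j) (wev f (word_of s) x)) ^+ 2.
  have := pc (enc x); under [X in _ <= _ * X]eq_bigr do rewrite enc_norm.
  apply: le_trans; apply: ler_sum => i _; rewrite -/(out x i).
  apply: le_trans (bessel (@hdot_deltas R S) (out x i) (box_uniq D N)).
  rewrite le_eqVlt; apply/orP; left; apply/eqP; rewrite big_seq [RHS]big_seq.
  by apply: eq_bigr => s sb; rewrite hdot_delta outE.
have := @ler_sum _ _ g predT _ _ (fun x _ => bound x).
rewrite -mulr_sumr exchange_big /=.
have -> : \sum_(x <- g) \sum_j \sum_(s <- box 0 N) normc (hdot (h j) (wev f (word_of s) x)) ^+ 2 =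
    (N ^ 2)%:R * X.
  rewrite exchange_big mulr_sumr; apply: eq_bigr => j _; rewrite exchange_big /=.
  rewrite -[N in RHS]subn0 -(@big_box 0 N (fun s => rn (adjoint (wev f (word_of s)) (h j)) ^+ 2)).
    by rewrite big_seq [RHS]big_seq; apply: eq_bigr => s; exact: frame_h.
  by move=> k l; exact: (star_bwords_norm sf k l (h j)).
congr (_ <= _); rewrite mulr_sumr; apply: eq_bigr => i _; rewrite exchange_big /=.
rewrite -ND -(@big_box D N (fun s => rn (adjoint (wev f (word_of s)) (y i)) ^+ 2)).
  by rewrite big_seq [RHS]big_seq; apply: eq_bigr => s; exact: frame_y.
by move=> k l; exact: (star_bwords_norm sf k l (y i)).
Qed.

End Dominance.

(** * Inductive limits of Hilbert spaces *)

(** A closed linear subspace, bundled so that the type of its elements can be a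
    Hilbert space. *)
Record csub (R : realType) (H : hilbertType R) := CSub {
  csub_set : set H;
  csub0 : csub_set 0;
  csub_lin : forall (a : R[i]) x y, csub_set x -> csub_set y -> csub_set (a *: x + y);
  csub_closed : closure csub_set `<=` csub_set }.

Section ClosedSubspace.
Variables (R : realType) (H : hilbertType R) (V : csub H).
Local Notation C := R[i].

Definition csub_pred : {pred H} := fun x => `[< csub_set V x >].

Lemma csub_submod_closed : submod_closed csub_pred.
Proof.
split; first by rewrite unfold_in; apply/asboolP; exact: csub0.
move=> a x y; rewrite !unfold_in => /asboolP Vx /asboolP Vy.
by apply/asboolP; exact: csub_lin.
Qed.

HB.instance Definition _ :=
  GRing.isSubmodClosed.Build C H csub_pred
    (GRing.submod_closed_semi csub_submod_closed).

Record csub_elt := CSubElt { csub_val : H; _ : csub_val \in csub_pred }.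

HB.instance Definition _ := [isSub for csub_val].
HB.instance Definition _ := [Choice of csub_elt by <:].
HB.instance Definition _ := [SubChoice_isSubLmodule of csub_elt by <:].

Definition csdot (x y : csub_elt) : C := hdot (csub_val x) (csub_val y).

Lemma csdot_addl z : zmod_morphism (csdot^~ z).
Proof. by move=> x y; rewrite /csdot -hdotBl. Qed.

Lemma csdot_addr z : zmod_morphism (csdot z).
Proof. by move=> x y; rewrite /csdot -hdotBr. Qed.

Lemma csdot_scalel z : GRing.scalable_for *%R (csdot^~ z).
Proof. by move=> a x; rewrite /csdot -hdotZl. Qed.

Lemma csdot_scaler z : GRing.scalable_for (Num.Def.conjC \; *%R) (csdot z).
Proof. by move=> a x; rewrite /csdot /= -hdotZr. Qed.

HB.instance Definition _ := isBilinear.Build C csub_elt csub_elt C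
  ( *%R ) (Num.Def.conjC \; *%R) csdot
  csdot_addl csdot_addr csdot_scalel csdot_scaler.

Lemma csdot_herm x y : csdot x y = (-1) ^+ false * Num.conj (csdot y x).
Proof. by rewrite expr0 mul1r /csdot hdotC. Qed.

HB.instance Definition _ := isHermitianSesquilinear.Build C csub_elt false
  Num.Def.conjC csdot csdot_herm.

Lemma csdot_pos x : x != 0 -> 0 < csdot x x.
Proof.
move=> x0; rewrite /csdot hdot_norm exprn_gt0// normr_gt0.
by apply: contra x0 => /eqP h; apply/eqP/val_inj.
Qed.

HB.instance Definition _ := isDotProduct.Build C csub_elt csdot csdot_pos.

HB.instance Definition _ := @Lmodule_isNormed.Build C csub_elt
  (dnorm csdot) (dnorm_triangle csdot) (dnormZ_sqrt csdot) (@dnorm0_eq0 _ _ csdot).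

Lemma csdot_norm x : csdot x x = `|x| ^+ 2.
Proof. exact: esym (dnormK csdot x). Qed.

Lemma csub_norm x : `|x| = `|csub_val x|.
Proof.
apply/eqP; rewrite -(@eqrXn2 _ 2)//; apply/eqP.
by have := csdot_norm x; rewrite /csdot hdot_norm => ->.
Qed.

Lemma csub_complete (F : set_system csub_elt) : ProperFilter F -> cauchy F -> cvg F.
Proof.
move=> FF /cauchyP Fc.
have cv : cvg (csub_val @ F).
  apply: cauchy_cvg; apply/cauchyP => e e0.
  have [x Fx] := Fc e e0; exists (csub_val x).
  apply: (@filterS _ F _ (ball x e)) => // y; rewrite -!ball_normE /=.
  by rewrite csub_norm.
pose l : H := lim (csub_val @ F).
have lV : l \in csub_pred.
  rewrite unfold_in; apply/asboolP/csub_closed => B Bl.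
  have FB : F (csub_val @^-1` B) by exact: cv.
  have [x Bx] := filter_ex FB; exists (csub_val x); split=> //.
  by have := valP x; rewrite unfold_in => /asboolP.
apply/cvg_ex; exists (CSubElt lV); apply/cvgrPdist_lt => e e0.
have /cvgrPdist_lt /(_ e e0) := cv; apply: filterS => x.
by rewrite csub_norm.
Qed.

HB.instance Definition _ := Uniform_isComplete.Build csub_elt csub_complete.

HB.instance Definition _ := isHilbert.Build R csub_elt csdot_norm.

Lemma csub_rn (x : csub_elt) : rn x = rn (csub_val x).
Proof. by rewrite /rn csub_norm. Qed.

End ClosedSubspace.

Section HilbertLimit.
Variables (R : realType) (S : choiceType) (rho : nat -> l2 R S -> l2 R S).
Local Notation C := R[i].
Local Notation H := (l2 R S).
Local Notation M := (l2 R (nat * S)%type).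
Hypotheses (brho : forall s, bounded_op (rho s)) (irho : forall s, isometric (rho s)).

Definition slot (s : nat) : H -> M := of_basis (fun t => delta R ((s, t) : nat * S)).

Lemma slotP s : [/\ bounded_op (slot s), isometric (slot s) &
  forall t, slot s (delta R t) = delta R (s, t)].
Proof. by apply: of_basisP => t t'; rewrite hdot_deltas xpair_eqE eqxx. Qed.

Lemma slot_bounded s : bounded_op (slot s). Proof. by case: (slotP s). Qed.

Lemma slot_orth s r x y : s != r -> hdot (slot s x) (slot r y) = 0.
Proof.
move=> sr; rewrite (adjointP (slot_bounded s)).
suff h : adjoint (slot s) \o slot r = 0.
  by have := congr1 (fun T => T y) h => /= ->; rewrite hdot0r.
have bs := slot_bounded s; have br := slot_bounded r.
apply: bounded_eq_basis; [|exact: bounded_0|].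
  by apply: bounded_comp => //; exact: bounded_adjoint.
move=> t; apply: l2_ext => t'; rewrite -hdot_delta adjointPr//.
have [_ _ ->] := slotP r; have [_ _ ->] := slotP s.
by rewrite hdot_deltas xpair_eqE eq_sym (negPf sr).
Qed.

(** The limit is realised inside a countable sum of copies of H: the s-th slot
    receives the part of H_s orthogonal to the image of H_(s-1). *)
Fixpoint embed (s : nat) : H -> M :=
  if s is r.+1 then
    (embed r \o adjoint (rho r)) + (slot r.+1 \o (idfun - (rho r \o adjoint (rho r))))
  else slot 0.

Lemma embed_bounded s : bounded_op (embed s).
Proof.
elim: s => [|s IH] /=; first exact: slot_bounded.
have ba := bounded_adjoint (brho s).
apply: bounded_D; apply: bounded_comp => //; first exact: slot_bounded.
by apply: bounded_B; [exact: bounded_id|exact: bounded_comp].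
Qed.

Lemma embed_orth s r x y : (s < r)%N -> hdot (embed s x) (slot r y) = 0.
Proof.
elim: s x => [|s IH] x sr; first by rewrite slot_orth// neq_ltn sr.
by rewrite /= !fctE hdotDl /= IH ?slot_orth ?addr0// ?neq_ltn ?sr// ltnW.
Qed.

Lemma embed_isometric s : isometric (embed s).
Proof.
elim: s => [|s IH] x; first by have [_ i _] := slotP 0; exact: i.
rewrite !rnE; congr (_%:C)%C; apply/eqP; rewrite -(@eqrXn2 _ 2)// ?rn_ge0//; apply/eqP.
have -> : embed s.+1 x = embed s (adjoint (rho s) x) +
   slot s.+1 (x - rho s (adjoint (rho s) x)) by [].
rewrite pythagoras ?embed_orth// (isometric_rn IH).
have [_ i _] := slotP s.+1; rewrite (isometric_rn i).
set a := adjoint (rho s) x; set b := x - rho s a.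
have ab : hdot (rho s a) b = 0.
  rewrite /b hdotBr isometric_hdot//; last exact: bounded_lin.
  by rewrite adjointP// subrr.
have := pythagoras ab; rewrite (isometric_rn (irho s)) => <-.
by rewrite /b [rho s a + _]addrC subrK.
Qed.

Lemma embed_compatible s : embed s.+1 \o rho s = embed s.
Proof.
apply/funext => x; rewrite /= !fctE /=.
have -> : adjoint (rho s) (rho s x) = x.
  exact: (congr1 (fun T => T x) (isometric_adjointK (brho s) (irho s))).
by rewrite subrr (lin0 (bounded_lin (slot_bounded _))) addr0.
Qed.

Lemma embed_le s t x : (s <= t)%N -> exists y, embed s x = embed t y.
Proof.
move=> /subnK <-; elim: (t - s)%N => [|k [y ->]]; first by exists x.
by exists (rho (k + s) y); rewrite addSn -[RHS]/((embed _ \o rho _) y) embed_compatible.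
Qed.

Definition embed_union : set M := \bigcup_s range (embed s).

Lemma embed_union_lin a x y : embed_union x -> embed_union y -> embed_union (a *: x + y).
Proof.
move=> [s _ [x' _ <-]] [t _ [y' _ <-]].
have [x1 ->] := embed_le x' (leq_maxl s t); have [y1 ->] := embed_le y' (leq_maxr s t).
by exists (maxn s t) => //; exists (a *: x1 + y1) => //; rewrite (bounded_lin (embed_bounded _)).
Qed.

Lemma limit_space_lin a x y : closure embed_union x -> closure embed_union y ->
  closure embed_union (a *: x + y).
Proof.
move=> /closure_rnP hx /closure_rnP hy; apply/closure_rnP => e e0.
have na := normc_ge0 a; have a1 : 0 < ComplexField.Normc.normc a + 1 by rewrite ltr_wpDl.
have e1 := divr_gt0 e0 a1.
have [x' Ux xx'] := hx _ e1; have [y' Uy yy'] := hy _ e1.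
exists (a *: x' + y'); first exact: embed_union_lin.
rewrite lincombB (le_lt_trans (rnD _ _))// rnZ.
have -> : e = ComplexField.Normc.normc a * (e / (ComplexField.Normc.normc a + 1)) +
    e / (ComplexField.Normc.normc a + 1) by field; rewrite gt_eqF.
by rewrite ler_ltD// ler_wpM2l// ltW.
Qed.

Lemma limit_space0 : closure embed_union 0.
Proof.
apply: subset_closure; exists 0%N => //; exists 0 => //.
exact/lin0/bounded_lin/embed_bounded.
Qed.

Definition limit_space : csub M := CSub limit_space0 limit_space_lin
  (fun x (h : closure (closure embed_union) x) => (@closed_closure _ embed_union) x h).

Lemma embed_in s x : embed s x \in csub_pred limit_space.
Proof.
rewrite unfold_in; apply/asboolP/subset_closure; exists s => //; by exists x.
Qed.

Definition limit_embed s x : csub_elt limit_space := CSubElt (embed_in s x).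

Lemma hilbert_limit_exists : exists (L : hilbertType R) (iota : nat -> H -> L),
  hilbert_limit (H_ := fun=> H) rho iota.
Proof.
exists (csub_elt limit_space), limit_embed.
have li s : linear (limit_embed s).
  by move=> a x y; apply: val_inj; rewrite /= (bounded_lin (embed_bounded s)).
have ii s : isometric (limit_embed s).
  by move=> x; rewrite csub_norm embed_isometric.
split.
- by move=> s; exact: isometric_bounded.
- exact: ii.
- move=> s; apply/funext => x; apply: val_inj => /=.
  exact: (congr1 (fun T => T x) (embed_compatible s)).
apply/seteqP; split=> // x _; apply/closure_rnP => e e0.
have := valP x; rewrite unfold_in => /asboolP /= /closure_rnP /(_ e e0)[_ [s _ [y _ <-]] xy].
exists (limit_embed s y); first by exists s => //; exists y.
by rewrite csub_rn.
Qed.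

End HilbertLimit.

(** * Tail representations *)

Section Intertwiner.
Variables (R : realType) (X : Type) (H K : hilbertType R).
Variables (f : X -> H -> H) (g : X -> K -> K) (J : H -> K).
Hypotheses (bJ : bounded_op J) (iJ : isometric J).
Hypothesis Jfg : forall x, J \o f x = g x \o J.

Lemma intertwine_wev z : J \o wev f z = wev g z \o J.
Proof.
elim: z => //= x z IH; transitivity ((J \o f x) \o wev f z) => //.
by rewrite Jfg; transitivity (g x \o (J \o wev f z)) => //; rewrite IH.
Qed.

Lemma intertwine_pev p : J \o pev f p = pev g p \o J.
Proof.
have lJ := bounded_lin bJ; rewrite /pev comp_sumr// comp_suml; apply: eq_bigr => t _.
by rewrite comp_Zr// comp_Zl intertwine_wev.
Qed.

(** f is equivalent to the restriction of g to the invariant subspace J H. *)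
Lemma intertwine_mxbound (I : finType) (p : I -> I -> ncpoly R X) c : 0 <= c ->
  mxbound (fun i j => pev g (p i j)) c -> mxbound (fun i j => pev f (p i j)) c.
Proof.
move=> c0 /(mxboundP _ c0) h; apply/(mxboundP _ c0) => x.
have := h (fun j => J (x j)); under [X in _ <= _ * X]eq_bigr do rewrite (isometric_rn iJ).
apply: le_trans; apply: ler_sum => i _.
rewrite -(isometric_rn iJ) (lin_sum (bounded_lin bJ)) le_eqVlt; apply/orP; left.
apply/eqP; congr (rn _ ^+ 2); apply: eq_bigr => j _.
exact: (congr1 (fun T => T (x j)) (intertwine_pev (p i j))).
Qed.

End Intertwiner.

Lemma hdot_ext_dense (R : realType) (H : hilbertType R) (D : set H) x y :
  closure D = setT -> (forall z, D z -> hdot x z = hdot y z) -> x = y.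
Proof.
move=> Dd xy; apply/subr0_eq/rn_eq0; set w := x - y.
apply: contrapT => /eqP w0; have wp : 0 < rn w by rewrite lt_neqAle eq_sym w0 rn_ge0.
have := (closure_rnP D w).1; rewrite Dd => /(_ I _ wp)[z Dz wz].
have := hdot_Re_CS w (w - z); rewrite hdotBr [hdot w z]hdotBl xy// subrr subr0 -rn_hdot.
by rewrite leNgt expr2 ltr_pM2l ?wz.
Qed.

Section Tail.
Variables (R : realType) (m n : nat) (u : 'M[R[i]]_(m * n)).
Hypothesis u_unitary : u \is unitarymx.
Local Notation C := R[i].
Local Notation letter := (letter m n).
Local Notation fock := (fock R m n).
Local Notation is_e := (@is_e m n).
Variable tau : nat -> 'I_m * 'I_n.

Lemma tail_space_exists : exists (L : hilbertType R) (iota : nat -> fock -> L),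
  is_tail_space u tau iota.
Proof.
apply: hilbert_limit_exists => s; first exact: right_tensor_bounded.
exact: right_tensor_isometric.
Qed.

Let bc x := creation_bounded u_unitary x.

Definition range_proj (I : finType) (g : I -> letter) : fock -> fock :=
  \sum_i (creation u (g i) \o adjoint (creation u (g i))).

Lemma range_projE (I : finType) (g : I -> letter) y : range_proj g y =
  \sum_i creation u (g i) (adjoint (creation u (g i)) y).
Proof. exact: sumfE. Qed.

Lemma range_proj_bounded (I : finType) (g : I -> letter) : bounded_op (range_proj g).
Proof.
by apply: bounded_sum => i; apply: bounded_comp => //; exact: bounded_adjoint.
Qed.

Lemma range_proj_creation (I : finType) (g : I -> letter) i y :
  (forall i j, is_e (g i) = is_e (g j)) -> injective g ->
  range_proj g (creation u (g i) y) = creation u (g i) y.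
Proof.
move=> ge gi; rewrite range_projE.
have E j : creation u (g j) (adjoint (creation u (g j)) (creation u (g i) y)) =
    if j == i then creation u (g i) y else 0.
  have := congr1 (fun T => T y) (creation_orth u_unitary (ge j i)).
  rewrite (inj_eq gi) /= => ->; case: eqP => [->//|_].
  by rewrite (lin0 (bounded_lin (bc _))).
by rewrite (bigD1 i)//= E eqxx big1 ?addr0// => j /negPf ji; rewrite E ji.
Qed.

(** Used once a letter of the given kind has been pulled to the front: then every
    term lies in the range of the projection. *)
Lemma range_proj_sum (I : finType) (g : I -> letter) (r : seq (C * (letter * seq letter))) v :
  (forall i j, is_e (g i) = is_e (g j)) -> injective g ->
  (forall t, t \in r -> exists i, t.2.1 = g i) ->
  range_proj g ((\sum_(t <- r) t.1 *: (creation u t.2.1 \o wev (creation u) t.2.2)) v) =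
  (\sum_(t <- r) t.1 *: (creation u t.2.1 \o wev (creation u) t.2.2)) v.
Proof.
move=> ge gi rg; have lr := bounded_lin (range_proj_bounded g).
rewrite sumfE (lin_sum lr) big_seq [RHS]big_seq; apply: eq_bigr => t /rg[i ti].
pose y := wev (creation u) t.2.2 v.
have -> : (t.1 *: (creation u t.2.1 \o wev (creation u) t.2.2)) v =
  t.1 *: creation u (g i) y by rewrite -ti.
by rewrite (linZ lr) range_proj_creation.
Qed.

Lemma range_proj_e z : (0 < ce z)%N -> range_proj inl (tensor u z) = tensor u z.
Proof.
move=> z0; rewrite -[z]cats0 tensor_wev//.
rewrite (pull_e_ev (creation_rel u_unitary) z0); apply: range_proj_sum => // [i j [->]//|t tz].
have /allP /(_ _ tz) /and3P[te _ _] := pull_e_count u z0.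
by case: (t.2.1) te => // a _; exists a.
Qed.

Lemma range_proj_f z : (0 < cf z)%N -> range_proj inr (tensor u z) = tensor u z.
Proof.
move=> z0; rewrite -[z]cats0 tensor_wev//.
rewrite (pull_f_ev (creation_rel u_unitary) z0); apply: range_proj_sum => // [i j [->]//|t tz].
have /allP /(_ _ tz) /and3P[te _ _] := pull_f_count u z0.
by case: (t.2.1) te => // a _; exists a.
Qed.

Variables (L : hilbertType R) (iota : nat -> fock -> L).
Hypothesis Liota : is_tail_space u tau iota.
Local Notation lam := (tail_rep u iota).

Let bi s : bounded_op (iota s) := limit_bounded Liota s.
Let li s : linear (iota s) := bounded_lin (bi s).
Let ii s : isometric (iota s).
Proof. by move=> x; exact: (limit_isometric Liota). Qed.

Lemma iota_shift s y : iota s y = iota s.+1 (tail_shift u tau s y).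
Proof. by have := congr1 (fun T => T y) (limit_compatible Liota s). Qed.

Lemma shift_creation s x y :
  tail_shift u tau s (creation u x y) = creation u x (tail_shift u tau s y).
Proof. exact: (congr1 (fun T => T y) (right_tensor_creation u_unitary _ x)). Qed.

(** This allows vectors from different stages of the limit to be compared at a
    common later stage. *)
Lemma iota_raise s t y : (s <= t)%N -> exists y', iota s y = iota t y' /\
  forall x, iota s (creation u x y) = iota t (creation u x y').
Proof.
move=> /subnK <-; elim: (t - s)%N => [|k [y' [-> Hy']]]; first by exists y.
exists (tail_shift u tau (k + s) y'); rewrite addSn -iota_shift; split=> // x.
by rewrite Hy' iota_shift shift_creation.
Qed.


(** The operators prescribed on the stages are compatible, and the stages are dense. *)
Lemma tail_repP x : bounded_op (lam x) /\ forall s, lam x \o iota s = iota s \o creation u x.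
Proof.
pose G (a b : L) := exists s y, a = iota s y /\ b = iota s (creation u x y).
have Glin a v w v' w' : G v w -> G v' w' -> G (a *: v + v') (a *: w + w').
  move=> [s [y [-> ->]]] [t [y' [-> ->]]].
  have [y1 [-> Hy1]] := iota_raise y (leq_maxl s t).
  have [y2 [-> Hy2]] := iota_raise y' (leq_maxr s t).
  exists (maxn s t), (a *: y1 + y2).
  by rewrite (bounded_lin (bc x)) !li Hy1 Hy2.
have Gc v w : G v w -> rn w <= 1 * rn v.
  move=> [s [y [-> ->]]]; rewrite mul1r !(isometric_rn (@ii s)).
  by rewrite (isometric_rn (creation_isometric u_unitary x)).
have Gdense : closure [set v | exists w, G v w] = setT.
  rewrite -subTset -(limit_dense Liota); apply: closure_subset => _ [s _ [y _ <-]].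
  by exists (iota s (creation u x y)), s, y.
have [T [bT _ TG]] := extend_graph ler01 Glin Gc Gdense.
rewrite /tail_rep; case: xgetP => [T' _ //|/(_ T)]; case; split=> // s.
by apply/funext => y; apply: TG; exists s, y.
Qed.

Lemma tail_bounded x : bounded_op (lam x). Proof. exact: (tail_repP x).1. Qed.

Lemma tail_iota x s y : lam x (iota s y) = iota s (creation u x y).
Proof. by have := congr1 (fun T => T y) ((tail_repP x).2 s). Qed.

Lemma tail_isometric x : isometric (lam x).
Proof.
apply: (isometric_dense (tail_bounded x) (limit_dense Liota)) => _ [s _ [y _ <-]].
rewrite tail_iota !(isometric_rn (@ii s)).
exact: (isometric_rn (creation_isometric u_unitary x)).
Qed.

Lemma tail_orth x y : is_e x = is_e y ->
  adjoint (lam x) \o lam y = if x == y then idfun else 0.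
Proof.
move=> xy; have bx := tail_bounded x; have by_ := tail_bounded y.
apply: (bounded_eq_dense _ _ (limit_dense Liota)).
- by apply: bounded_comp => //; exact: bounded_adjoint.
- by case: eqP => _; [exact: bounded_id|exact: bounded_0].
move=> _ [s _ [v _ <-]]; apply: (hdot_ext_dense (limit_dense Liota)) => _ [t _ [w _ <-]].
have [v' [-> _]] := iota_raise v (leq_maxl s t).
have [w' [-> _]] := iota_raise w (leq_maxr s t).
rewrite /= adjointPr// !tail_iota (isometric_hdot (@li _) (@ii _)).
rewrite -adjointPr//; have /= -> := congr1 (fun T => T v') (creation_orth u_unitary xy).
by case: eqP => _ /=; rewrite ?hdot0l// (isometric_hdot (@li _) (@ii _)).
Qed.

(** A vector of stage s is seen at stage s + 1, where its tensors have received a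
    letter of the given kind on the right; such tensors lie in the span of the
    ranges, as the letter can be pulled to the front. *)
Lemma tail_sum (I : finType) (g : I -> letter) :
  (forall i j, is_e (g i) = is_e (g j)) -> injective g ->
  (forall s y, range_proj g (tail_shift u tau s y) = tail_shift u tau s y) ->
  \sum_i (lam (g i) \o adjoint (lam (g i))) = idfun.
Proof.
move=> ge gi cover.
have bl i : bounded_op (lam (g i) \o adjoint (lam (g i))).
  by apply: bounded_comp; [|apply: bounded_adjoint]; exact: tail_bounded.
apply: (bounded_eq_dense (bounded_sum _ bl) (bounded_id _) (limit_dense Liota)).
move=> _ [s _ [v _ <-]]; rewrite sumfE iota_shift -[X in _ = idfun (iota s.+1 X)]cover.
rewrite -{1}cover range_projE (lin_sum (@li _)) /=.
under [LHS]eq_bigr do rewrite (lin_sum (adjoint_linear (tail_bounded _)))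
  (lin_sum (bounded_lin (tail_bounded _))).
apply: eq_bigr => i _; rewrite (bigD1 i)//= [X in _ + X]big1 ?addr0 => [|j /negPf ji].
  rewrite -!tail_iota; congr (lam (g i) _).
  have /(congr1 (fun T => T (iota s.+1 (adjoint (creation u (g i)) (tail_shift u tau s v))))) :=
    tail_orth (erefl (is_e (g i))).
  by rewrite eqxx.
rewrite -!tail_iota.
have /(congr1 (fun T => T (iota s.+1 (adjoint (creation u (g j)) (tail_shift u tau s v))))) :=
    tail_orth (ge i j).
rewrite (inj_eq gi) eq_sym ji /= => ->.
exact: (lin0 (bounded_lin (tail_bounded _))).
Qed.

Lemma shift_cover (I : finType) (g : I -> letter) s :
  (forall y, range_proj g (tail_shift u tau s (delta R y)) = tail_shift u tau s (delta R y)) ->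
  forall y, range_proj g (tail_shift u tau s y) = tail_shift u tau s y.
Proof.
move=> h y; have br := right_tensor_bounded u_unitary [:: inl (tau s).1; inr (tau s).2].
have bg := range_proj_bounded g.
have E : range_proj g \o tail_shift u tau s = tail_shift u tau s.
  by apply: bounded_eq_basis => //; exact: bounded_comp.
exact: (congr1 (fun T => T y) E).
Qed.

Lemma tail_star_rep : star_rep u lam.
Proof.
split.
- by move=> i; exact: tail_bounded.
- by move=> j; exact: tail_bounded.
- move=> i j; apply: (bounded_eq_dense _ _ (limit_dense Liota)).
  + by apply: bounded_comp; exact: tail_bounded.
  + apply: bounded_sum => i'; apply: bounded_sum => j'; apply: bounded_Z.
    by apply: bounded_comp; exact: tail_bounded.
  move=> _ [s _ [v _ <-]].
  transitivity (iota s ((creation u (inl i) \o creation u (inr j)) v)).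
    by rewrite /= !tail_iota.
  rewrite (rel_ef (creation_rel u_unitary)) !sumfE (lin_sum (@li _)).
  apply: eq_bigr => i' _; rewrite !sumfE (lin_sum (@li _)).
  by apply: eq_bigr => j' _; rewrite !fctE /= (linZ (@li _)) !tail_iota.
- by move=> i; exact: tail_isometric.
- by move=> j; exact: tail_isometric.
- apply: (@tail_sum _ inl) => // [i j [->]//|s]; apply: shift_cover => y.
  rewrite /tail_shift right_tensor_delta//; apply: range_proj_e.
  by rewrite /ce count_cat /= addnC.
- apply: (@tail_sum _ inr) => // [i j [->]//|s]; apply: shift_cover => y.
  rewrite /tail_shift right_tensor_delta//; apply: range_proj_f.
  by rewrite /cf count_cat /= addnC.
Qed.

(** The first copy of the Fock space inside the limit carries the left regular
    representation, which is therefore dominated by the tail representation. *)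
Lemma tail_dominates (I : finType) (p : I -> I -> ncpoly R letter) c : 0 <= c ->
  mxbound (fun i j => pev lam (p i j)) c ->
  mxbound (fun i j => pev (creation u) (p i j)) c.
Proof.
apply: (intertwine_mxbound (bi 0) (@ii 0%N)) => x.
exact: esym ((tail_repP x).2 0%N).
Qed.

End Tail.

(** * Dominating representations *)

Lemma sum_pair (V : nmodType) (I J : finType) (F : I * J -> V) :
  \sum_b F b = \sum_i \sum_j F (i, j).
Proof. by rewrite pair_bigA; apply: eq_bigr => -[]. Qed.

Section Envelope.
Variables (R : realType) (m n : nat) (u : 'M[R[i]]_(m * n)).
Hypothesis u_unitary : u \is unitarymx.
Local Notation letter := (letter m n).
Implicit Types (H K : hilbertType R) (I J : finType).

(** Rectangular matrices are made square by padding with zeros, since domination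
    speaks of square matrices only. *)
Definition corner (V : nmodType) I J (p : I -> J -> V) (a b : I + J) : V :=
  match a, b with inl i, inr j => p i j | _, _ => 0 end.

Lemma mxbound_corner I J H (X : I -> J -> H -> H) c : 0 <= c ->
  mxbound (corner X) c <-> mxbound X c.
Proof.
move=> c0.
have E (x : I + J -> H) : \sum_a rn (\sum_b corner X a b (x b)) ^+ 2 =
    \sum_i rn (\sum_j X i j (x (inr j))) ^+ 2.
  rewrite big_sumType /= [X in _ + X]big1 ?addr0 => [|j _].
    apply: eq_bigr => i _; rewrite big_sumType /= [X in X + _]big1 ?add0r//.
  by rewrite big1 ?rn0 ?expr0n// => -[a|b].
split=> /(mxboundP _ c0) h; apply/(mxboundP _ c0) => x.
  have := h (fun a => if a is inr j then x j else 0); rewrite E big_sumType /=.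
  by rewrite [X in _ * (X + _)]big1 ?add0r// => i _; rewrite rn0 expr0n.
rewrite E; apply: le_trans (h (fun j => x (inr j))) _.
rewrite ler_wpM2l ?sqr_ge0// big_sumType /= lerDr sumr_ge0// => i _.
exact: sqr_ge0.
Qed.

Definition pcorner I J (p : I -> J -> ncpoly R letter) (a b : I + J) : ncpoly R letter :=
  match a, b with inl i, inr j => p i j | _, _ => [::] end.

Lemma pev_corner I J (p : I -> J -> ncpoly R letter) H (f : letter -> H -> H) :
  (fun a b => pev f (pcorner p a b)) = corner (fun i j => pev f (p i j)).
Proof.
by apply/funext => -[i|j]; apply/funext => -[i'|j'] //=; rewrite /pev big_nil.
Qed.

Lemma mxbound_enum I H (X : I -> I -> H -> H) c : 0 <= c ->
  mxbound (fun i j : 'I_#|I| => X (enum_val i) (enum_val j)) c <-> mxbound X c.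
Proof.
have E (V : nmodType) (F : I -> V) : \sum_i F i = \sum_(i < #|I|) F (enum_val i).
  by rewrite (reindex _ (onW_bij _ (@enum_val_bij I))); apply: eq_bigl.
move=> c0; split=> /(mxboundP _ c0) h; apply/(mxboundP _ c0) => x.
  have := h (fun j => x (enum_val j)); rewrite !E.
  by congr (_ <= _); apply: eq_bigr => i _; congr (rn _ ^+ 2); rewrite E.
have := h (fun j => x (enum_rank j)); rewrite !E.
congr (_ <= _ * _).
  apply: eq_bigr => i _; congr (rn _ ^+ 2); rewrite E.
  by apply: eq_bigr => j _; rewrite enum_valK.
by apply: eq_bigr => j _; rewrite enum_valK.
Qed.

(** For a *-representation the converse implication holds too, by star_dominated. *)
Definition dominating H (f : letter -> H -> H) : Prop :=
  forall I (p : I -> I -> ncpoly R letter) c, 0 <= c ->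
  mxbound (fun i j => pev f (p i j)) c ->
  mxbound (fun i j => pev (creation u) (p i j)) c.

Section Reduction.
Variables (I : finType) (p : I -> I -> ncpoly R (bool * letter)).

Let N := (\max_i \max_j poly_degree (p i j))%N.
Let ws := bwords m n N N.

Definition reduced (i : I) (b : I * 'I_(size ws)) : ncpoly R letter :=
  reduce_poly u (p i b.1) (word_of (tnth (in_tuple ws) b.2)).

Lemma reduced_ev H (f : letter -> H -> H) : star_rep u f -> forall i b,
  pev (srep f) (p i b.1) \o wev f (word_of (tnth (in_tuple ws) b.2)) = pev f (reduced i b).
Proof.
move=> sf i [j k]; apply: reduce_poly_ev => //=.
have : tnth (in_tuple ws) k \in ws by exact: mem_tnth.
rewrite mem_bwords => /andP[/eqP e1 /eqP e2].
have [-> ->] := word_of_counts (tnth (in_tuple ws) k); rewrite e1 e2.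
apply: sub_all (poly_degreeP (p i j)) => t h; rewrite andbb (leq_trans h)//.
apply: leq_trans (leq_bigmax (F := fun j => poly_degree (p i j)) j) _.
exact: (leq_bigmax (F := fun i => (\max_j poly_degree (p i j))%N) i).
Qed.

(** The row of all words of bidegree (N, N) is unitary, so that multiplication by
    it preserves norms while it removes the adjoints. *)
Lemma reduced_bound H (f : letter -> H -> H) c : star_rep u f -> 0 <= c ->
  mxbound (fun i j => pev (srep f) (p i j)) c <->
  mxbound (fun i b => pev f (reduced i b)) c.
Proof.
move=> sf c0; have bf := star_bounded sf.
have lp q : linear (pev (srep f) q) by exact/bounded_lin/pev_bounded/srep_bounded.
pose W k := wev f (word_of (tnth (in_tuple ws) k)).
have E i (y : I * 'I_(size ws) -> H) : \sum_b pev f (reduced i b) (y b) =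
    \sum_j pev (srep f) (p i j) (\sum_k W k (y (j, k))).
  rewrite sum_pair; apply: eq_bigr => j _; rewrite (lin_sum (lp _)); apply: eq_bigr => k _.
  by rewrite -(reduced_ev sf).
have sW : \sum_k (W k \o adjoint (W k)) = idfun.
  by rewrite -(star_sum_bwords sf N N) -/ws (big_tnth _ _ ws).
have bW k : bounded_op (W k) by exact: wev_bounded.
split=> /(mxboundP _ c0) h; apply/(mxboundP _ c0) => y.
  under eq_bigr do rewrite E.
  apply: le_trans (h _) _; rewrite ler_wpM2l ?sqr_ge0// sum_pair; apply: ler_sum => j _.
  exact: (cuntz_row_contr bW sW).
have := h (fun b => adjoint (W b.2) (y b.1)); under eq_bigr do rewrite E.
rewrite sum_pair /=; under [X in _ <= _ * X]eq_bigr do rewrite (cuntz_norm bW sW).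
congr (_ <= _); apply: eq_bigr => i _; congr (rn _ ^+ 2); apply: eq_bigr => j _.
congr (pev _ _ _); have := congr1 (fun T => T (y j)) sW.
by rewrite sumfE.
Qed.

End Reduction.

(** After removal of the adjoints on both sides, the comparison goes through the
    creation operators. *)
Lemma dominating_universal K H (f : letter -> K -> K) (g : letter -> H -> H) I
    (p : I -> I -> ncpoly R (bool * letter)) c :
  star_rep u f -> dominating f -> star_rep u g -> 0 <= c ->
  mxbound (fun i j => pev (srep f) (p i j)) c ->
  mxbound (fun i j => pev (srep g) (p i j)) c.
Proof.
move=> sf df sg c0 /(reduced_bound p sf c0) h; apply/(reduced_bound p sg c0).
apply/(mxbound_corner _ c0); rewrite -pev_corner; apply: (star_dominated u_unitary sg c0).
by apply: (df _ _ _ c0); rewrite pev_corner; apply/(mxbound_corner _ c0).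
Qed.

Section Extension.
Variables (K H : hilbertType R) (f : letter -> K -> K) (g : letter -> H -> H).
Hypotheses (sf : star_rep u f) (df : dominating f) (sg : star_rep u g).
Let bf := star_bounded sf.
Let bg := star_bounded sg.
Local Notation G := (poly_graph (srep f) (srep g)).

Lemma extension_graph : contr_graph G.
Proof.
apply: poly_graph_contr; [exact: srep_bounded|exact: srep_bounded|].
by move=> I p c c0; exact: dominating_universal.
Qed.

Lemma extension_star_hom : star_hom (cstar_gen (range f)) (graph_ext G).
Proof.
apply: graph_ext_star; first exact: extension_graph.
  exact: poly_graph_adjoint.
by apply: cstar_gen_dom; [exact: bf|exact: bg|exact: extension_graph].
Qed.

Lemma extension_gen x : graph_ext G (f x) = g x.
Proof.
apply: (graph_extE extension_graph); apply: sub_graph_closure; first exact: extension_graph.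
by exists [:: (1, [:: (false, x)])]; rewrite !pev_word.
Qed.

End Extension.

Lemma poly_graph_flip X H K (f : X -> H -> H) (g : X -> K -> K) T S :
  graph_closure (poly_graph f g) T S -> graph_closure (poly_graph g f) S T.
Proof.
move=> [bT bS h]; split=> // e e0; have [T' [S' [[p [-> ->]] h1 h2]]] := h e e0.
by exists (pev g p), (pev f p); split=> //; exists p.
Qed.

(** The reversed graph is single-valued too, by the same argument. *)
Lemma extension_inj K H (f : letter -> K -> K) (g : letter -> H -> H) :
  star_rep u f -> dominating f -> star_rep u g -> dominating g ->
  set_inj (cstar_gen (range f)) (graph_ext (poly_graph (srep f) (srep g))).
Proof.
move=> sf df sg dg T T' /set_mem OT /set_mem OT' TT'.
have dom : cstar_gen (range f) `<=` graph_dom (poly_graph (srep f) (srep g)).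
  by apply: cstar_gen_dom; [exact: (star_bounded sf)|exact: (star_bounded sg)|exact: extension_graph].
have gT := poly_graph_flip (graph_extP (dom _ OT)).
have gT' := poly_graph_flip (graph_extP (dom _ OT')); rewrite -TT' in gT'.
exact: (graph_fun (extension_graph sg dg sf) gT gT').
Qed.

(** A *-homomorphism is completely contractive. *)
Lemma hom_dominating K (L : hilbertType R) (f : letter -> K -> K) (g : letter -> L -> L) s :
  star_rep u f -> star_rep u g -> dominating g ->
  star_hom (cstar_gen (range f)) s -> (forall x, s (f x) = g x) -> dominating f.
Proof.
move=> sf sg dg hs sfg I p c c0 h; apply: dg => //.
have bf := star_bounded sf.
have cO : cstar_algebra (cstar_gen (range f)).
  by apply: cstar_gen_cstar => _ [x _ <-]; exact: bf.
have opO := cstar_operator_algebra cO.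
have Of x : cstar_gen (range f) (f x) by apply: gen_cstar; exists x.
have Ow z : cstar_gen (range f) (wev f z) by exact: (opalg_wev z opO Of).
have sw z : s (wev f z) = wev g z by exact: star_hom_wev.
have sp q : s (pev f q) = pev g q.
  rewrite /pev (hom_sum cO hs) => [|t]; last by apply: (opalg_Z opO).
  by apply: eq_bigr => t _; rewrite (homZ cO hs)// sw.
have := star_hom_mxcontr cO hs c0 (fun i j => opalg_pev (p i j) opO Of) h.
by congr (mxbound _ c); apply/funext => i; apply/funext => j; rewrite sp.
Qed.

Lemma exists_dominating : (0 < m)%N -> (0 < n)%N ->
  exists (L : hilbertType R) (g : letter -> L -> L), star_rep u g /\ dominating g.
Proof.
move=> m0 n0; pose tau (_ : nat) := (Ordinal m0, Ordinal n0).
have [L [iota Liota]] := tail_space_exists u_unitary tau.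
exists L, (tail_rep u iota); split; first exact: tail_star_rep Liota.
by move=> I p c c0; exact: (tail_dominates u_unitary Liota c0).
Qed.

(** * The C*-envelope *)

(** Here l is any family with the same matrix norms as the creation operators,
    so that the left regular representation of a semigroup is included. *)
Section TheEnvelope.
Variables (F K : hilbertType R) (l : letter -> F -> F) (f : letter -> K -> K).
Hypotheses (bl : forall x, bounded_op (l x)) (sf : star_rep u f) (df : dominating f).
Hypothesis lreg : forall I (p : I -> I -> ncpoly R letter) c, 0 <= c ->
  mxbound (fun i j => pev l (p i j)) c <->
  mxbound (fun i j => pev (creation u) (p i j)) c.
Let bf := star_bounded sf.
Local Notation A := (opalg_gen (range l)).
Local Notation O := (cstar_gen (range f)).
Local Notation G := (poly_graph l f).
Local Notation phi := (graph_ext G).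

Let cG : contr_graph G.
Proof.
apply: poly_graph_contr => // I p c c0 /(lreg _ c0).
exact: star_dominated.
Qed.

Let cG' : contr_graph (poly_graph f l).
Proof.
apply: poly_graph_contr => // I p c c0 h; apply/(lreg _ c0).
exact: df.
Qed.

Let AG : A `<=` graph_dom G.
Proof.
apply: opalg_gen_dom => // I p c c0 /(lreg _ c0).
exact: star_dominated.
Qed.

Let phi_closure T : A T -> graph_closure G T (phi T).
Proof. by move=> AT; exact/graph_extP/AG. Qed.

Lemma envelope_phi_pev p : phi (pev l p) = pev f p.
Proof. by apply: (graph_extE cG); apply: sub_graph_closure => //; exists p. Qed.

Lemma envelope_phi_gen x : phi (l x) = f x.
Proof. by have := envelope_phi_pev [:: (1, [:: x])]; rewrite !pev_word. Qed.

Let opA : operator_algebra A.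
Proof. by apply: opalg_gen_opalg => _ [x _ <-]. Qed.

Let cO : cstar_algebra O.
Proof. by apply: cstar_gen_cstar => _ [x _ <-]. Qed.

Let Al x : A (l x). Proof. by apply: gen_opalg; exists x. Qed.
Let Of x : O (f x). Proof. by apply: gen_cstar; exists x. Qed.

(** Contractivity holds in both directions. *)
Lemma envelope_phi_isometric : completely_isometric A phi.
Proof.
move=> k T AT; have gT i j := phi_closure (AT i j).
have bT i j : bounded_op (T i j) by exact: opalg_bounded opA _ (AT i j).
have bS i j : bounded_op (map_mx phi T i j).
  by rewrite mxE; exact: graph_bddr (graph_closure_contr cG) _ _ (gT i j).
have [T0 Tb Tle] := mx_opnormP bT; have [S0 Sb Sle] := mx_opnormP bS.
have SE : (fun i j => map_mx phi T i j) = (fun i j => phi (T i j)).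
  by apply/funext => i; apply/funext => j; rewrite mxE.
rewrite SE in Sb Sle; apply/eqP; rewrite eq_le; apply/andP; split.
  by apply/(Sle _ T0); apply: (graph_contr (graph_closure_contr cG)) Tb.
apply/(Tle _ S0); apply: (graph_contr (graph_closure_contr cG')) Sb => // i j.
exact: poly_graph_flip.
Qed.

Lemma envelope_phi_generates : O = cstar_gen (phi @` A).
Proof.
have phiO : phi @` A `<=` O.
  move=> _ [T AT <-]; have [bT bS h] := phi_closure AT.
  apply: (opalg_closed (cstar_operator_algebra cO)) => // e e0.
  have [_ [_ [[p [-> ->]] _ h2]]] := h e e0; exists (pev f p) => //.
  exact: opalg_pev (cstar_operator_algebra cO) Of.
apply/seteqP; split.
  apply: smallest_sub => [|_ [x _ <-]].
    by apply: cstar_gen_cstar => T /phiO; exact/opalg_bounded/cstar_operator_algebra.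
  by rewrite -envelope_phi_gen; apply: gen_cstar; exists (l x).
by apply: smallest_sub.
Qed.

(** Let T belong to J, and let p be a *-polynomial near T. Modulo J, p is small.
    A unitary row of words turns p into a row of elements of A, whose norm is the
    same in the quotient; so p is small, and so is T. *)
Lemma envelope_minimal (J : set (K -> K)) : closed_ideal O J ->
  (forall k (T : 'M[F -> F]_k), (forall i j, A (T i j)) ->
       mx_quotient_norm J (map_mx phi T) = mx_opnorm T) ->
  J = [set 0].
Proof.
move=> iJ normJ; apply/seteqP; split=> [T JT|_ ->]; last exact: (ideal0 iJ).
have opO := cstar_operator_algebra cO.
have OT : O T by exact: ideal_sub iJ _ JT.
apply: obound_zero => e e0; have e2 : 0 < e / 2 by rewrite divr_gt0.
have e20 := ltW e2.
have [S' [_ _ /(_ _ e2)[_ [_ [[p [-> _]] Tp _]]]]] :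
    graph_dom (poly_graph (srep f) (srep f)) T.
  by apply: cstar_gen_dom OT => //; exact: extension_graph.
suff : obound (pev (srep f) p) (e / 2).
  by move=> hp; rewrite [e]splitr; exact: obound_split hp Tp.
pose P (_ _ : 'I_1) := p; pose r := reduced (p := P); pose N := (\max_i \max_j poly_degree (P i j))%N.
pose W k := wev f (word_of (tnth (in_tuple (bwords m n N N)) k)).
have bW k : bounded_op (W k) by exact: wev_bounded.
have OW k : O (W k) by exact: (opalg_wev _ opO Of).
have sW : \sum_k (W k \o adjoint (W k)) = idfun.
  by rewrite -(star_sum_bwords sf N N) (big_tnth _ _ (bwords m n N N)).
pose Q := ('I_1 + 'I_1 * 'I_(size (bwords m n N N)))%type.
pose q (i j : 'I_#|{: Q}|) := pcorner r (enum_val i) (enum_val j).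
pose M := \matrix_(i, j) pev l (q i j).
have AM i j : A (M i j) by rewrite mxE; exact: opalg_pev opA Al.
(* Y is the row of the - T W_k, all in J; M + Y is the row of the (p - T) W_k *)
pose Y := \matrix_(i, j) corner (fun (_ : 'I_1) b => - (T \o W b.2))
   (enum_val i : Q) (enum_val j : Q) : 'M[K -> K]_#|{: Q}|.
have JY i j : J (Y i j).
  rewrite mxE; case: (enum_val i) => [a|a]; case: (enum_val j) => [b|b] /=; try exact: (ideal0 iJ).
  rewrite -[- _]addr0 -scaleN1r; apply: (ideal_linear iJ); last exact: (ideal0 iJ).
  exact: (ideal_mulr iJ).
have phiM i j : map_mx phi M i j = pev f (q i j) by rewrite !mxE envelope_phi_pev.
have bM i j : bounded_op (map_mx phi M i j).
  by rewrite phiM; apply: pev_bounded.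
have bMY i j : bounded_op ((map_mx phi M + Y) i j).
  by rewrite mxE; apply: bounded_D => //; apply: (opalg_bounded opO); exact: (ideal_sub iJ).
have MYe : mx_opnorm (map_mx phi M + Y) <= e / 2.
  have [_ _ /(_ _ e20) le] := mx_opnormP bMY; apply/le.
  pose X (_ : 'I_1) (b : 'I_1 * 'I_(size (bwords m n N N))) := (pev (srep f) p - T) \o W b.2.
  have -> : (fun i j => (map_mx phi M + Y) i j) =
      fun i j => corner X (enum_val i : Q) (enum_val j : Q).
    apply/funext => i; apply/funext => j; rewrite mxE phiM mxE /q.
    case: (enum_val i) => [a|a]; case: (enum_val j) => [b|b] /=; rewrite ?addr0 /pev ?big_nil//.
    by rewrite -/(pev f (r a b)) -(reduced_ev sf a b).
  apply/(mxbound_enum _ e20)/(mxbound_corner _ e20)/(mxboundP _ e20) => y.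
  rewrite big_ord1 !sum_pair !big_ord1.
  have bpT : bounded_op (pev (srep f) p - T).
    apply: bounded_B; last exact: opalg_bounded opO _ OT.
    by apply: pev_bounded; exact: srep_bounded.
  rewrite -(lin_sum (bounded_lin bpT)).
  have h1 := obound_distC Tp (\sum_k W k (y (ord0, k))).
  rewrite rn_le_sq// in h1; apply: le_trans h1 _; rewrite ler_wpM2l ?sqr_ge0//.
  exact: (cuntz_row_contr bW sW).
have Me : mx_opnorm M <= e / 2.
  rewrite -(normJ _ _ AM); apply: le_trans MYe; rewrite /mx_quotient_norm.
  apply: ge_inf; last by exists Y.
  exists 0 => _ [Z JZ <-].
  have bMZ i j : bounded_op ((map_mx phi M + Z) i j).
    by rewrite mxE; apply: bounded_D => //; apply: (opalg_bounded opO); exact: (ideal_sub iJ).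
  by have [] := mx_opnormP bMZ.
have {Me} : mx_opnorm (map_mx phi M) <= e / 2 by rewrite envelope_phi_isometric.
have [_ _ /(_ _ e20) le /le] := mx_opnormP bM.
have -> : (fun i j => map_mx phi M i j) = (fun i j => pev f (pcorner r (enum_val i) (enum_val j))).
  by apply/funext => i; apply/funext => j; rewrite phiM.
move=> /(mxbound_enum (fun a b => pev f (pcorner r a b)) e20).
rewrite pev_corner => /(mxbound_corner _ e20)/(reduced_bound P sf e20)/(mxboundP _ e20) h x.
by have := h (fun=> x); rewrite !big_ord1 -rn_le_sq.
Qed.

Lemma is_envelope : is_cstar_envelope A O phi.
Proof.
split.
- exact: graph_ext_hom.
- exact: envelope_phi_isometric.
- exact: envelope_phi_generates.
- exact: envelope_minimal.
Qed.

End TheEnvelope.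
End Envelope.

(** * The semigroup of a permutation *)

Section Theta.
Variables (R : realType) (m n : nat) (theta : {perm 'I_m * 'I_n}).
Local Notation C := R[i].
Local Notation letter := (letter m n).
Local Notation fock := (fock R m n).
Local Notation ix := mxvec_index.
Local Notation cls := (Ftheta_class theta).
Local Notation cong := (theta_cong theta).
Implicit Types (H K : hilbertType R) (z : seq letter) (w : Ftheta theta).

Definition theta_mx : 'M[C]_(m * n) := \matrix_(r, c) \sum_(p : 'I_m * 'I_n)
  ((r == ix p.1 p.2) && (c == ix (theta p).1 (theta p).2))%:R.

Lemma theta_mxE i j i' j' : theta_mx (ix i j) (ix i' j') = (theta (i, j) == (i', j'))%:R.
Proof.
rewrite mxE (bigD1 (i, j))//= big1 ?addr0 => [|[a b]]; last first.
  by rewrite mxvec_indexE xpair_eqE (eq_sym i) (eq_sym j) => /negPf ->.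
rewrite eqxx mxvec_indexE; case: (theta (i, j)) => a b /=.
by rewrite xpair_eqE (eq_sym a) (eq_sym b).
Qed.

Lemma sum_theta_mx (V : lmodType C) i j (G : 'I_m -> 'I_n -> V) :
  \sum_i' \sum_j' theta_mx (ix i j) (ix i' j') *: G i' j' =
  G (theta (i, j)).1 (theta (i, j)).2.
Proof.
under eq_bigr do under eq_bigr do rewrite theta_mxE.
rewrite pair_bigA /= (bigD1 (theta (i, j)))//= -surjective_pairing eqxx scale1r.
by rewrite big1 ?addr0// => -[a b] /negPf ab; rewrite eq_sym ab scale0r.
Qed.

Lemma theta_mx_unitary : theta_mx \is unitarymx.
Proof.
apply/unitarymxP/matrixP => r s; rewrite !mxE.
case/mxvec_indexP: r => i j; case/mxvec_indexP: s => i' j'.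
rewrite mxvec_indexE sum_mxvec_index.
have := sum_theta_mx i j (fun a b => (theta_mx (ix i' j') (ix a b))^* : C^o).
rewrite theta_mxE -surjective_pairing (inj_eq perm_inj) xpair_eqE => E.
transitivity ((((i' == i) && (j' == j))%:R)^* : C); last by rewrite rmorph_nat (eq_sym i) (eq_sym j).
rewrite -E; apply: eq_bigr => a _; apply: eq_bigr => b _.
by rewrite !mxE.
Qed.

Local Notation u := theta_mx.
Let uu := theta_mx_unitary.

Lemma theta_cong_wev H (f : letter -> H -> H) z z' : rel_rep u f -> cong z z' ->
  wev f z = wev f z'.
Proof.
move=> rf; elim=> [x y i j|//|x y _ ->//|x y t _ -> _ ->//].
rewrite !wev_cat; congr (_ \o (_ \o _)).
by have := rel_ef rf i j; rewrite sum_theta_mx.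
Qed.

(** A letter f passes the letters e one at a time, by the inverse of theta. *)
Lemma theta_normal_form z : exists s : fock_basis m n, cong z (word_of s).
Proof.
have cons x z1 z2 : cong z1 z2 -> cong (x :: z1) (x :: z2).
  by move=> h; apply: (theta_cong_cat (theta_cong_refl _ [:: x]) h).
have move_f j (w : seq 'I_m) (v : seq 'I_n) :
    exists s : fock_basis m n, cong (inr j :: word_of (w, v)) (word_of s).
  elim: w j => [|i w IH] j; first by exists ([::], j :: v); exact: theta_cong_refl.
  pose p := (theta^-1)%g (i, j); have [[w' v'] hs] := IH p.2.
  exists (p.1 :: w', v'); apply: theta_cong_trans (cons (inl p.1) _ _ hs).
  apply: theta_cong_sym; have := theta_cong_rel theta [::] (word_of (w, v)) p.1 p.2.
  by rewrite -surjective_pairing permKV.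
elim: z => [|x z [[w v] h]]; first by exists ([::], [::]); exact: theta_cong_refl.
case: x => [i|j].
  by exists (i :: w, v); exact: (cons (inl i) _ _ h).
by have [s hs] := move_f j w v; exists s; apply: theta_cong_trans hs; exact: cons.
Qed.

Lemma theta_tensor z z' : cong z z' -> tensor u z = tensor u z'.
Proof.
move=> h; rewrite -[z]cats0 -[z']cats0 !tensor_wev//.
by rewrite (theta_cong_wev (creation_rel uu) h).
Qed.

(** Tensors of words are basis vectors indexed by normal forms, so that the Fock
    space separates the elements of the semigroup. *)
Lemma theta_tensor_inj z z' : tensor u z = tensor u z' -> cong z z'.
Proof.
have [s hs] := theta_normal_form z; have [t ht] := theta_normal_form z'.
rewrite (theta_tensor hs) (theta_tensor ht) !tensor_word_of => E.
suff st : s = t by rewrite st in hs; exact: theta_cong_trans hs (theta_cong_sym ht).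
have := congr1 (fun x => l2fun x s) E.
by rewrite !deltaE eqxx; case: eqP => // _ /eqP; rewrite oner_eq0.
Qed.

Lemma cls_cong z z' : cls z = cls z' -> cong z z'.
Proof.
move=> E; apply: theta_cong_trans (Ftheta_classK _ z'); rewrite -E.
exact/theta_cong_sym/Ftheta_classK.
Qed.

Lemma hdot_theta_tensor z z' :
  hdot (tensor u z) (tensor u z') = (cls z == cls z')%:R.
Proof.
have [s hs] := theta_normal_form z; have [t ht] := theta_normal_form z'.
rewrite (theta_tensor hs) (theta_tensor ht) !tensor_word_of hdot_deltas.
rewrite (Ftheta_classP hs) (Ftheta_classP ht); congr (_%:R); congr nat_of_bool.
apply/eqP/eqP => [->//|/cls_cong/theta_tensor]; rewrite !tensor_word_of.
move=> /(congr1 (fun x => l2fun x s)).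
by rewrite !deltaE eqxx; case: eqP => // _ /eqP; rewrite oner_eq0.
Qed.

Lemma cls_cat z z' : cls (z ++ z') = (cls z * cls z')%g.
Proof. by rewrite -Ftheta_mulE. Qed.

(** The creation operators are injective. *)
Lemma theta_cancel w : injective (fun x => w * x)%g.
Proof.
move=> x y; rewrite -[w]Ftheta_reprK -[x]Ftheta_reprK -[y]Ftheta_reprK.
rewrite -!cls_cat => E; apply/Ftheta_classP/theta_tensor_inj.
have := theta_tensor (cls_cong E).
elim: (repr w) => //= a z IH; rewrite !tensor_cons// => h; apply: IH.
apply/subr0_eq/rn_eq0; rewrite -(isometric_rn (creation_isometric uu a)).
by rewrite (linB (bounded_lin (creation_bounded uu a))) h subrr rn0.
Qed.

Local Notation lam := (regular_rep theta (R := R)).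
Local Notation l := (fun x : letter => lam (cls [:: x])).

Lemma regular_repP w : [/\ bounded_op (lam w), isometric (lam w) &
  forall x, lam w (delta R x) = delta R (w * x)%g].
Proof.
apply: of_basisP => x y; rewrite hdot_deltas (inj_eq (@theta_cancel w)).
by [].
Qed.

Lemma regular_rep_bounded w : bounded_op (lam w). Proof. by case: (regular_repP w). Qed.
Lemma regular_rep_delta w x : lam w (delta R x) = delta R (w * x)%g.
Proof. by case: (regular_repP w). Qed.

Lemma regular_rep_wev z : lam (cls z) = wev l z.
Proof.
have bl := regular_rep_bounded.
apply: bounded_eq_basis => [||x]; [exact: bl|exact: wev_bounded|].
rewrite regular_rep_delta; elim: z => [|a z IH] /=; first by rewrite mul1g.
by rewrite -IH regular_rep_delta -cat1s cls_cat mulgA.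
Qed.

(** Normal forms match the standard bases of the two spaces; the resulting
    isometries in both directions intertwine the generators. *)
Lemma regular_rep_norm (I : finType) (p : I -> I -> ncpoly R letter) c : 0 <= c ->
  mxbound (fun i j => pev l (p i j)) c <->
  mxbound (fun i j => pev (creation u) (p i j)) c.
Proof.
move=> c0; have bl := regular_rep_bounded; have bc := creation_bounded uu.
have [U [bU iU Ud]] : exists U : l2 R (Ftheta theta) -> fock, [/\ bounded_op U,
    isometric U & forall x, U (delta R x) = tensor u (repr x)].
  exists (of_basis (fun x : Ftheta theta => tensor u (repr x))); apply: of_basisP => x y.
  by rewrite hdot_theta_tensor !Ftheta_reprK.
have [V [bV iV Vd]] : exists V : fock -> l2 R (Ftheta theta), [/\ bounded_op V,
    isometric V & forall s, V (delta R s) = delta R (cls (word_of s))].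
  exists (of_basis (fun s => delta R (cls (word_of s)))); apply: of_basisP => s t.
  by rewrite hdot_deltas -hdot_theta_tensor !tensor_word_of hdot_deltas.
split; [apply: (intertwine_mxbound bV iV _ c0)|apply: (intertwine_mxbound bU iU _ c0)] => x.
  apply: bounded_eq_basis => [||s]; [exact: bounded_comp|exact: bounded_comp|].
  transitivity (V (creation u x (delta R s))) => //.
  transitivity (l x (V (delta R s))) => //.
  rewrite creation_delta// Vd regular_rep_delta -(cls_cat [:: x]).
  have [t ht] := theta_normal_form (x :: word_of s).
  by rewrite (theta_tensor ht) tensor_word_of Vd (Ftheta_classP ht).
apply: bounded_eq_basis => [||y]; [exact: bounded_comp|exact: bounded_comp|].
transitivity (U (l x (delta R y))) => //; transitivity (creation u x (U (delta R y))) => //.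
rewrite Ud regular_rep_delta Ud -tensor_cons//; apply: theta_tensor.
by rewrite -{1}[y]Ftheta_reprK -(cls_cat [:: x]); exact: Ftheta_classK.
Qed.

Lemma semigroup_algebraE : semigroup_algebra theta R = opalg_gen (range l).
Proof.
have bl := regular_rep_bounded.
apply: opalg_gen_eq => [_ [w _ <-]|_ [x _ <-]|_ [w _ <-]|_ [x _ <-]] //.
  rewrite -[w]Ftheta_reprK regular_rep_wev; apply: (@opalg_wev _ _ _ l).
    by apply: opalg_gen_opalg => _ [x _ <-].
  by move=> x; apply: gen_opalg; exists x.
by apply: gen_opalg; exists (cls [:: x]).
Qed.

Section Representations.
Variables (H : hilbertType R) (sigma : Ftheta theta -> H -> H).
Hypothesis hs : theta_star_representation sigma.
Local Notation f := (fun x : letter => sigma (cls [:: x])).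

Lemma theta_rep_wev z : sigma (cls z) = wev f z.
Proof.
elim: z => [|x z IH]; first exact: (theta_rep1 hs).
by rewrite -cat1s cls_cat (theta_repM hs) IH.
Qed.

Lemma theta_rep_star : star_rep u f.
Proof.
split=> [i|j|i j|i|j||]; try exact: (theta_rep_bounded hs).
- rewrite sum_theta_mx -!(theta_repM hs) -!cls_cat.
  congr (sigma _); apply: Ftheta_classP.
  exact: (theta_cong_rel theta [::] [::] i j).
- exact: (theta_rep_isometric hs).
- exact: (theta_rep_isometric hs).
- exact: (theta_rep_sum_e hs).
- exact: (theta_rep_sum_f hs).
Qed.

Lemma cstar_gen_theta_rep : cstar_gen (range sigma) = cstar_gen (range f).
Proof.
have bs := theta_rep_bounded hs.
apply: cstar_gen_eq => [_ [w _ <-]|_ [x _ <-]|_ [w _ <-]|_ [x _ <-]] //.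
  rewrite -[w]Ftheta_reprK theta_rep_wev; apply: (@opalg_wev _ _ _ f).
    by apply/cstar_operator_algebra/cstar_gen_cstar => _ [x _ <-].
  by move=> x; apply: gen_cstar; exists x.
by apply: gen_cstar; exists (cls [:: x]).
Qed.

End Representations.

Definition theta_rep_of H (f : letter -> H -> H) w := wev f (repr w).

Section Converse.
Variables (H : hilbertType R) (f : letter -> H -> H).
Hypothesis sf : star_rep u f.

Lemma theta_rep_of_cls z : theta_rep_of f (cls z) = wev f z.
Proof. exact: (theta_cong_wev (star_rel uu sf) (Ftheta_classK _ z)). Qed.

Lemma theta_rep_ofP : theta_star_representation (theta_rep_of f).
Proof.
have bf := star_bounded sf.
have gE x : theta_rep_of f (cls [:: x]) = f x by exact: theta_rep_of_cls.
split=> [w||w z|w||].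
- exact: wev_bounded.
- exact: (theta_rep_of_cls [::]).
- by rewrite -{1}[w]Ftheta_reprK -{1}[z]Ftheta_reprK -cls_cat theta_rep_of_cls wev_cat.
- rewrite /theta_rep_of; elim: (repr w) => [|x z IH] y //=.
  by rewrite (star_isometric sf) IH.
- by rewrite -(star_rep_sumA sf); apply: eq_bigr => i _; rewrite gE.
- by rewrite -(star_rep_sumB sf); apply: eq_bigr => i _; rewrite gE.
Qed.

End Converse.

Lemma semigroup_cstar_exists : (0 < m)%N -> (0 < n)%N ->
  exists (K : hilbertType R) (O : set (K -> K)) (sigma : Ftheta theta -> K -> K),
    is_semigroup_cstar O sigma.
Proof.
move=> m0 n0; have [L [g [sg dg]]] := exists_dominating uu m0 n0.
exists L, (cstar_gen (range (theta_rep_of g))), (theta_rep_of g).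
have hg := theta_rep_ofP sg.
have gE : (fun x => theta_rep_of g (cls [:: x])) = g.
  by apply/funext => x; exact: theta_rep_of_cls.
split=> // H sigma' hs'.
have sg' := theta_rep_star hs'.
exists (graph_ext (poly_graph (srep g) (srep (fun x => sigma' (cls [:: x]))))).
  by rewrite (cstar_gen_theta_rep hg) gE; exact: (extension_star_hom uu sg dg sg').
move=> w; rewrite -[w in RHS]Ftheta_reprK (theta_rep_wev hs').
apply: star_hom_wev => [x||x]; first exact: star_bounded sg x.
  exact: (extension_star_hom uu sg dg sg').
exact: (extension_gen uu sg dg sg').
Qed.

Lemma semigroup_cstar_envelope (K : hilbertType R) (O : set (K -> K))
    (sigma : Ftheta theta -> K -> K) : (0 < m)%N -> (0 < n)%N ->
  is_semigroup_cstar O sigma ->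
  exists phi : (l2 R (Ftheta theta) -> l2 R (Ftheta theta)) -> (K -> K),
    is_cstar_envelope (semigroup_algebra theta R) O phi /\
    forall w, phi (lam w) = sigma w.
Proof.
move=> m0 n0 [hs -> univ]; have [L [g [sg dg]]] := exists_dominating uu m0 n0.
have sf := theta_rep_star hs; have bl := regular_rep_bounded.
have [s hom_s sE] := univ _ _ (theta_rep_ofP sg).
rewrite (cstar_gen_theta_rep hs) in hom_s *.
have df : dominating u (fun x => sigma (cls [:: x])).
  move=> I p c; apply: (hom_dominating sf sg dg hom_s) => x.
  by rewrite sE theta_rep_of_cls.
exists (graph_ext (poly_graph l (fun x => sigma (cls [:: x])))); split.
  by rewrite semigroup_algebraE; apply: (is_envelope uu _ sf df) => //; exact: regular_rep_norm.
move=> w; rewrite -[w]Ftheta_reprK regular_rep_wev (theta_rep_wev hs) -!pev_word.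
by apply: (envelope_phi_pev uu) => //; exact: regular_rep_norm.
Qed.

End Theta.

(** * The universal algebra *)

Section Cuntz.
Variables (R : realType) (m n : nat) (u : 'M[R[i]]_(m * n)).
Hypothesis u_unitary : u \is unitarymx.
Local Notation letter := (letter m n).

Definition on_letters (V : Type) (A : 'I_m -> V) (B : 'I_n -> V) (x : letter) : V :=
  match x with inl i => A i | inr j => B j end.

Lemma range_on_letters (V : Type) (A : 'I_m -> V) (B : 'I_n -> V) :
  range A `|` range B = range (on_letters A B).
Proof.
apply/seteqP; split=> [y [[i _ <-]|[j _ <-]]|_ [[i|j] _ <-]].
- by exists (inl i).
- by exists (inr j).
- by left; exists i.
- by right; exists j.
Qed.

Lemma cuntz_exists : (0 < m)%N -> (0 < n)%N ->
  exists (K : hilbertType R) (O : set (K -> K))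
    (A : 'I_m -> K -> K) (B : 'I_n -> K -> K), is_generalised_cuntz u O A B.
Proof.
move=> m0 n0; have [L [g [sg dg]]] := exists_dominating u_unitary m0 n0.
pose A i := g (inl i); pose B j := g (inr j).
have gE : on_letters A B = g by apply/funext => -[].
exists L, (cstar_gen (range A `|` range B)), A, B; split=> // H A' B' sAB.
have sg' : star_rep u (on_letters A' B') by [].
exists (graph_ext (poly_graph (srep g) (srep (on_letters A' B')))).
have e := extension_gen u_unitary sg dg sg'.
split=> [|i|j]; [|exact: (e (inl i))|exact: (e (inr j))].
by rewrite range_on_letters gE; exact: (extension_star_hom u_unitary sg dg sg').
Qed.

Section Universal.
Variables (K : hilbertType R) (O : set (K -> K)) (A : 'I_m -> K -> K) (B : 'I_n -> K -> K).
Hypothesis uO : is_generalised_cuntz u O A B.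
Local Notation f := (on_letters A B).

Lemma cuntz_star_rep : star_rep u f. Proof. exact: (cuntz_rep uO). Qed.

Lemma cuntz_genE : O = cstar_gen (range f).
Proof. by rewrite (cuntz_gen uO) range_on_letters. Qed.

(** The universal property gives a *-homomorphism to the algebra of a dominating
    representation. *)
Lemma cuntz_dominating : (0 < m)%N -> (0 < n)%N -> dominating u f.
Proof.
move=> m0 n0; have [L [g [sg dg]]] := exists_dominating u_unitary m0 n0.
have [s [hs sA sB]] := cuntz_universal uO sg; rewrite cuntz_genE in hs.
move=> I p c; apply: (hom_dominating cuntz_star_rep sg dg hs) => -[i|j].
  exact: sA.
exact: sB.
Qed.

Lemma cuntz_envelope : (0 < m)%N -> (0 < n)%N ->
  exists phi : (fock R m n -> fock R m n) -> (K -> K),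
    [/\ is_cstar_envelope (unitary_relation_algebra u) O phi,
        forall i, phi (L_e u i) = A i & forall j, phi (L_f u j) = B j].
Proof.
move=> m0 n0; have df := cuntz_dominating m0 n0; have sf := cuntz_star_rep.
have bc := creation_bounded u_unitary.
have lE : on_letters (L_e u) (L_f u) = creation u by apply/funext => -[].
exists (graph_ext (poly_graph (creation u) f)).
have e := envelope_phi_gen u_unitary bc sf (fun _ _ _ _ => iff_refl _).
split=> [|i|j]; [|exact: (e (inl i))|exact: (e (inr j))].
rewrite cuntz_genE /unitary_relation_algebra range_on_letters lE.
exact: (is_envelope u_unitary bc sf df (fun _ _ _ _ => iff_refl _)).
Qed.

Lemma cuntz_tail_faithful (tau : nat -> 'I_m * 'I_n) (L : hilbertType R)
    (iota : nat -> fock R m n -> L) : (0 < m)%N -> (0 < n)%N ->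
  is_tail_space u tau iota ->
  exists sigma : (K -> K) -> (L -> L),
    [/\ star_hom O sigma, set_inj O sigma,
        forall i, sigma (A i) = tail_rep u iota (inl i) &
        forall j, sigma (B j) = tail_rep u iota (inr j)].
Proof.
move=> m0 n0 Liota; have df := cuntz_dominating m0 n0; have sf := cuntz_star_rep.
have sg := tail_star_rep u_unitary Liota.
have dg : dominating u (tail_rep u iota).
  by move=> I p c c0; exact: (tail_dominates u_unitary Liota c0).
exists (graph_ext (poly_graph (srep f) (srep (tail_rep u iota)))).
have e := extension_gen u_unitary sf df sg.
split=> [||i|j]; [| |exact: (e (inl i))|exact: (e (inr j))].
- by rewrite cuntz_genE; exact: (extension_star_hom u_unitary sf df sg).
- by rewrite cuntz_genE; exact: (extension_inj u_unitary sf df sg dg).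
Qed.

End Universal.
End Cuntz.

Theorem theorem3p6 (R : realType) (m n : nat)
    (m_gt0 : (0 < m)%N) (n_gt0 : (0 < n)%N)
    (u : 'M[R[i]]_(m * n)) (u_unitary : u \is unitarymx) :
  (* O_{X_u} exists, and it is the C*-envelope of A_u *)
  (exists (K : hilbertType R) (O : set (K -> K))
     (A : 'I_m -> K -> K) (B : 'I_n -> K -> K), is_generalised_cuntz u O A B) /\
  (forall (K : hilbertType R) (O : set (K -> K))
     (A : 'I_m -> K -> K) (B : 'I_n -> K -> K), is_generalised_cuntz u O A B ->
   exists phi : (fock R m n -> fock R m n) -> (K -> K),
     [/\ is_cstar_envelope (unitary_relation_algebra u) O phi,
         forall i, phi (L_e u i) = A i & forall j, phi (L_f u j) = B j]) /\
  (* C*(F_theta^+) exists, and it is the C*-envelope of A_theta *)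
  (forall theta : {perm 'I_m * 'I_n},
   (exists (K : hilbertType R) (O : set (K -> K)) (sigma : Ftheta theta -> K -> K),
      is_semigroup_cstar O sigma) /\
   (forall (K : hilbertType R) (O : set (K -> K)) (sigma : Ftheta theta -> K -> K),
      is_semigroup_cstar O sigma ->
    exists phi : (l2 R (Ftheta theta) -> l2 R (Ftheta theta)) -> (K -> K),
      is_cstar_envelope (semigroup_algebra theta R) O phi /\
      forall w, phi (regular_rep theta w) = sigma w)) /\
  (* every tail representation extends to a faithful representation of O_{X_u} *)
  (forall tau : nat -> 'I_m * 'I_n,
   (exists (L : hilbertType R) (iota : nat -> fock R m n -> L),
      is_tail_space u tau iota) /\
   (forall (L : hilbertType R) (iota : nat -> fock R m n -> L),
      is_tail_space u tau iota ->
    forall (K : hilbertType R) (O : set (K -> K))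
      (A : 'I_m -> K -> K) (B : 'I_n -> K -> K), is_generalised_cuntz u O A B ->
    exists sigma : (K -> K) -> (L -> L),
      [/\ star_hom O sigma, set_inj O sigma,
          forall i, sigma (A i) = tail_rep u iota (inl i) &
          forall j, sigma (B j) = tail_rep u iota (inr j)])).
Proof.
split; first exact: cuntz_exists.
split=> [K O A B uO|]; first exact: cuntz_envelope uO m_gt0 n_gt0.
split=> [theta|tau].
  split; first exact: semigroup_cstar_exists.
  by move=> K O sigma hs; exact: semigroup_cstar_envelope.
split; first exact: tail_space_exists.
by move=> L iota Liota K O A B uO; exact: cuntz_tail_faithful Liota.
Qed.
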